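(* Problem $(P^{\triangle})$ can be solved in strongly polynomial time.
   Context: An instance of $(P^{\triangle})$ consists of a matroid $\mathcal{M}=(E,\mathcal{B})$ on a finite ground set $E$ with base set $\mathcal{B}$ (given by an independence oracle), cost functions $c_1,c_2\colon E\to\mathbb{R}$, and a penalty function $C\colon\mathbb{N}\to\mathbb{R}$ (whose values can be queried). The problem is to minimize $c_1(X)+c_2(Y)+C(|X\triangle Y|)$ over all $X,Y\in\mathcal{B}$, where $c_i(S)=\sum_{e\in S}c_i(e)$ and $X\triangle Y=(X\setminus Y)\cup(Y\setminus X)$. *)

(* Defs.v *)
From HB Require Import structures.
From mathcomp Require Import all_boot all_order all_algebra.
From mathcomp Require Import reals.

Set Implicit Arguments.
Unset Strict Implicit.
Unset Printing Implicit Defensive.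

Import Order.TTheory GRing.Theory Num.Theory.
Local Open Scope ring_scope.

Record matroid (E : finType) := Matroid {
  bases : {set {set E}};
  bases_neq0 : bases != set0;
  bases_exchange : forall (A B : {set E}) (x : E),
    A \in bases -> B \in bases -> x \in A :\: B ->
    exists2 y, y \in B :\: A & y |: (A :\ x) \in bases
}.

Definition indep (E : finType) (M : matroid E) (S : {set E}) : bool :=
  [exists B in bases M, S \subset B].

Definition symdiff (E : finType) (X Y : {set E}) : {set E} :=
  (X :\: Y) :|: (Y :\: X).

(* [T] is the type of the numbers of an instance: the reals in general, [rat]
   when encoding lengths are measured. *)
Record instance (T : Type) (E : finType) := Instance {
  imat : matroid E;
  cost1 : E -> T;
  cost2 : E -> T;
  penalty : nat -> T
}.

Definition map_instance (T U : Type) (f : T -> U) (E : finType)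
    (I : instance T E) : instance U E :=
  Instance (imat I) (f \o cost1 I) (f \o cost2 I) (f \o penalty I).

Section Problem.
Variables (R : realType) (E : finType) (I : instance R E).

Definition feasible (X Y : {set E}) : Prop :=
  X \in bases (imat I) /\ Y \in bases (imat I).

Definition objective (X Y : {set E}) : R :=
  \sum_(e in X) cost1 I e + \sum_(e in Y) cost2 I e
  + penalty I #|symdiff X Y|.

Definition optimal (X Y : {set E}) : Prop :=
  feasible X Y /\
  forall X' Y', feasible X' Y' -> objective X Y <= objective X' Y'.

End Problem.

(* Model of computation: structured programs over a random access memory with
   two banks of cells, one for natural numbers and one for real numbers.  The
   two kinds of numbers do not mix: there is no rounding of a real to a natural
   number.  Natural numbers can only be added and subtracted, so that in [t]
   steps their bit length grows by at most [t]; unit-cost multiplication is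
   allowed for reals only. *)

(* [Dir i] is cell [i]; [Ind i] is the cell whose number is stored in cell [i]
   of the bank of naturals. *)
Inductive addr := Dir of nat | Ind of nat.

(* The first address is always the destination. *)
Inductive instr :=
  | NCst of addr & nat
  | NMov of addr & addr
  | NAdd of addr & addr & addr
  | NSub of addr & addr & addr
  | RCst of addr & int
  | RMov of addr & addr
  | RAdd of addr & addr & addr
  | RSub of addr & addr & addr
  | RMul of addr & addr & addr
  | RDiv of addr & addr & addr
  | AskIndep of addr & addr
  | AskPenalty of addr & addr.

Inductive test :=
  | NLe of addr & addr
  | NLt of addr & addr
  | RLe of addr & addr
  | RLt of addr & addr.

Inductive prog :=
  | Skip
  | Do of instr
  | Seq of prog & prog
  | If of test & prog & prog
  | While of test & prog.

Definition update (T : Type) (m : nat -> T) (a : nat) (v : T) : nat -> T :=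
  fun b => if b == a then v else m b.

Record state (R : Type) := State { nmem : nat -> nat; rmem : nat -> R }.

Definition loc (R : Type) (s : state R) (a : addr) : nat :=
  match a with Dir i => i | Ind i => nmem s i end.

Definition nval (R : Type) (s : state R) (a : addr) : nat := nmem s (loc s a).

Definition rval (R : Type) (s : state R) (a : addr) : R := rmem s (loc s a).

Definition nset (R : Type) (s : state R) (d : addr) (v : nat) : state R :=
  State (update (nmem s) (loc s d) v) (rmem s).

Definition rset (R : Type) (s : state R) (d : addr) (v : R) : state R :=
  State (nmem s) (update (rmem s) (loc s d) v).

(* A subset of the ground set is stored as its incidence vector, in [#|E|]
   consecutive cells of the bank of naturals, the first of which is [base]. *)
Definition read_set (R : Type) (E : finType) (s : state R) (base : nat) :
    {set E} :=
  [set e : E | nmem s (base + enum_rank e)%N != 0%N].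

Section Semantics.
Variables (R : realType) (E : finType) (I : instance R E).
Implicit Type s : state R.

Definition step (i : instr) s : state R :=
  match i with
  | NCst d k => nset s d k
  | NMov d a => nset s d (nval s a)
  | NAdd d a b => nset s d (nval s a + nval s b)%N
  | NSub d a b => nset s d (nval s a - nval s b)%N
  | RCst d z => rset s d z%:~R
  | RMov d a => rset s d (rval s a)
  | RAdd d a b => rset s d (rval s a + rval s b)
  | RSub d a b => rset s d (rval s a - rval s b)
  | RMul d a b => rset s d (rval s a * rval s b)
  | RDiv d a b => rset s d (rval s a / rval s b)
  | AskIndep d a => nset s d (indep (imat I) (read_set E s (loc s a)))
  | AskPenalty d a => rset s d (penalty I (nval s a))
  end.

Definition holds (t : test) s : bool :=
  match t with
  | NLe a b => (nval s a <= nval s b)%N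
  | NLt a b => (nval s a < nval s b)%N
  | RLe a b => rval s a <= rval s b
  | RLt a b => rval s a < rval s b
  end.

(* [exec p s tr]: started in state [s], program [p] halts, and [tr] lists the
   states reached after each elementary step, an elementary step being an
   instruction (in particular an oracle call) or the evaluation of a test.
   Hence [size tr] is the running time and [last s tr] the final state. *)
Inductive exec : prog -> state R -> seq (state R) -> Prop :=
  | exec_skip s : exec Skip s [::]
  | exec_do i s : exec (Do i) s [:: step i s]
  | exec_seq p q s tr tr' :
      exec p s tr -> exec q (last s tr) tr' -> exec (Seq p q) s (tr ++ tr')
  | exec_if_true t p q s tr :
      holds t s -> exec p s tr -> exec (If t p q) s (s :: tr)
  | exec_if_false t p q s tr :
      ~~ holds t s -> exec q s tr -> exec (If t p q) s (s :: tr)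
  | exec_while_true t p s tr tr' :
      holds t s -> exec p s tr -> exec (While t p) (last s tr) tr' ->
      exec (While t p) s (s :: tr ++ tr')
  | exec_while_false t p s : ~~ holds t s -> exec (While t p) s [:: s].

(* The elements of [E] are numbered from [0] to [#|E| - 1] by [enum_rank].
   Initially cell [0] of the bank of naturals contains [#|E|], and the bank of
   reals contains the [#|E|] values of [cost1] followed by those of [cost2];
   all other cells contain [0]. *)
Definition init : state R :=
  State (fun a => if a == 0%N then #|E| else 0%N)
        (fun a => nth 0 ([seq cost1 I e | e <- enum E] ++
                         [seq cost2 I e | e <- enum E]) a).

End Semantics.

(* The base addresses of the two output sets are in cells [1] and [2]. *)
Definition outX (R : Type) (E : finType) (s : state R) : {set E} :=
  read_set E s (nmem s 1).
Definition outY (R : Type) (E : finType) (s : state R) : {set E} :=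
  read_set E s (nmem s 2).

Definition solves (R : realType) (p : prog) : Prop :=
  forall (E : finType) (I : instance R E) (tr : seq (state R)),
    exec I p (init I) tr ->
    optimal I (outX E (last (init I) tr)) (outY E (last (init I) tr)).

Definition bits_nat (m : nat) : nat := (trunc_log 2 m).+1.

(* One more bit for the sign. *)
Definition bits_rat (x : rat) : nat :=
  (bits_nat `|numq x| + bits_nat `|denq x|).+1.

(* Since [#|symdiff X Y| <= #|E|], the values of the penalty function that
   belong to the instance are those at [0, ..., #|E|]. *)
Definition bits_instance (E : finType) (J : instance rat E) : nat :=
  (\sum_(e : E) (bits_rat (cost1 J e) + bits_rat (cost2 J e)) +
   \sum_(k < #|E|.+1) bits_rat (penalty J k))%N.

(* The number of elementary steps is bounded by a polynomial in the size of the
   ground set alone, on all instances. *)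
Definition poly_steps (R : realType) (p : prog) : Prop :=
  exists f : {poly nat}, forall (E : finType) (I : instance R E),
    exists2 tr, exec I p (init I) tr & (size tr <= f.[#|E|])%N.

(* On rational instances, all numbers that occur during the computation are
   rational, of bit length polynomial in the encoding length of the instance. *)
Definition poly_numbers (R : realType) (p : prog) : Prop :=
  exists g : {poly nat}, forall (E : finType) (J : instance rat E)
      (I := map_instance (ratr : rat -> R) J) (tr : seq (state R)),
    exec I p (init I) tr ->
    forall t a : nat, exists2 x : rat,
      rmem (nth (init I) tr t) a = ratr x &
      (bits_rat x <= g.[bits_instance J])%N.

Definition strongly_polynomial (R : realType) (p : prog) : Prop :=
  poly_steps R p /\ poly_numbers R p.

(* Main.v *)
Require Import Defs.
From mathcomp Require Import all_boot all_order all_algebra.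
From mathcomp Require Import reals.
From mathcomp Require Import zify ring lra.
From Stdlib Require Import FunctionalExtensionality.

(** All bases have the same size, so the penalty of a pair [(X, Y)] depends only
    on [#|X :&: Y|], and it suffices to find, for every number [k] that occurs,
    a cheapest pair of bases with [k] common elements and to compare the values
    of these few pairs.

    Start from a cheapest base [X0] for the first cost and a cheapest base [Y0]
    for the second one ([greedy_spec]), with [k0] common elements.  A primal-dual
    algorithm lowers the size of the intersection from [k0] on, one by one.
    Its invariant is [certificate]: a potential [p] on the elements, with values
    between [0] and [lam], such that both bases are lightest for their cost minus
    [p], while [p] is [0] on the common elements and [lam] on the elements in
    neither base.  By weak duality ([certificate_le]) such a pair is
    cheapest among the pairs with an intersection of the same size.  An arc
    from [u] to [v] stands for the exchange of [u] for [v] in one of the two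
    bases, and it is tight if the exchange does not change the reduced weight.
    If tight arcs lead from a common element to an element in neither base, the
    exchanges along a path with the fewest arcs are made ([augment]): the lightest
    bases for the reduced weight form a matroid ([minimizers_sym_exchange]), and
    in it the exchanges of a shortest path can be made together
    ([foldl_swap]).  Otherwise [p] is raised outside the set reached by
    tight arcs until a new arc becomes tight ([certificate_raise]); if there is
    no arc to be made tight, the intersection is smallest ([no_arcs_out]).

    Pairs with more than [k0] common elements are found by the same
    algorithm, run on the first matroid and the dual of the second one, since
    replacing [Y] by its complement turns [#|X :&: Y|] into
    [#|X| - #|X :&: Y|].

    The program is written in a small language whose only loops range over
    the ground set.  Its commands are total functions on environments
    ([sem]), which is where correctness is proved ([main_spec]); a compiler to
    the random access machine is verified once and for all ([compile_correct]).
    The number of steps of a compiled command is polynomial in the size of the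
    ground set ([cost_poly]).  No real numbers are multiplied,
    so that over the common denominator of a rational instance each step
    at most doubles the largest numerator; after polynomially many steps all bit
    lengths are polynomial ([strongly_polynomial_additive]). *)

Set Implicit Arguments.
Unset Strict Implicit.
Unset Printing Implicit Defensive.

Import Order.TTheory GRing.Theory Num.Theory.
Local Open Scope ring_scope.

(** * Exchange properties of matroid bases *)

Section SetFamilies.
Variable E : finType.
Implicit Types (A B X Y S : {set E}) (F : {set {set E}}) (u v x y : E).

Definition swap X u v : {set E} := v |: (X :\ u).

Lemma in_swap X u v e : (e \in swap X u v) = (e == v) || (e != u) && (e \in X).
Proof. by rewrite !inE. Qed.

Lemma card_swap X u v : u \in X -> v \notin X -> #|swap X u v| = #|X|.
Proof.
move=> uX vX; have := cardsD1 u X; rewrite uX /swap cardsU1 !inE (negbTE vX).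
by rewrite andbF /= => ->.
Qed.

Definition exchange F := forall A B x, A \in F -> B \in F -> x \in A :\: B ->
  exists2 y, y \in B :\: A & swap A x y \in F.

Definition sym_exchange F := forall A B x, A \in F -> B \in F ->
  x \in A :\: B ->
  exists y, [/\ y \in B :\: A, swap A x y \in F & swap B y x \in F].

Lemma sym_exchangeW F : sym_exchange F -> exchange F.
Proof. by move=> sF A B x AF BF /(sF A B x AF BF) [y [yB sA _]]; exists y. Qed.

Lemma exchange_card F : exchange F -> {in F &, forall A B, #|A| = #|B|}.
Proof.
move=> eF; suff le : {in F &, forall A B, (#|A| <= #|B|)%N}.
  by move=> A B AF BF; apply/eqP; rewrite eqn_leq !le.
move=> A B AF BF; have [m] := ubnP #|A :\: B|; elim: m A AF => // m IH A AF leA.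
case: (set_0Vmem (A :\: B)) => [/eqP|[x xAB]].
  by rewrite setD_eq0 => /subset_leq_card.
have [y yBA sF] := eF _ _ _ AF BF xAB.
move: (xAB) (yBA); rewrite !inE => /andP[xB xA] /andP[yA yB].
rewrite -(card_swap xA yA); apply: IH => //.
suff -> : swap A x y :\: B = (A :\: B) :\ x.
  by move: leA; rewrite (cardsD1 x (A :\: B)) xAB.
apply/setP => e; rewrite !inE; case: (eqVneq e y) => [->|_] /=.
  by rewrite yB andbF.
by case: (e == x); case: (e \in B).
Qed.

(** The element [g] is not in the fundamental circuit of [b] in [X], so that
    exchanging [a] for [b] does not affect which elements may replace [g]. *)
Lemma swap_indep_swap F X a b g f : exchange F -> X \in F ->
    a \in X -> b \notin X -> g \in X -> f \notin X -> g != a -> f != b ->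
    swap X a b \in F -> swap X g b \notin F ->
  (swap (swap X a b) g f \in F) = (swap X g f \in F).
Proof.
move=> eF XF aX bX gX fX ga fb sab sgb; set X1 := swap X a b.
have gf : g != f by apply: contraNneq fX => <-.
have gb : g != b by apply: contraNneq bX => <-.
have af : a != f by apply: contraNneq fX => <-.
have ab : a != b by apply: contraNneq bX => <-.
apply/idP/idP => sF.
- have gD : g \in X :\: swap X1 g f.
    by rewrite !inE (negbTE gf) eqxx gX.
  have [y] := eF _ _ _ XF sF gD.
  rewrite !inE; case: (eqVneq y f) => [-> _ //|_] /=.
  case: (eqVneq y b) => [->|yb] /=; first by rewrite (negbTE sgb).
  by case: (y \in X); rewrite ?andbF.
- have gD : g \in X1 :\: swap X g f.
    by rewrite !inE (negbTE gf) eqxx ga gX orbT.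
  have [y] := eF _ _ _ sab sF gD.
  rewrite !inE; case: (eqVneq y f) => [-> _ //|yf] /=.
  case: (eqVneq y a) => [-> _|ya] /=; last first.
    by case: (y \in X); rewrite ?orbT ?andbF.
  suff -> : swap X1 g a = swap X g b by rewrite (negbTE sgb).
  apply/setP => e; rewrite !inE.
  case: (eqVneq e a) => [->|_] /=; first by rewrite (negbTE ab) eq_sym ga aX.
  by case: (eqVneq e b) => [->|_] /=; rewrite ?[b == g]eq_sym ?gb.
Qed.

(** The pairs are exchanged one after the other.  A pair [(a, b)] that is
    handled before [(g, f)] does not admit the mixed exchange of [g] for [b],
    so that the later exchanges stay possible; this is the uniqueness of the
    perfect matching that underlies augmenting paths. *)
Lemma foldl_swap F X (l : seq (E * E)) : exchange F -> X \in F ->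
    uniq (map fst l) -> uniq (map snd l) ->
    (forall a, a \in l -> [/\ a.1 \in X, a.2 \notin X & swap X a.1 a.2 \in F]) ->
    pairwise (fun a g : E * E => swap X g.1 a.2 \notin F) l ->
  foldl (fun Z a => swap Z a.1 a.2) X l \in F.
Proof.
move=> eF; elim: l X => [|[a b] l IH] X XF //= /andP[al ul] /andP[bl vl] lP.
case/andP=> /allP rl pl.
have [/= aX bX sab] := lP _ (mem_head _ _).
have lP' g : g \in l -> [/\ g.1 \in X, g.2 \notin X & swap X g.1 g.2 \in F].
  by move=> gl; apply: lP; rewrite inE gl orbT.
have ne1 (g : E * E) : g \in l -> g.1 != a.
  by move=> gl; apply: contraNneq al => <-; apply: map_f.
have ne2 (g : E * E) : g \in l -> g.2 != b.
  by move=> gl; apply: contraNneq bl => <-; apply: map_f.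
have stab (g f : E * E) : g \in l -> f \in l ->
    (swap (swap X a b) g.1 f.2 \in F) = (swap X g.1 f.2 \in F).
  move=> gl fl; have [gX _ _] := lP' _ gl; have [_ fX _] := lP' _ fl.
  by apply: swap_indep_swap; rewrite ?ne1 ?ne2 ?rl.
apply: IH => //.
- move=> g gl; have [gX fX sgf] := lP' _ gl.
  by rewrite stab // !in_swap gX (negbTE fX) andbF (negbTE (ne2 _ gl)) ne1 ?orbT.
- rewrite (eq_in_pairwise (P := mem l)
    (r' := fun a g => swap X g.1 a.2 \notin F)) //.
    by move=> g f gl fl; rewrite stab.
Qed.

Lemma swapC X u v : u \in X -> v \notin X -> ~: swap X u v = swap (~: X) v u.
Proof.
move=> uX vX; apply/setP => e; rewrite !inE negb_or negb_and negbK.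
case: (eqVneq e u) => [->|_] /=; last by case: (e == v).
by rewrite andbT; apply: contraNneq vX => <-.
Qed.

(** An exchange between complements is an exchange between the bases in the
    opposite direction: the one-sided axiom would not be enough. *)
Lemma sym_exchangeC F : sym_exchange F -> sym_exchange [set ~: B | B in F].
Proof.
move=> sF _ _ x /imsetP[A AF ->] /imsetP[B BF ->].
rewrite !inE negbK => /andP[xB xA].
have xBA : x \in B :\: A by rewrite !inE xA.
have [y []] := sF _ _ _ BF AF xBA; rewrite !inE => /andP[yB yA] s1 s2.
exists y; rewrite !inE negbK yA yB; split => //.
- by rewrite -swapC // imset_f.
- by rewrite -swapC // imset_f.
Qed.

End SetFamilies.

Section Matroids.
Variables (E : finType) (M : matroid E).
Implicit Types (A B I K : {set E}).

Lemma bases_exchangeP : exchange (bases M).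
Proof. by move=> A B x AM BM xAB; apply: bases_exchange. Qed.

Lemma indepP I : reflect (exists2 B, B \in bases M & I \subset B) (indep M I).
Proof.
by apply: (iffP existsP) => [[B /andP[]]|[B]]; exists B => //; apply/andP.
Qed.

Lemma base_card A B : A \in bases M -> B \in bases M -> #|A| = #|B|.
Proof. exact: exchange_card bases_exchangeP _ _. Qed.

Lemma indep_base I B : B \in bases M -> #|I| = #|B| ->
  indep M I = (I \in bases M).
Proof.
move=> BM cI; apply/indepP/idP => [[A AM IA]|IM]; last by exists I.
suff -> : I = A by [].
by apply/eqP; rewrite eqEcard IA cI (base_card AM BM) leqnn.
Qed.

(** A base around [I] that meets [B] in as many elements as possible lies in
    [I :|: B]: an element outside could be exchanged for one of [B]. *)
Lemma indep_extend I B : indep M I -> B \in bases M ->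
  exists A, [/\ A \in bases M, I \subset A & A \subset I :|: B].
Proof.
move=> /indepP[A0 A0M IA0] BM.
pose P A := (A \in bases M) && (I \subset A).
have PA0 : P A0 by rewrite /P A0M.
case: (@arg_maxnP _ A0 P (fun A => #|A :&: B|) PA0) => A /andP[AM IA] maxA.
exists A; split => //; apply/subsetP => x xA; rewrite inE.
case: (boolP (x \in I)) => //= xI; apply/negPn/negP => xB.
have xAB : x \in A :\: B by rewrite inE xB.
have [y yBA sM] := bases_exchangeP AM BM xAB.
move: (yBA); rewrite inE => /andP[yA yB].
have /maxA : P (swap A x y).
  rewrite /P sM /=; apply/subsetP => e eI; rewrite in_swap (subsetP IA) // andbT.
  by rewrite (_ : e != x) ?orbT //; apply: contraNneq xI => <-.
apply/negP; rewrite /= -ltnNge.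
have -> : swap A x y :&: B = y |: (A :&: B).
  apply/setP => e; rewrite !inE; case: (eqVneq e y) => [->|_] /=; first by rewrite yB.
  by case: (eqVneq e x) => [->|_] //=; rewrite (negbTE xB) andbF.
by rewrite cardsU1 inE (negbTE yA).
Qed.

(** Adding to an independent subset of a base a new element [x] costs the base
    one of its other elements. *)
Lemma indep_swap I B x : indep M (x |: I) -> B \in bases M -> x \notin B ->
    I \subset B ->
  exists y, [/\ y \in B, y \notin I & swap B y x \in bases M].
Proof.
move=> iI BM xB IB; have [A [AM IA AB]] := indep_extend iI BM.
have xA : x \in A by rewrite (subsetP IA) // setU11.
have cA := base_card AM BM.
have : ~~ (B \subset A).
  apply/negP => sBA; have /eqP BA : B == A by rewrite eqEcard sBA cA leqnn.
  by rewrite BA xA in xB.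
case/subsetPn => y yB yA.
have yI : y \notin I by apply: contra yA => yI; rewrite (subsetP IA) // inE yI orbT.
exists y; split => //.
suff <- : A = swap B y x by [].
apply/eqP; rewrite eqEcard card_swap // cA leqnn andbT.
apply/subsetP => e eA; rewrite in_swap.
have := subsetP AB _ eA; rewrite !inE -orbA => /or3P[->//|eI|->].
  rewrite (subsetP IB) // andbT (_ : e != y) ?orbT //.
  by apply: contraNneq yI => <-.
by rewrite andbT (_ : e != y) ?orbT //; apply: contraNneq yA => <-.
Qed.

(** [K] is the fundamental circuit of [x] in [B], without [x].  It
    extends inside [A] to a base that cannot contain [x], since [x |: K] is
    dependent; exchanging [x] against that base picks an element of [K]. *)
Lemma bases_sym_exchange : sym_exchange (bases M).
Proof.
move=> A B x AM BM; rewrite inE => /andP[xB xA].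
pose K := [set y in B | swap B y x \in bases M].
have KB : K \subset B by apply/subsetP => y; rewrite inE => /andP[].
have dK : ~~ indep M (x |: K).
  apply/negP => iK; have [y [yB yK sM]] := indep_swap iK BM xB KB.
  by rewrite inE yB sM in yK.
have iK : indep M K by apply/indepP; exists B.
have [A' [A'M KA' A'A]] := indep_extend iK AM.
have xA' : x \notin A'.
  apply: contra dK => xA'; apply/indepP; exists A' => //.
  by rewrite subUset sub1set xA' KA'.
have xAA' : x \in A :\: A' by rewrite inE xA'.
have [y] := bases_exchangeP AM A'M xAA'; rewrite inE => /andP[yA yA'] sM.
have yK : y \in K by have := subsetP A'A _ yA'; rewrite inE (negbTE yA) orbF.
move: yK; rewrite inE => /andP[yB sBM].
by exists y; rewrite inE yA yB.
Qed.

End Matroids.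

(** * Bases of minimum weight *)

Section Weights.
Variables (R : realFieldType) (E : finType).
Implicit Types (X B : {set E}) (F : {set {set E}}) (w p : E -> R).

Definition weight w X : R := \sum_(e in X) w e.

Lemma weight_swap w X u v : u \in X -> v \notin X ->
  weight w (swap X u v) = weight w X - w u + w v.
Proof.
move=> uX vX; rewrite /weight /swap big_setU1 ?inE ?(negbTE vX) ?andbF //=.
by rewrite [\sum_(e in X) _](big_setD1 u) //=; ring.
Qed.

Lemma weightB w p X : weight (w \- p) X = weight w X - weight p X.
Proof. by rewrite /weight -sumrB. Qed.

Definition minimizers F w : {set {set E}} :=
  [set B in F | [forall A in F, weight w B <= weight w A]].

Lemma minimizersP F w B :
  reflect (B \in F /\ forall A, A \in F -> weight w B <= weight w A)
          (B \in minimizers F w).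
Proof.
rewrite inE; apply: (iffP andP) => [[BF /forallP mB]|[BF mB]]; split => //.
  by move=> A; apply/implyP.
by apply/forallP => A; apply/implyP/mB.
Qed.

(** The two bases produced by a symmetric exchange between two lightest bases
    have the same total weight as these, hence are lightest as well. *)
Lemma minimizers_sym_exchange F w :
  sym_exchange F -> sym_exchange (minimizers F w).
Proof.
move=> sF A B x /minimizersP[AF mA] /minimizersP[BF mB] xAB.
have [y [yBA s1 s2]] := sF _ _ _ AF BF xAB; exists y.
move: (xAB) (yBA); rewrite !in_setD => /andP[xB xA] /andP[yA yB].
have := mA _ s1; have := mB _ s2; rewrite !weight_swap // => l1 l2.
split; rewrite ?yA //; apply/minimizersP; split => // C CF.
  by apply: le_trans (mA _ CF); rewrite weight_swap //; lra.
by apply: le_trans (mB _ CF); rewrite weight_swap //; lra.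
Qed.

Lemma swap_minimizers F w X u v : X \in minimizers F w -> u \in X -> v \notin X ->
  (swap X u v \in minimizers F w) = (swap X u v \in F) && (w v <= w u).
Proof.
move=> /minimizersP[XF mX] uX vX.
apply/minimizersP/andP => [[sF sm]|[sF wvu]]; split => //.
  by have := sm _ XF; rewrite weight_swap //; lra.
by move=> A AF; apply: le_trans (mX _ AF); rewrite weight_swap //; lra.
Qed.

Lemma minimizers_swap_le F w X u v : X \in minimizers F w ->
  u \in X -> v \notin X -> swap X u v \in F -> w u <= w v.
Proof.
by move=> /minimizersP[XF mX] uX vX /mX; rewrite weight_swap //; lra.
Qed.

(** A lightest base that meets [X] in as many elements as possible is [X]:
    otherwise a symmetric exchange brings it closer to [X]. *)
Lemma local_minimizer F w X : sym_exchange F -> X \in F ->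
    (forall u v, u \in X -> v \notin X -> swap X u v \in F -> w u <= w v) ->
  X \in minimizers F w.
Proof.
move=> sF XF loc.
have [B0 B0F mB0] := arg_minP (weight w) XF.
have PB0 : B0 \in minimizers F w by apply/minimizersP.
case: (@arg_maxnP _ B0 (mem (minimizers F w)) (fun B => #|X :&: B|) PB0).
move=> B /= Bm maxB; have /minimizersP[BF mB] := Bm.
case: (set_0Vmem (X :\: B)) => [/eqP|[x xXB]].
  rewrite setD_eq0 => XB; suff -> : X = B by [].
  apply/eqP; rewrite eqEcard XB.
  by rewrite (exchange_card (sym_exchangeW sF) XF BF) leqnn.
have [y [yBX s1 s2]] := sF _ _ _ XF BF xXB.
move: (xXB) (yBX); rewrite !in_setD => /andP[xB xX] /andP[yX yB].
have /maxB : swap B y x \in minimizers F w by rewrite swap_minimizers // s2 loc.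
rewrite leqNgt => /negP[].
have -> : X :&: swap B y x = x |: (X :&: B).
  apply/setP => e; rewrite !inE; case: (eqVneq e x) => [->|_] /=; first by rewrite xX.
  by case: (eqVneq e y) => [->|_] //=; rewrite (negbTE yX).
by rewrite cardsU1 inE (negbTE xB) andbF.
Qed.

End Weights.

(** * Pairs of bases with a prescribed intersection *)

Section Pairs.
Variables (R : realFieldType) (E : finType).
Variables (F : bool -> {set {set E}}) (w : bool -> E -> R).
Hypothesis F_exch : forall b, sym_exchange (F b).

Implicit Types (Z : bool -> {set E}) (p : E -> R) (U : {set E}) (e u v s : E).

Definition both Z : {set E} := Z false :&: Z true.
Definition none Z : {set E} := ~: (Z false :|: Z true).

Definition pair_weight Z : R := weight (w false) (Z false) + weight (w true) (Z true).

Definition swap_arc Z b u v := [&& u \in Z b, v \notin Z b & swap (Z b) u v \in F b].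
Definition slack p b u v : R := w b v - w b u - p v + p u.
Definition tight Z p b u v := swap_arc Z b u v && (slack p b u v <= 0).

(** Linear programming duality: [p] splits the problem into two problems about
    a single base, [lam] is the price of giving up one common element, and the
    last two conditions are complementary slackness. *)
Record certificate Z p (lam : R) : Prop := Certificate {
  cert_min : forall b, Z b \in minimizers (F b) (w b \- p);
  cert_bound : forall e, 0 <= p e <= lam;
  cert_both : {in both Z, forall e, p e = 0};
  cert_none : {in none Z, forall e, p e = lam}
}.

Definition fewest_common Z :=
  forall Z', (forall b, Z' b \in F b) -> (#|both Z| <= #|both Z'|)%N.

Lemma certificate_feasible Z p lam b : certificate Z p lam -> Z b \in F b.
Proof. by move=> /cert_min /(_ b) /minimizersP[]. Qed.

Lemma weight_sum (q : E -> R) U : weight q U = \sum_e q e * (e \in U)%:R.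
Proof.
rewrite /weight big_mkcond /=; apply: eq_bigr => e _.
by case: (e \in U); rewrite ?mulr1 ?mulr0.
Qed.

Lemma card_sum U : #|U|%:R = \sum_e (e \in U)%:R :> R.
Proof.
rewrite -sum1_card natr_sum big_mkcond /=; apply: eq_bigr => e _.
by case: (e \in U).
Qed.

(** For an element of multiplicity [m] in the pair, [(m - 1) * p e] is at least
    [- lam] if [m = 0] and at least [0] if [m = 2], with equality in the
    certified pair; elements are counted through
    [#|none Z| = #|E| - #|Z false| - #|Z true| + #|both Z|]. *)
Lemma certificate_le Z p lam Z' : certificate Z p lam -> (forall b, Z' b \in F b) ->
  pair_weight Z + lam * (#|both Z|%:R - #|both Z'|%:R) <= pair_weight Z'.
Proof.
move=> [Zm pb p0 pl] ZF.
have ZZ b : weight (w b) (Z b) - weight p (Z b) <= weight (w b) (Z' b) - weight p (Z' b).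
  by rewrite -!weightB; have /minimizersP[_] := Zm b; apply.
have cZ b : #|Z' b|%:R = #|Z b|%:R :> R.
  congr (_%:R); have /minimizersP[Zb _] := Zm b.
  exact: exchange_card (sym_exchangeW (@F_exch b)) _ _ (ZF b) Zb.
have main : 0 <= \sum_e
   (p e * (e \in Z' false)%:R + p e * (e \in Z' true)%:R
    - p e * (e \in Z false)%:R - p e * (e \in Z true)%:R
    - lam * ((e \in Z' false)%:R + (e \in Z' true)%:R
             - (e \in Z false)%:R - (e \in Z true)%:R)
    - lam * ((e \in both Z)%:R - (e \in both Z')%:R)).
  apply: sumr_ge0 => e _; have /andP[pe0 pel] := pb e.
  have := p0 e; have := pl e; rewrite !inE.
  case: (e \in Z false); case: (e \in Z true); case: (e \in Z' false);
    case: (e \in Z' true) => /= l0 l1; rewrite ?(l0 isT) ?(l1 isT);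
    rewrite ?mulr1 ?mulr0 ?mul0r; lra.
move: main; rewrite !(sumrB, big_split) /= -!mulr_sumr !(sumrB, big_split) /=.
rewrite -!card_sum -!weight_sum !cZ.
have := ZZ false; have := ZZ true; rewrite /pair_weight; lra.
Qed.

Lemma certificate_opt Z p lam Z' : certificate Z p lam ->
  (forall b, Z' b \in F b) -> #|both Z| = #|both Z'| ->
  pair_weight Z <= pair_weight Z'.
Proof.
by move=> cZ ZF eqk; have := certificate_le cZ ZF; rewrite eqk subrr mulr0 addr0.
Qed.

Lemma arc_slack_ge0 Z p lam b u v : certificate Z p lam -> swap_arc Z b u v ->
  0 <= slack p b u v.
Proof.
move=> cZ /and3P[uZ vZ sF].
by have := minimizers_swap_le (cert_min cZ b) uZ vZ sF; rewrite /slack /=; lra.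
Qed.

Lemma tightE Z p lam b u v : certificate Z p lam -> u \in Z b -> v \notin Z b ->
  tight Z p b u v = (swap (Z b) u v \in minimizers (F b) (w b \- p)).
Proof.
move=> cZ uZ vZ; rewrite (swap_minimizers (cert_min cZ b)) // /tight /swap_arc uZ vZ /=.
by congr (_ && _); rewrite /slack /=; apply/idP/idP; lra.
Qed.

Lemma certificate_init Z : (forall b, Z b \in minimizers (F b) (w b)) ->
  certificate Z (fun=> 0) 0.
Proof.
move=> Zm; split=> // [b|e]; last by rewrite lexx.
have /minimizersP[ZF mZ] := Zm b; apply/minimizersP; split => // A AF.
have w0 B : weight (fun=> 0 : R) B = 0 by rewrite /weight big1.
by rewrite !weightB !w0 !subr0 mZ.
Qed.

(** ** Dual steps *)

Definition raise U p (eps : R) e := if e \in U then p e else p e + eps.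

Definition arcs_out Z U eps p :=
  forall b u v, u \in U -> v \notin U -> swap_arc Z b u v -> eps <= slack p b u v.

(** The step lowers the slacks of the arcs that leave [U] by [eps], and that of
    no other arc; sources keep potential [0] and sinks follow [lam]. *)
Lemma certificate_raise Z p lam U eps : certificate Z p lam ->
    both Z \subset U -> [disjoint none Z & U] -> 0 <= eps -> arcs_out Z U eps p ->
  certificate Z (raise U p eps) (lam + eps).
Proof.
move=> cZ bU nU e0 out; split => [b|e|e eb|e en].
- have ZF := certificate_feasible b cZ; apply: local_minimizer => // u v uZ vZ sF.
  have auv : swap_arc Z b u v by apply/and3P.
  have := arc_slack_ge0 cZ auv; have := out b u v; rewrite /= /slack /raise.
  by case: (u \in U); case: (v \in U) => /= oo; try have := oo isT isT auv; lra.
- have /andP[? ?] := cert_bound cZ e.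
  by rewrite /raise; case: (e \in U); apply/andP; split; lra.
- by rewrite /raise (subsetP bU) // (cert_both cZ).
- by rewrite /raise (disjointFr nU en) (cert_none cZ).
Qed.

(** Without arcs that leave [U] the price of giving up a common element can be
    raised beyond any bound. *)
Lemma no_arcs_out Z p lam U : certificate Z p lam ->
    both Z \subset U -> [disjoint none Z & U] ->
    (forall b u v, u \in U -> v \notin U -> ~~ swap_arc Z b u v) ->
  fewest_common Z.
Proof.
move=> cZ bU nU out Z' ZF; rewrite leqNgt; apply/negP => lt.
(* the new price exceeds the difference [D] of the two weights *)
pose D := pair_weight Z' - pair_weight Z; pose eps := `|D| + `|lam| + 1.
have e0 : 0 <= eps by rewrite /eps !addr_ge0.
have oU : arcs_out Z U eps p by move=> b u v uU vU; rewrite (negbTE (out b u v uU vU)).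
have := certificate_le (certificate_raise cZ bU nU e0 oU) ZF.
have : 1 <= #|both Z|%:R - #|both Z'|%:R :> R.
  by rewrite -natrB ?(ltnW lt) // ler1n subn_gt0.
have : D < lam + eps.
  by rewrite /eps; have := ler_norm D; have := ler_norm (- lam); rewrite normrN; lra.
have : 0 <= lam + eps.
  by rewrite /eps; have := ler_norm (- lam); rewrite normrN; have := normr_ge0 D; lra.
rewrite /D; nra.
Qed.

(** ** Breadth-first search and augmentation *)

(** [R'] is the set reached from the common elements along tight arcs,
    [lev] the distance, [par] the predecessor on a shortest path, and [sd v]
    the base in which the arc from [par v] to [v] makes an exchange.  By the last
    condition no tight arc skips a level. *)
Record searched Z p (R' : {set E}) (lev : E -> nat) (par : E -> option E)
    (sd : E -> bool) : Prop := Searched {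
  srch_both : {in both Z, forall v, [/\ v \in R', lev v = 0%N & par v = None]};
  srch_par : forall v, v \in R' -> v \notin both Z -> exists u,
    [/\ par v = Some u, u \in R', lev v = (lev u).+1 & tight Z p (sd v) u v];
  srch_closed : forall b u v, u \in R' -> tight Z p b u v ->
    v \in R' /\ (lev v <= (lev u).+1)%N
}.

Lemma searched_sub Z p R' lev par sd U : searched Z p R' lev par sd ->
    both Z \subset U ->
    (forall b u v, u \in U -> u \in R' -> v \in R' -> tight Z p b u v -> v \in U) ->
  R' \subset U.
Proof.
move=> [_ sp _] bU cU; apply/subsetP => v; have [m] := ubnP (lev v).
elim: m v => // m IH v lm vR; case: (boolP (v \in both Z)) => [|vb].
  exact: (subsetP bU).
have [u [_ uR lv tv]] := sp v vR vb.
by apply: (cU _ u) tv => //; apply: IH; rewrite // -ltnS -lv.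
Qed.

(** A dual step by the least slack of an outgoing arc keeps the tight arcs
    inside the searched set and makes an outgoing one tight. *)
Lemma searched_grows Z p R' lev par sd eps R2 lev2 par2 sd2 b u v :
    searched Z p R' lev par sd ->
    searched Z (raise R' p eps) R2 lev2 par2 sd2 ->
    u \in R' -> v \notin R' -> swap_arc Z b u v -> slack p b u v = eps ->
  (#|R'| < #|R2|)%N.
Proof.
move=> s1 s2 uR vR auv sl.
have sub : R' \subset R2.
  apply: (searched_sub s1) => [|c x y xR2 xR yR tc].
    by apply/subsetP => e /(srch_both s2)[].
  suff /(srch_closed s2 xR2)[] : tight Z (raise R' p eps) c x y by [].
  by move: tc; rewrite /tight /slack /raise xR yR.
apply: proper_card; apply/properP; split => //; exists v => //.
suff /(srch_closed s2 (subsetP sub u uR))[] :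
  tight Z (raise R' p eps) b u v by [].
by move: sl; rewrite /tight auv /slack /raise uR (negbTE vR) /=; lra.
Qed.

Definition exch_arc Z (a : bool * (E * E)) b :=
  if b == a.1 then swap (Z b) a.2.1 a.2.2 else Z b.

Fixpoint is_trace (l : seq (bool * (E * E))) v s : Prop :=
  if l is a :: l' then a.2.2 = v /\ is_trace l' a.2.1 s else v = s.

Lemma foldl_exch_arc Z l b : foldl exch_arc Z l b =
  foldl (fun X a => swap X a.1 a.2) (Z b) [seq a.2 | a <- l & a.1 == b].
Proof.
elim: l Z => //= a l IH Z; rewrite IH /exch_arc [b == _]eq_sym.
by case: (a.1 == b).
Qed.

(** An inner vertex of the path is in exactly one base, which it leaves for the
    other one; only the two ends change their status. *)
Lemma trace_status l Z v s : is_trace l v s -> v \in none Z -> s \in both Z ->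
    uniq (map (fun a => a.2.1) l) -> uniq (map (fun a => a.2.2) l) ->
    (forall a, a \in l -> a.2.1 \in Z a.1 /\ a.2.2 \notin Z a.1) ->
  both (foldl exch_arc Z l) = both Z :\ s /\ none (foldl exch_arc Z l) = none Z :\ v.
Proof.
elim: l Z v => [|[b [u v]] l IH] Z v' /=.
  move=> -> sn sb; exfalso; move: sn sb; rewrite !inE.
  by case: (s \in Z false).
move=> [<- tr] vn sb /andP[ul uul] /andP[vl uvl] lP {v'}.
have [/= uZ vZ] := lP _ (mem_head _ _).
set Z1 := exch_arc Z (b, (u, v)).
have Z1E c e : (e \in Z1 c) =
    if c == b then (e == v) || (e != u) && (e \in Z c) else e \in Z c.
  by rewrite /Z1 /exch_arc /=; case: (c == b); rewrite ?in_swap.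
have uv : u != v by apply: contraNneq vZ => <-.
case: l IH tr ul vl uul uvl lP => [|[b' [u' v']] l] IH /=.
  move=> us _ _ _ _ _; subst s; split; apply/setP => e; move: sb vn; rewrite !inE !Z1E.
    case: (eqVneq e u) => [->|_]; last first.
      by case: (eqVneq e v) => [->|_] //; case: (b); case: (v \in Z false) => //= _;
       case: (v \in Z true).
    by case: (b); rewrite (negbTE uv) ?andbF.
  case: (eqVneq e u) => [->|_].
    by rewrite (negbTE uv); case: (b) => /= /andP[-> ->].
  by case: (eqVneq e v) => [->|_] //; case: (b); rewrite ?orbT.
move=> [v'u tr] ul vl uul uvl lP; subst v'.
have [/= u'Z' uZ'] : u' \in Z b' /\ u \notin Z b'.
  by apply: (lP (b', (u', u))); rewrite inE mem_head orbT.
have b'b : b' = ~~ b.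
  by case: (eqVneq b' b) uZ' => [->|]; [rewrite uZ | case: (b'); case: (b)].
subst b'.
have un : u \in none Z1.
  by move: uZ'; rewrite !inE !Z1E (negbTE uv) eqxx /=; case: (b) => /= /negbTE->.
have sb1 : s \in both Z1.
  have su : s != u.
    by apply: contraNneq uZ' => <-; move: sb; rewrite !inE; case: (b) => /= /andP[].
  move: sb; rewrite !inE !Z1E su.
  by case: (b) => /= /andP[-> ->]; rewrite ?orbT.
have lP1 a : a \in (~~ b, (u', u)) :: l -> a.2.1 \in Z1 a.1 /\ a.2.2 \notin Z1 a.1.
  move=> al; have al' : a \in [:: (b, (u, v)), (~~ b, (u', u)) & l].
    by rewrite inE al orbT.
  have [aZ1 aZ2] := lP a al'.
  have au : a.2.1 != u by apply: contraNneq ul => <-; apply: (map_f (fun a => a.2.1) al).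
  have av : a.2.2 != v by apply: contraNneq vl => <-; apply: (map_f (fun a => a.2.2) al).
  by rewrite !Z1E au (negbTE av) aZ1 (negbTE aZ2) andbF orbT !if_same.
have [-> ->] := IH Z1 u (conj erefl tr) un sb1 uul uvl lP1.
split; apply/setP => e; rewrite !inE !Z1E; last first.
  case: (eqVneq e u) => [->|_] /=.
    by rewrite (negbTE uv); case: (b) uZ uZ' => /= -> /negbTE->.
  by case: (eqVneq e v) => [->|_] //; case: (b); rewrite /= ?orbT.
case: (eqVneq e u) => [->|_].
  by rewrite (negbTE uv); case: (b) uZ uZ' => /= -> /negbTE->; rewrite ?andbF.
case: (eqVneq e v) => [->|_]; last by rewrite !if_same.
by move: vn; rewrite !inE negb_or; case: (b) => /= /andP[/negbTE-> /negbTE->]; rewrite ?andbF.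
Qed.

Section Augment.
Variables (Z : bool -> {set E}) (p : E -> R) (lam : R).
Variables (R' : {set E}) (lev : E -> nat) (par : E -> option E) (sd : E -> bool).
Hypotheses (cZ : certificate Z p lam) (sR : searched Z p R' lev par sd).

Fixpoint trace k v : seq (bool * (E * E)) :=
  if k is k'.+1 then
    if par v is Some u then (sd v, (u, v)) :: trace k' u else [::]
  else [::].

Lemma trace_arcs k v : v \in R' ->
  {in trace k v, forall a,
    [/\ a.2.1 \in R', tight Z p a.1 a.2.1 a.2.2, lev a.2.2 = (lev a.2.1).+1
      & (lev a.2.2 <= lev v)%N]}.
Proof.
elim: k v => [|k IH] v vR //=; case pv: (par v) => [u|] //.
have vb : v \notin both Z by apply/negP => /(srch_both sR)[_ _]; rewrite pv.
have [u' [pv' uR lv tv]] := srch_par sR vR vb.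
have uu' : u = u' by rewrite pv in pv'; case: pv'.
subst u'.
move=> a; rewrite inE => /predU1P[->|al] //=.
have [? ? ? ?] := IH u uR a al; split => //; rewrite lv.
exact: leqW.
Qed.

Lemma trace_pairwise k v : v \in R' ->
  pairwise (fun a g => lev g.2.2 <= lev a.2.1)%N (trace k v).
Proof.
elim: k v => [|k IH] v vR //=; case pv: (par v) => [u|] //.
have vb : v \notin both Z by apply/negP => /(srch_both sR)[_ _]; rewrite pv.
have [u' [pv' uR lv tv]] := srch_par sR vR vb.
have uu' : u = u' by rewrite pv in pv'; case: pv'.
subst u'.
by rewrite /= IH // andbT; apply/allP => a /(trace_arcs uR)[].
Qed.

Lemma trace_source k v : v \in R' -> (lev v <= k)%N ->
  exists2 s, s \in both Z & is_trace (trace k v) v s.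
Proof.
elim: k v => [|k IH] v vR lk /=.
  exists v => //; apply/negPn/negP => vb; have [u [_ _ lv _]] := srch_par sR vR vb.
  by rewrite lv in lk.
case: (boolP (v \in both Z)) => [vb|vb].
  by exists v => //; have [_ _ ->] := srch_both sR vb.
have [u [-> uR lv tv]] := srch_par sR vR vb.
have [|s sb tr] := IH u uR; first by rewrite -ltnS -lv.
by exists s.
Qed.

Lemma trace_uniq k v : v \in R' ->
  uniq (map (fun a => a.2.1) (trace k v)) /\ uniq (map (fun a => a.2.2) (trace k v)).
Proof.
move=> vR; have pw := trace_pairwise k vR; have al := trace_arcs (k := k) vR.
rewrite !uniq_pairwise !pairwise_map.
split; apply: sub_in_pairwise pw; try by apply/allP => a; exact: id.
all: move=> a g /= /al[_ _ la _] /al[_ _ lg _] le.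
- by apply: contraTneq le => e1; rewrite lg -e1 ltnn.
- by apply: contraTneq le => e1; rewrite -e1 la ltnn.
Qed.

(** The exchanges of the two bases are governed by [foldl_swap] in the matroid
    of lightest bases, since arcs that skip a level are not tight. *)
Lemma augment t k : t \in none Z -> t \in R' -> (lev t <= k)%N ->
  let Z' := foldl exch_arc Z (trace k t) in
  [/\ certificate Z' p lam, (#|both Z'|.+1 = #|both Z|)%N
    & (#|none Z'| < #|none Z|)%N].
Proof.
move=> tn tR tk /=; have [s sb tr] := trace_source tR tk.
have [u1 u2] := trace_uniq k tR.
have al := trace_arcs (k := k) tR.
have [|Eb En] := trace_status tr tn sb u1 u2.
  by move=> a /al[_ /andP[/and3P[]]].
split; last 2 first.
- by rewrite Eb [#|both Z|](cardsD1 s) sb.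
- by rewrite En [#|none Z|](cardsD1 t) tn.
split => [b|||]; last 3 first.
- exact: cert_bound cZ.
- by move=> e; rewrite Eb => /setD1P[_ /(cert_both cZ)].
- by move=> e; rewrite En => /setD1P[_ /(cert_none cZ)].
rewrite foldl_exch_arc; set l := [seq a <- _ | _].
have lsub : subseq l (trace k t) by apply: filter_subseq.
have ll a : a \in l -> a.1 = b /\ a \in trace k t.
  by rewrite mem_filter => /andP[/eqP].
apply: foldl_swap.
- exact/sym_exchangeW/minimizers_sym_exchange.
- exact: cert_min cZ b.
- by rewrite -map_comp (subseq_uniq _ u1) //; apply: map_subseq.
- by rewrite -map_comp (subseq_uniq _ u2) //; apply: map_subseq.
- move=> _ /mapP[a /ll[<- /al[_ ta _ _]] ->].
  have /andP[/and3P[aZ1 aZ2 _] _] := ta.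
  by rewrite -(tightE cZ).
- rewrite pairwise_map.
  have := subseq_pairwise lsub (trace_pairwise k tR).
  apply: sub_in_pairwise (allss _) => a g /ll[ab /al[a1 ta la _]] /ll[gb /al[g1 tg lg _]].
  have /andP[/and3P[_ aZ _] _] := ta; have /andP[/and3P[gZ _ _] _] := tg.
  rewrite ab in aZ; rewrite gb in gZ; rewrite /= -(tightE cZ) // => lt.
  apply/negP => /(srch_closed sR g1)[_]; rewrite la ltnS => /(leq_trans lt).
  by rewrite lg ltnn.
Qed.

End Augment.

End Pairs.

(** * A language of bounded loops *)

Inductive cond :=
  | CIn of nat & nat
  | CSome of nat
  | CEq of nat & nat
  | CLt of nat & nat
  | CIndep of nat
  | CNot of cond
  | CAnd of cond & cond
  | CXor of cond & cond.

(** Loops range over the ground set, hence every command terminates.  The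
    elements held by variables are optional: an access through an empty variable
    has no effect, or yields an empty or zero value.  [KGet] and [KPut]
    access the only array of elements, [KReset] and [KIncr] the only counter, whose
    value is the argument of [KPenalty]. *)
Inductive cmd :=
  | KSkip
  | KSeq of cmd & cmd
  | KIf of cond & cmd & cmd
  | KFor of nat & cmd
  | KNone of nat
  | KMov of nat & nat
  | KGet of nat & nat
  | KPut of nat & nat
  | KIns of nat & nat
  | KDel of nat & nat
  | KZero of nat
  | KAdd of nat & nat & nat
  | KSub of nat & nat & nat
  | KLoad of nat & nat & nat
  | KStore of nat & nat & nat
  | KReset
  | KIncr
  | KPenalty of nat.

Definition upd (T : Type) (f : nat -> T) (i : nat) (v : T) : nat -> T :=
  fun j => if Nat.eqb j i then v else f j.

Section Language.
Variables (R : realType) (E : finType) (I : instance R E).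

Record env := Env {
  evar : nat -> option E;
  epar : E -> option E;
  eset : nat -> {set E};
  earr : nat -> E -> R;
  ereal : nat -> R;
  ecnt : nat
}.
Implicit Types h : env.

Definition set_var h x v := Env (upd (evar h) x v) (epar h) (eset h) (earr h) (ereal h) (ecnt h).
Definition set_par h e v :=
  Env (evar h) (fun e' => if e' == e then v else epar h e') (eset h) (earr h) (ereal h) (ecnt h).
Definition set_set h j X := Env (evar h) (epar h) (upd (eset h) j X) (earr h) (ereal h) (ecnt h).
Definition set_arr h j e v :=
  Env (evar h) (epar h) (eset h)
      (upd (earr h) j (fun e' => if e' == e then v else earr h j e')) (ereal h) (ecnt h).
Definition set_real h q v := Env (evar h) (epar h) (eset h) (earr h) (upd (ereal h) q v) (ecnt h).
Definition set_cnt h n := Env (evar h) (epar h) (eset h) (earr h) (ereal h) n.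

Fixpoint ceval b h : bool :=
  match b with
  | CIn x j => if evar h x is Some e then e \in eset h j else false
  | CSome x => isSome (evar h x)
  | CEq x y => evar h x == evar h y
  | CLt q r => ereal h q < ereal h r
  | CIndep j => indep (imat I) (eset h j)
  | CNot a => ~~ ceval a h
  | CAnd a c => ceval a h && ceval c h
  | CXor a c => ceval a h (+) ceval c h
  end.

Fixpoint sem c h : env :=
  match c with
  | KSkip => h
  | KSeq a b => sem b (sem a h)
  | KIf b p q => if ceval b h then sem p h else sem q h
  | KFor x p => foldl (fun h e => sem p (set_var h x (Some e))) (set_var h x None) (enum E)
  | KNone x => set_var h x None
  | KMov x y => set_var h x (evar h y)
  | KGet x y => set_var h x (if evar h y is Some e then epar h e else None)
  | KPut y x => if evar h y is Some e then set_par h e (evar h x) else h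
  | KIns j x => if evar h x is Some e then set_set h j (e |: eset h j) else h
  | KDel j x => if evar h x is Some e then set_set h j (eset h j :\ e) else h
  | KZero q => set_real h q 0
  | KAdd q r s => set_real h q (ereal h r + ereal h s)
  | KSub q r s => set_real h q (ereal h r - ereal h s)
  | KLoad q j x => set_real h q (if evar h x is Some e then earr h j e else 0)
  | KStore j x q => if evar h x is Some e then set_arr h j e (ereal h q) else h
  | KReset => set_cnt h 0
  | KIncr => set_cnt h (ecnt h).+1
  | KPenalty q => set_real h q (if (ecnt h <= #|E|)%N then penalty I (ecnt h) else 0)
  end.

End Language.

(** ** Modified variables *)

Record footprint := Footprint {
  mvar : seq nat; mset : seq nat; marr : seq nat; mreal : seq nat;
  mpar : bool; mcnt : bool
}.

Definition fp0 := Footprint [::] [::] [::] [::] false false.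
Definition fpU f g := Footprint (mvar f ++ mvar g) (mset f ++ mset g)
  (marr f ++ marr g) (mreal f ++ mreal g) (mpar f || mpar g) (mcnt f || mcnt g).

Fixpoint modified c : footprint :=
  match c with
  | KSkip => fp0
  | KSeq a b | KIf _ a b => fpU (modified a) (modified b)
  | KFor x p => fpU (Footprint [:: x] [::] [::] [::] false false) (modified p)
  | KNone x | KMov x _ | KGet x _ => Footprint [:: x] [::] [::] [::] false false
  | KPut _ _ => Footprint [::] [::] [::] [::] true false
  | KIns j _ | KDel j _ => Footprint [::] [:: j] [::] [::] false false
  | KZero q | KAdd q _ _ | KSub q _ _ | KLoad q _ _ | KPenalty q =>
      Footprint [::] [::] [::] [:: q] false false
  | KStore j _ _ => Footprint [::] [::] [:: j] [::] false false
  | KReset | KIncr => Footprint [::] [::] [::] [::] false true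
  end.

Section Frame.
Variables (R : realType) (E : finType) (I : instance R E).
Implicit Types (h : env R E).

Definition agree (f : footprint) h h' : Prop :=
  [/\ forall x, x \notin mvar f -> evar h' x = evar h x,
      forall j, j \notin mset f -> eset h' j = eset h j,
      forall j, j \notin marr f -> earr h' j = earr h j,
      forall q, q \notin mreal f -> ereal h' q = ereal h q &
      (~~ mpar f -> epar h' = epar h) /\ (~~ mcnt f -> ecnt h' = ecnt h)].

Lemma agree_trans f h1 h2 h3 : agree f h1 h2 -> agree f h2 h3 -> agree f h1 h3.
Proof.
move=> [a1 a2 a3 a4 [a5 a6]] [b1 b2 b3 b4 [b5 b6]]; split => [x hx|j hj|j hj|q hq|].
- by rewrite b1 ?a1.
- by rewrite b2 ?a2.
- by rewrite b3 ?a3.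
- by rewrite b4 ?a4.
by split => m; rewrite ?b5 ?a5 ?b6 ?a6.
Qed.

Lemma agree_l f g h h' : agree f h h' -> agree (fpU f g) h h'.
Proof.
move=> [a1 a2 a3 a4 [a5 a6]]; split => [x|j|j|q|] /=; rewrite ?mem_cat ?negb_or.
- by case/andP => hx _; apply: a1.
- by case/andP => hx _; apply: a2.
- by case/andP => hx _; apply: a3.
- by case/andP => hx _; apply: a4.
by split; rewrite ?negb_or => /andP[m _]; rewrite ?a5 ?a6.
Qed.

Lemma agree_r f g h h' : agree g h h' -> agree (fpU f g) h h'.
Proof.
move=> [a1 a2 a3 a4 [a5 a6]]; split => [x|j|j|q|] /=; rewrite ?mem_cat ?negb_or.
- by case/andP => _; apply: a1.
- by case/andP => _; apply: a2.
- by case/andP => _; apply: a3.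
- by case/andP => _; apply: a4.
by split; rewrite ?negb_or => /andP[_ m]; rewrite ?a5 ?a6.
Qed.

Lemma updE T (f : nat -> T) i v j : j != i -> upd f i v j = f j.
Proof. by rewrite /upd; case: (PeanoNat.Nat.eqb_spec j i) => [->|//]; rewrite eqxx. Qed.

Lemma agree_sub f g h h' :
    [&& all (mem (mvar g)) (mvar f), all (mem (mset g)) (mset f),
        all (mem (marr g)) (marr f), all (mem (mreal g)) (mreal f),
        mpar f ==> mpar g & mcnt f ==> mcnt g] ->
  agree f h h' -> agree g h h'.
Proof.
case/and5P=> /allP g1 /allP g2 /allP g3 /allP g4 /andP[/implyP g5 /implyP g6].
move=> [a1 a2 a3 a4 [a5 a6]]; split => [x|j|j|q|].
- by move=> xg; apply: a1; apply: contra xg; apply: g1.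
- by move=> xg; apply: a2; apply: contra xg; apply: g2.
- by move=> xg; apply: a3; apply: contra xg; apply: g3.
- by move=> xg; apply: a4; apply: contra xg; apply: g4.
by split => m; [apply: a5 | apply: a6]; apply: contra m.
Qed.

Lemma agree_set_var f h x v : x \in mvar f -> agree f h (set_var h x v).
Proof.
move=> xf; split => //= z zf; rewrite updE //.
by apply: contraNneq zf => ->.
Qed.

Lemma sem_agree c h : agree (modified c) h (sem I c h).
Proof.
elim: c h => /= [|a IHa b IHb|b p IHp q IHq|x p IHp|x|x y|x y|y x|j x|j x|q|q r s|q r s|q j x
  |j x q|||q] h;
  try by [];
  try by (split => //= z; rewrite inE => ?; rewrite updE).
- by apply: agree_trans (agree_l _ (IHa h)) (agree_r _ (IHb _)).
- by case: ceval; [apply: agree_l | apply: agree_r].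
- set f := fpU _ _.
  have ax k v : agree f k (set_var k x v).
    by split => //= z; rewrite /f /= inE negb_or => /andP[zx _]; rewrite updE.
  elim: (enum E) (set_var h x None) (ax h None) => //= e s IH k hk.
  by apply: IH; apply: agree_trans hk (agree_trans (ax k (Some e)) (agree_r _ (IHp _))).
- by case: (evar h y).
- by case: (evar h x) => [e|] //; split => //= z; rewrite inE => ?; rewrite updE.
- by case: (evar h x) => [e|] //; split => //= z; rewrite inE => ?; rewrite updE.
- by case: (evar h x) => [e|] //; split => //= z; rewrite inE => ?; rewrite updE.
Qed.

Lemma agree_var f h h' x : agree f h h' -> x \notin mvar f -> evar h' x = evar h x.
Proof. by case=> a _ _ _ _; apply: a. Qed.
Lemma agree_set f h h' j : agree f h h' -> j \notin mset f -> eset h' j = eset h j.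
Proof. by case=> _ a _ _ _; apply: a. Qed.
Lemma agree_arr f h h' j : agree f h h' -> j \notin marr f -> earr h' j = earr h j.
Proof. by case=> _ _ a _ _; apply: a. Qed.
Lemma agree_real f h h' q : agree f h h' -> q \notin mreal f -> ereal h' q = ereal h q.
Proof. by case=> _ _ _ a _; apply: a. Qed.
Lemma agree_par f h h' : agree f h h' -> ~~ mpar f -> epar h' = epar h.
Proof. by case=> _ _ _ _ [a _]; apply: a. Qed.

(** Besides the invariant on the elements treated so far, the step may use that
    the loop has only changed the variables that it modifies. *)
Lemma for_ind x p h (P : {set E} -> env R E -> Prop) :
    P set0 (set_var h x None) ->
    (forall (S : {set E}) e k, e \notin S -> P S k -> agree (modified (KFor x p)) h k ->
      P (e |: S) (sem I p (set_var k x (Some e)))) ->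
  P setT (sem I (KFor x p) h).
Proof.
move=> P0 Ps /=.
have ax k v : agree (modified (KFor x p)) k (set_var k x v).
  by split => //= z; rewrite inE negb_or => /andP[zx _]; rewrite updE.
suff main s (S : {set E}) k : uniq s -> [disjoint S & s] -> P S k ->
    agree (modified (KFor x p)) h k ->
    P (S :|: [set e in s])
      (foldl (fun h e => sem I p (set_var h x (Some e))) k s).
  have := main (enum E) set0 _ (enum_uniq _) _ P0 (ax h None).
  rewrite (_ : set0 :|: _ = setT); first by apply; apply/pred0P => e; rewrite /= inE.
  by apply/setP => e; rewrite !inE mem_enum.
elim: s S k => [|e s IH] S k /=.
  by move=> _ _ PS _; rewrite (_ : _ :|: _ = S) //; apply/setP => e; rewrite !inE orbF.
move=> /andP[es us] dS PS ak.
have eS : e \notin S by rewrite (disjointFl dS) // mem_head.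
rewrite (_ : S :|: _ = (e |: S) :|: [set e in s]); last first.
  by apply/setP => z; rewrite !inE; case: (z == e); case: (z \in S).
apply: IH => //; last 2 first.
- exact: Ps.
- apply: agree_trans ak (agree_trans (ax k (Some e)) _).
  exact/agree_r/sem_agree.
rewrite disjoint_sym; apply/pred0P => z /=; rewrite !inE.
case: (eqVneq z e) => [->|_] /=; first by rewrite (negbTE es).
apply/negbTE/negP => /andP[zs zS].
by move: dS => /pred0P/(_ z) /=; rewrite zS inE zs orbT.
Qed.

Lemma for_iter x p h (P : nat -> env R E -> Prop) :
    P 0%N (set_var h x None) ->
    (forall i e k, (i < #|E|)%N -> P i k -> agree (modified (KFor x p)) h k ->
      P i.+1 (sem I p (set_var k x (Some e)))) ->
  P #|E| (sem I (KFor x p) h).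
Proof.
move=> P0 Ps; rewrite -[#|E|]cardsT.
apply: (for_ind (P := fun S k => P #|S| k)) => [|S e k eS PS ak].
  by rewrite cards0.
rewrite cardsU1 eS; apply: Ps => //.
by rewrite -cardsT (@proper_card _ S [set: E]) // properT; apply: contraNneq eS => ->.
Qed.

End Frame.

(** * Compilation to the random access machine *)

Local Notation "p ;; q" := (Seq p q) (at level 60, right associativity).

(** Cells [0], [1] and [2] of the bank of naturals have a prescribed use.  The costs
    fill the beginning of the bank of reals, so that no real variable can have a
    constant address: real variables and all arrays are reached through
    pointers, stored from [at_set 0] on. *)
Definition n_vars := 12%N.
Definition n_sets := 16%N.
Definition n_arrs := 4%N.
Definition n_reals := 8%N.

Definition at_zero := 3%N.
Definition at_one := 4%N.
Definition at_tmp := 5%N.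
Definition at_cnt := 6%N.
Definition at_var x := (7 + x)%N.
Definition at_set j := (19 + j)%N.
Definition at_par := 35%N.
Definition at_arr j := (36 + j)%N.
Definition at_real q := (40 + q)%N.
Definition n_scalars := 48%N.

(** The code of an element is one more than its number, whence the subtraction. *)
Definition locate ptr x :=
  Do (NAdd (Dir at_tmp) (Dir ptr) (Dir (at_var x))) ;;
  Do (NSub (Dir at_tmp) (Dir at_tmp) (Dir at_one)).

Definition if_some x p q := If (NLt (Dir at_zero) (Dir (at_var x))) p q.

Fixpoint compile_if b p q : prog :=
  match b with
  | CIn x j => if_some x (locate (at_set j) x ;;
      If (NLt (Dir at_zero) (Ind at_tmp)) p q) q
  | CSome x => if_some x p q
  | CEq x y => If (NLe (Dir (at_var x)) (Dir (at_var y)))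
      (If (NLe (Dir (at_var y)) (Dir (at_var x))) p q) q
  | CLt r s => If (RLt (Ind (at_real r)) (Ind (at_real s))) p q
  | CIndep j => Do (AskIndep (Dir at_tmp) (Ind (at_set j))) ;;
      If (NLt (Dir at_zero) (Dir at_tmp)) p q
  | CNot a => compile_if a q p
  | CAnd a c => compile_if a (compile_if c p q) q
  | CXor a c => compile_if a (compile_if c q p) (compile_if c p q)
  end.

Fixpoint compile c : prog :=
  match c with
  | KSkip => Skip
  | KSeq a b => compile a ;; compile b
  | KIf b p q => compile_if b (compile p) (compile q)
  | KFor x p => Do (NCst (Dir (at_var x)) 0%N) ;;
      While (NLt (Dir (at_var x)) (Dir 0%N))
        (Do (NAdd (Dir (at_var x)) (Dir (at_var x)) (Dir at_one)) ;; compile p)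
  | KNone x => Do (NCst (Dir (at_var x)) 0%N)
  | KMov x y => Do (NMov (Dir (at_var x)) (Dir (at_var y)))
  | KGet x y => if_some y (locate at_par y ;; Do (NMov (Dir (at_var x)) (Ind at_tmp)))
      (Do (NCst (Dir (at_var x)) 0%N))
  | KPut y x => if_some y (locate at_par y ;; Do (NMov (Ind at_tmp) (Dir (at_var x)))) Skip
  | KIns j x => if_some x (locate (at_set j) x ;; Do (NCst (Ind at_tmp) 1%N)) Skip
  | KDel j x => if_some x (locate (at_set j) x ;; Do (NCst (Ind at_tmp) 0%N)) Skip
  | KZero q => Do (RCst (Ind (at_real q)) 0)
  | KAdd q r s => Do (RAdd (Ind (at_real q)) (Ind (at_real r)) (Ind (at_real s)))
  | KSub q r s => Do (RSub (Ind (at_real q)) (Ind (at_real r)) (Ind (at_real s)))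
  | KLoad q j x => if_some x
      (locate (at_arr j) x ;; Do (RMov (Ind (at_real q)) (Ind at_tmp)))
      (Do (RCst (Ind (at_real q)) 0))
  | KStore j x q => if_some x
      (locate (at_arr j) x ;; Do (RMov (Ind at_tmp) (Ind (at_real q)))) Skip
  | KReset => Do (NCst (Dir at_cnt) 0%N)
  | KIncr => Do (NAdd (Dir at_cnt) (Dir at_cnt) (Dir at_one))
  | KPenalty q => If (NLe (Dir at_cnt) (Dir 0%N))
      (Do (AskPenalty (Ind (at_real q)) (Dir at_cnt))) (Do (RCst (Ind (at_real q)) 0))
  end.

Fixpoint wf_cond b : bool :=
  match b with
  | CIn x j => (x < n_vars)%N && (j < n_sets)%N
  | CSome x => (x < n_vars)%N
  | CEq x y => (x < n_vars)%N && (y < n_vars)%N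
  | CLt q r => (q < n_reals)%N && (r < n_reals)%N
  | CIndep j => (j < n_sets)%N
  | CNot a => wf_cond a
  | CAnd a c | CXor a c => wf_cond a && wf_cond c
  end.

Fixpoint wf c : bool :=
  match c with
  | KSkip | KReset | KIncr => true
  | KSeq a b => wf a && wf b
  | KIf b p q => [&& wf_cond b, wf p & wf q]
  | KFor x p => [&& (x < n_vars)%N, x \notin mvar (modified p) & wf p]
  | KNone x => (x < n_vars)%N
  | KMov x y | KGet x y | KPut x y => (x < n_vars)%N && (y < n_vars)%N
  | KIns j x | KDel j x => (j < n_sets)%N && (x < n_vars)%N
  | KZero q | KPenalty q => (q < n_reals)%N
  | KAdd q r s | KSub q r s => [&& (q < n_reals)%N, (r < n_reals)%N & (s < n_reals)%N]
  | KLoad q j x | KStore j x q => [&& (j < n_arrs)%N, (x < n_vars)%N & (q < n_reals)%N]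
  end.

Fixpoint cost_cond b : nat :=
  match b with
  | CIn _ _ => 4
  | CSome _ | CLt _ _ => 1
  | CEq _ _ | CIndep _ => 2
  | CNot a => cost_cond a
  | CAnd a c | CXor a c => cost_cond a + cost_cond c
  end%N.

Fixpoint cost n c : nat :=
  match c with
  | KSkip => 0
  | KSeq a b => cost n a + cost n b
  | KIf b p q => cost_cond b + (cost n p + cost n q)
  | KFor _ p => 2 + n * (2 + cost n p)
  | KNone _ | KMov _ _ | KZero _ | KAdd _ _ _ | KSub _ _ _ | KReset | KIncr => 1
  | KPenalty _ => 2
  | KGet _ _ | KPut _ _ | KIns _ _ | KDel _ _ | KLoad _ _ _ | KStore _ _ _ => 4
  end%N.

Lemma cost_poly c : exists f : {poly nat}, forall n, cost n c = f.[n].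
Proof.
have cst k : exists f : {poly nat}, forall n : nat, k = f.[n].
  by exists k%:P => n; rewrite hornerC.
elim: c => [|a [f Hf] b [g Hg]|b p [f Hf] q [g Hg]|x p [f Hf]|x|x y|x y|y x|j x|j x|q
  |q r s|q r s|q j x|j x q|||q] /=; try exact: cst.
- by exists (f + g) => n; rewrite hornerD Hf Hg.
- by exists ((cost_cond b)%:P + (f + g)) => n; rewrite !hornerD hornerC Hf Hg.
- exists (2%:P + 'X * (2%:P + f)) => n.
  by rewrite hornerD hornerM hornerD hornerX !hornerC Hf.
Qed.

Section Simulation.
Variables (R : realType) (E : finType) (I : instance R E).
Implicit Types (s : state R) (h : env R E).
Local Notation n := #|E|.

(** What a step may write into the bank of reals if numerators over a common
    denominator are to be at most doubled.  Penalties are queried only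
    at arguments that belong to the instance, for the encoding length accounts
    for no others. *)
Inductive derived s : R -> Prop :=
  | derived_zero : derived s 0
  | derived_cell a : derived s (rmem s a)
  | derived_add a b : derived s (rmem s a + rmem s b)
  | derived_sub a b : derived s (rmem s a - rmem s b)
  | derived_penalty k : (k <= n)%N -> derived s (penalty I k).

Fixpoint additive_run s (tr : seq (state R)) : Prop :=
  if tr is s' :: tr' then (forall a, derived s (rmem s' a)) /\ additive_run s' tr' else True.

Lemma additive_run_cat s tr tr' :
  additive_run s tr -> additive_run (last s tr) tr' -> additive_run s (tr ++ tr').
Proof. by elim: tr s => //= s' tr IH s [d a] a'; split => //; apply: IH. Qed.

Definition runs p s T (Q : state R -> Prop) : Prop :=
  exists tr, [/\ exec I p s tr, Q (last s tr), (size tr <= T)%N & additive_run s tr].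

Lemma runs_skip s T (Q : state R -> Prop) : Q s -> runs Skip s T Q.
Proof. by exists [::]; split => //; constructor. Qed.

Lemma runs_do i s T (Q : state R -> Prop) : (0 < T)%N -> Q (step I i s) ->
  (forall a, derived s (rmem (step I i s) a)) -> runs (Do i) s T Q.
Proof. by move=> T0 HQ d; exists [:: step I i s]; split => //; constructor. Qed.

Lemma runs_nat i s T (Q : state R -> Prop) : (0 < T)%N -> Q (step I i s) ->
  rmem (step I i s) = rmem s -> runs (Do i) s T Q.
Proof. by move=> T0 HQ e; apply: runs_do => // a; rewrite e; constructor. Qed.

Lemma runs_seq p q s T1 T2 T (Q1 Q : state R -> Prop) : (T1 + T2 <= T)%N ->
  runs p s T1 Q1 -> (forall s', Q1 s' -> runs q s' T2 Q) -> runs (p ;; q) s T Q.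
Proof.
move=> le [tr [e1 q1 s1 a1]] /(_ _ q1)[tr' [e2 q2 s2 a2]].
exists (tr ++ tr'); rewrite last_cat size_cat; split => //.
- exact: exec_seq.
- by apply: leq_trans le; apply: leq_add.
- exact: additive_run_cat.
Qed.

Lemma derived_refl s a : derived s (rmem s a). Proof. exact: derived_cell. Qed.

Lemma runs_if t p q s T (Q : state R -> Prop) :
  (holds t s -> runs p s T Q) -> (~~ holds t s -> runs q s T Q) ->
  runs (If t p q) s T.+1 Q.
Proof.
case: (boolP (holds t s)) => h Hp Hq.
- have [tr [e1 q1 s1 a1]] := Hp isT; exists (s :: tr); split => //.
  + exact: exec_if_true.
  + by split => // a; apply: derived_refl.
- have [tr [e1 q1 s1 a1]] := Hq isT; exists (s :: tr); split => //.
  + exact: exec_if_false.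
  + by split => // a; apply: derived_refl.
Qed.

Lemma runs_weaken p s T T' (Q Q' : state R -> Prop) : (T <= T')%N ->
  (forall s, Q s -> Q' s) -> runs p s T Q -> runs p s T' Q'.
Proof.
move=> le QQ [tr [e q sz a]]; exists tr; split => //; first exact: QQ.
exact: leq_trans le.
Qed.

Lemma runs_ge p s T T' (Q : state R -> Prop) : (T <= T')%N ->
  runs p s T Q -> runs p s T' Q.
Proof. by move=> le; apply: runs_weaken. Qed.

(** ** Memory layout *)

(** The empty variable is coded by [0], so that it is what fresh memory holds. *)
Definition enc (o : option E) : nat := if o is Some e then (enum_rank e).+1 else 0%N.

Definition cell_set j (e : E) : nat := (n_scalars + (j * n + enum_rank e))%N.
Definition cell_par (e : E) : nat := (n_scalars + (n_sets * n + enum_rank e))%N.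
Definition cell_arr j (e : E) : nat := (j * n + enum_rank e)%N.
Definition cell_real q : nat := (n_arrs * n + q)%N.

Record represents h s : Prop := Represents {
  rep_size : nmem s 0%N = n;
  rep_zero : nmem s at_zero = 0%N;
  rep_one : nmem s at_one = 1%N;
  rep_cnt : nmem s at_cnt = ecnt h;
  rep_var : forall x, (x < n_vars)%N -> nmem s (at_var x) = enc (evar h x);
  rep_pset : forall j, (j < n_sets)%N -> nmem s (at_set j) = (n_scalars + j * n)%N;
  rep_ppar : nmem s at_par = (n_scalars + n_sets * n)%N;
  rep_parr : forall j, (j < n_arrs)%N -> nmem s (at_arr j) = (j * n)%N;
  rep_preal : forall q, (q < n_reals)%N -> nmem s (at_real q) = cell_real q;
  rep_set : forall j e, (j < n_sets)%N -> nmem s (cell_set j e) = (e \in eset h j) :> nat;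
  rep_par : forall e, nmem s (cell_par e) = enc (epar h e);
  rep_arr : forall j e, (j < n_arrs)%N -> rmem s (cell_arr j e) = earr h j e;
  rep_real : forall q, (q < n_reals)%N -> rmem s (cell_real q) = ereal h q
}.

Lemma rank_lt (e : E) : (enum_rank e < n)%N. Proof. exact: ltn_ord. Qed.

Lemma cell_inj j j' (e e' : E) :
  (j * n + enum_rank e)%N = (j' * n + enum_rank e')%N -> j = j' /\ e = e'.
Proof.
have n0 : (0 < n)%N by apply: leq_ltn_trans (rank_lt e).
move=> eq; split.
  by have := congr1 (divn^~ n) eq; rewrite !divnMDl // !divn_small ?rank_lt ?addn0.
have := congr1 (modn^~ n) eq; rewrite !modnMDl !modn_small ?rank_lt //.
by move/ord_inj/enum_rank_inj.
Qed.

Lemma enc_inj : injective enc.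
Proof. by move=> [e|] [e'|] //= []; move/ord_inj/enum_rank_inj->. Qed.

Lemma enc_gt0 o : (0 < enc o)%N = isSome o. Proof. by case: o. Qed.

Lemma read_set_rep h s j : represents h s -> (j < n_sets)%N ->
  read_set E s (nmem s (at_set j)) = eset h j.
Proof.
move=> r jn; apply/setP => e; rewrite inE (rep_pset r jn) -addnA.
by rewrite (rep_set r e jn); case: (e \in _).
Qed.

Definition nwrite s a v : state R := State (update (nmem s) a v) (rmem s).
Definition rwrite s a v : state R := State (nmem s) (update (rmem s) a v).

Ltac cells := rewrite /update; case: eqP => [?|_]; [exfalso;
  unfold cell_set, cell_par, cell_arr, cell_real, at_zero, at_one, at_tmp, at_cnt, at_var,
    at_set, at_par, at_arr, at_real, n_scalars, n_vars, n_sets, n_arrs, n_reals in *; lia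
  | by auto].

Lemma rep_write_tmp h s v : represents h s -> represents h (nwrite s at_tmp v).
Proof.
case=> r1 r2 r3 r4 r5 r6 r7 r8 r9 r10 r11 r12 r13.
by split => /= *; first [by auto | cells].
Qed.

Lemma rep_write_cnt h s v : represents h s ->
  represents (set_cnt h v) (nwrite s at_cnt v).
Proof.
case=> r1 r2 r3 r4 r5 r6 r7 r8 r9 r10 r11 r12 r13.
by split => /= *; first [by auto | cells].
Qed.

Lemma rep_write_var h s x o : (x < n_vars)%N -> represents h s ->
  represents (set_var h x o) (nwrite s (at_var x) (enc o)).
Proof.
move=> xn; case=> r1 r2 r3 r4 r5 r6 r7 r8 r9 r10 r11 r12 r13.
split => /= [||||x' ?|k ?||k ?|k ?|k e' kn|e'|k e' kn|q qn]; try first [by auto | by cells].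
rewrite /upd; case: (PeanoNat.Nat.eqb_spec x' x) => [->|ne]; first by rewrite /update eqxx.
by cells.
Qed.

Lemma rep_write_set h s j e (b : bool) : (j < n_sets)%N -> represents h s ->
  represents (set_set h j (if b then e |: eset h j else eset h j :\ e))
             (nwrite s (cell_set j e) b).
Proof.
move=> jn; case=> r1 r2 r3 r4 r5 r6 r7 r8 r9 r10 r11 r12 r13.
split => /= [||||x ?|k ?||k ?|k ?|k e' kn|e'|k e' kn|q qn]; try first [by auto | by cells].
- rewrite /update; case: eqP => [/addnI/cell_inj[-> ->]|ne].
    by rewrite /upd PeanoNat.Nat.eqb_refl; case: (b); rewrite !inE eqxx.
  rewrite r10 // /upd; case: (PeanoNat.Nat.eqb_spec k j) => [kj|//]; subst k.
  have ee : e' != e by apply/eqP => ee; apply: ne; rewrite ee.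
  by case: (b); rewrite !inE (negbTE ee).
- by rewrite -r11 /update; case: eqP => // /addnI/cell_inj[jk _]; rewrite -jk in jn.
Qed.

Lemma rep_write_par h s e o : represents h s ->
  represents (set_par h e o) (nwrite s (cell_par e) (enc o)).
Proof.
case=> r1 r2 r3 r4 r5 r6 r7 r8 r9 r10 r11 r12 r13.
split => /= [||||x ?|k ?||k ?|k ?|k e' kn|e'|k e' kn|q qn]; try first [by auto | by cells].
- by rewrite -r10 // /update; case: eqP => // /addnI/cell_inj[jk _]; rewrite jk in kn.
- rewrite /update; case: eqP => [/addnI/cell_inj[_ ->]|ne]; first by rewrite eqxx.
  by rewrite r11; case: eqP => // ee; case: ne; rewrite ee.
Qed.

Lemma rep_write_arr h s j e v : (j < n_arrs)%N -> represents h s ->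
  represents (set_arr h j e v) (rwrite s (cell_arr j e) v).
Proof.
move=> jn; case=> r1 r2 r3 r4 r5 r6 r7 r8 r9 r10 r11 r12 r13.
split => //= [k e' kn|q qn].
- rewrite /update; case: eqP => [/cell_inj[-> ->]|ne].
    by rewrite /upd PeanoNat.Nat.eqb_refl eqxx.
  rewrite r12 // /upd; case: (PeanoNat.Nat.eqb_spec k j) => [kj|//]; subst k.
  by case: eqP => // ee; case: ne; rewrite ee.
- rewrite -r13 // /update; case: eqP => // eq; exfalso; move: eq (rank_lt e) jn.
  by rewrite /cell_real /cell_arr /n_arrs; nia.
Qed.

Lemma rep_write_real h s q v : (q < n_reals)%N -> represents h s ->
  represents (set_real h q v) (rwrite s (cell_real q) v).
Proof.
move=> qn; case=> r1 r2 r3 r4 r5 r6 r7 r8 r9 r10 r11 r12 r13.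
split => //= [k e' kn|r rn].
- rewrite -r12 // /update; case: eqP => // eq; exfalso; move: eq (rank_lt e') kn.
  by rewrite /cell_real /cell_arr /n_arrs; nia.
- rewrite /update /upd; case: (PeanoNat.Nat.eqb_spec r q) => [->|ne]; first by rewrite eqxx.
  by rewrite r13 //; case: eqP => // /addnI.
Qed.

(** ** Simulation of commands *)

Lemma runs_locate h s ptr base x e : represents h s -> (x < n_vars)%N ->
    evar h x = Some e -> nmem s ptr = base ->
  runs (locate ptr x) s 2
    (fun s' => represents h s' /\ nmem s' at_tmp = (base + enum_rank e)%N).
Proof.
move=> r xn hx hp.
pose s1 := nwrite s at_tmp (base + (enum_rank e).+1)%N.
apply: (@runs_seq _ _ _ 1%N 1%N _ (fun s' => s' = s1)) => //.
  by apply: runs_nat => //; rewrite /= /nset /nval /= (rep_var r xn) hx hp.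
move=> _ ->; apply: runs_nat => //; split; first exact/rep_write_tmp/rep_write_tmp.
rewrite /= /update eqxx /nval /= /update /= (rep_one r).
by rewrite addnS subn1.
Qed.

Lemma holds_some h s x : represents h s -> (x < n_vars)%N ->
  holds (NLt (Dir at_zero) (Dir (at_var x))) s = isSome (evar h x).
Proof. by move=> r xn; rewrite /= /nval /= (rep_zero r) (rep_var r xn) enc_gt0. Qed.

Lemma runs_if_some h s x p q T (Q : state R -> Prop) :
    represents h s -> (x < n_vars)%N ->
    (forall e, evar h x = Some e -> runs p s T Q) ->
    (evar h x = None -> runs q s T Q) ->
  runs (if_some x p q) s T.+1 Q.
Proof.
move=> r xn hp hq; apply: runs_if; rewrite (holds_some r xn).
  by case hx: (evar h x) => [e|] // _; apply: hp hx.
by case hx: (evar h x) => [e|] // _; apply: hq hx.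
Qed.

Lemma runs_compile_if b p q T (Q : state R -> Prop) h :
    (forall s, represents h s -> ceval I b h -> runs p s T Q) ->
    (forall s, represents h s -> ~~ ceval I b h -> runs q s T Q) ->
    wf_cond b -> forall s, represents h s ->
  runs (compile_if b p q) s (cost_cond b + T) Q.
Proof.
elim: b p q T => [x j|x|x y|r r'|j|a IH|a IHa c IHc|a IHa c IHc] p q T /= hp hq.
- case/andP=> xn jn s r; rewrite addSn; apply: (runs_if_some r xn) => [e hx|hx]; last first.
    by apply: runs_ge (hq s r _); [lia | rewrite hx].
  apply: (runs_seq _ (runs_locate r xn hx (rep_pset r jn)) (T2 := T.+1)); first lia.
  move=> s' [r' ht].
  have hh : holds (NLt (Dir at_zero) (Ind at_tmp)) s' = (e \in eset h j).
    rewrite /= /nval /= (rep_zero r') ht -addnA (rep_set r' e jn).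
    by case: (e \in _).
  apply: runs_if; rewrite hh => he; [apply: hp | apply: hq] => //.
    by rewrite hx.
  by rewrite hx.
- move=> xn s r; apply: (runs_if_some r xn) => [e hx|hx].
    by apply: hp; rewrite ?hx.
  by apply: hq; rewrite ?hx.
- case/andP=> xn yn s r.
  have hxy : (evar h x == evar h y) = (holds (NLe (Dir (at_var x)) (Dir (at_var y))) s
                       && holds (NLe (Dir (at_var y)) (Dir (at_var x))) s).
    rewrite /= /nval /= (rep_var r xn) (rep_var r yn) -eqn_leq.
    exact/esym/(inj_eq enc_inj).
  rewrite !addSn; apply: runs_if => h1; last first.
    by apply: runs_ge (hq s r _); [lia | rewrite hxy (negbTE h1)].
  by apply: runs_if => h2; [apply: hp | apply: hq] => //; rewrite hxy h1 ?h2 //= (negbTE h2).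
- case/andP=> rn rn' s rr.
  have hh : holds (RLt (Ind (at_real r)) (Ind (at_real r'))) s = (ereal h r < ereal h r').
    by rewrite /= /rval /= (rep_preal rr rn) (rep_preal rr rn') !(rep_real rr).
  by apply: runs_if; rewrite hh => h1; [apply: hp | apply: hq].
- move=> jn s r; rewrite addSn add1n.
  pose s1 := nwrite s at_tmp (indep (imat I) (eset h j)).
  apply: (@runs_seq _ _ _ 1%N T.+1 _ (fun s' => s' = s1)) => //.
    by apply: runs_nat => //=; rewrite (read_set_rep r jn).
  move=> _ ->; have r1 : represents h s1 by apply: rep_write_tmp.
  have hh : holds (NLt (Dir at_zero) (Dir at_tmp)) s1 = indep (imat I) (eset h j).
    rewrite /holds /nval /loc (rep_zero r1) /s1 /= /update eqxx.
    by case: (indep _ _).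
  by apply: runs_if; rewrite hh => h1; [apply: hp | apply: hq].
- move=> wa s r; apply: IH => // s' r' ha.
  by apply: hq => //; rewrite negbK.
- case/andP=> wa wc s r; rewrite -addnA; apply: IHa => // s' r' ha.
    by apply: IHc => // s2 r2 hc; [apply: hp | apply: hq] => //; rewrite ha.
  by apply: runs_ge (hq s' r' _); [lia | rewrite (negbTE ha)].
- case/andP=> wa wc s r; rewrite -addnA; apply: IHa => // s' r' ha;
    apply: IHc => // s2 r2 hc; [apply: hq | apply: hp | apply: hp | apply: hq] => //;
    by rewrite ?ha ?(negbTE ha) ?hc ?(negbTE hc).
Qed.

Lemma derived_update s a (v : R) : derived s v -> forall b, derived s (update (rmem s) a v b).
Proof. by move=> d b; rewrite /update; case: eqP => // _; apply: derived_cell. Qed.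

Lemma runs_real h s i q v T : (0 < T)%N -> represents h s -> (q < n_reals)%N ->
    step I i s = rset s (Ind (at_real q)) v -> derived s v ->
  runs (Do i) s T (represents (set_real h q v)).
Proof.
move=> T0 r qn e d; apply: runs_do => //; rewrite e /rset /= (rep_preal r qn).
  exact: rep_write_real.
exact: derived_update.
Qed.

Lemma runs_nset h h' s i a v T : (0 < T)%N ->
    step I i s = nset s a v -> represents h' (nwrite s (loc s a) v) -> 
  runs (Do i) s T (represents h').
Proof. by move=> T0 e r; apply: runs_nat; rewrite ?e. Qed.

Lemma runs_cst h s x T : (0 < T)%N -> represents h s -> (x < n_vars)%N ->
  runs (Do (NCst (Dir (at_var x)) 0%N)) s T (represents (set_var h x None)).
Proof.
by move=> T0 r xn; apply: (runs_nset h _ (a := Dir (at_var x)) (v := 0%N)) => //;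
  apply: (rep_write_var None xn r).
Qed.

(** A loop needs no hidden counter: its body does not modify the loop variable,
    whose cell therefore still holds the number of rounds begun. *)
Lemma compile_correct c : wf c -> forall h s, represents h s ->
  runs (compile c) s (cost n c) (represents (sem I c h)).
Proof.
elim: c => /= [|a IHa b IHb|b p IHp q IHq|x p IHp|x|x y|x y|y x|j x|j x|q|q r r'|q r r'|q j x
  |j x q|||q].
- by move=> _ h s r; apply: runs_skip.
- case/andP=> wa wb h s r; apply: (runs_seq (leqnn _) (IHa wa h s r)) => s' r'.
  exact: IHb.
- case/and3P=> wb wp wq h s r.
  apply: runs_compile_if wb _ r => s' r' hb.
    by rewrite hb; apply: runs_ge (IHp wp _ _ r'); rewrite leq_addr.
  by rewrite (negbTE hb); apply: runs_ge (IHq wq _ _ r'); rewrite leq_addl.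
- case/and3P=> xn xp wp h s r.
  apply: (runs_seq (T1 := 1%N) (T2 := (1 + n * (2 + cost n p))%N) _
    (runs_cst (T := 1%N) isT r xn)); first exact: leqnn.
  set h0 := set_var h x None.
  suff main (l m : seq E) k s' : enum E = l ++ m -> represents k s' ->
      nmem s' (at_var x) = size l ->
      runs (While (NLt (Dir (at_var x)) (Dir 0%N))
        (Do (NAdd (Dir (at_var x)) (Dir (at_var x)) (Dir at_one)) ;; compile p))
       s' (1 + size m * (2 + cost n p))%N
       (represents (foldl (fun h e => sem I p (set_var h x (Some e))) k m)).
    move=> s' r'; apply: (runs_ge _ (main [::] (enum E) h0 s' erefl r' _)).
      by rewrite -cardE leqnn.
    by rewrite (rep_var r' xn) /= /upd PeanoNat.Nat.eqb_refl.
  elim: m l k s' => [|e m IH] l k s' En r' sx.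
    exists [:: s']; split => //=; last by split => // a; apply: derived_refl.
    apply: exec_while_false; rewrite /= /nval /= sx (rep_size r') -leqNgt.
    by rewrite cardE En cats0.
  have sl : (size l < n)%N by rewrite cardE En size_cat /= addnS ltnS leq_addr.
  have rk : enum_rank e = size l :> nat.
    have re : (enum_rank e < size (enum E))%N by rewrite -cardE rank_lt.
    have := index_uniq e re (enum_uniq E); rewrite nth_enum_rank => <-.
    have := enum_uniq E; rewrite En cat_uniq /= => /and3P[_ /norP[el _] _].
    by rewrite index_cat (negbTE el) /= eqxx addn0.
  pose k1 := set_var k x (Some e).
  have [tr [e1 q1 z1 a1]] : runs (Do (NAdd (Dir (at_var x)) (Dir (at_var x)) (Dir at_one)) ;; compile p)
      s' (1 + cost n p)%N (represents (sem I p k1)).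
    apply: (runs_seq (T1 := 1%N) (T2 := cost n p) (Q1 := represents k1)) => //; last first.
      by move=> s2 r2; apply: IHp.
    apply: (runs_nset k _ (a := Dir (at_var x)) (v := (size l).+1)) => //.
      by rewrite /= /nval /= sx (rep_one r') addn1.
    by rewrite -rk; apply: (rep_write_var (Some e) xn r').
  have ex : evar (sem I p k1) x = Some e.
    rewrite (agree_var (sem_agree I p k1) xp) /= /upd PeanoNat.Nat.eqb_refl //.
  have [||tr2 [e2 q2 z2 a2]] := IH (rcons l e) (sem I p k1) (last s' tr) _ q1 _.
  + by rewrite cat_rcons.
  + by rewrite (rep_var q1 xn) ex /= rk size_rcons.
  exists (s' :: tr ++ tr2); split => /=.
  + apply: exec_while_true e1 e2.
    by rewrite /= /nval /= sx (rep_size r').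
  + by rewrite last_cat.
  + have arith (a b c K : nat) : (a <= 1 + c -> b <= 1 + K -> a + b < 1 + (2 + c + K))%N by lia.
    by rewrite size_cat mulSn; apply: arith z1 z2.
  + split; first by move=> a; apply: derived_refl.
    exact: additive_run_cat.
- by move=> xn h s r; apply: runs_cst.
- case/andP=> xn yn h s r; apply: (runs_nset h _ (a := Dir (at_var x)) (v := enc (evar h y))) => //.
    by rewrite /= /nval /= (rep_var r yn).
  exact: rep_write_var.
- case/andP=> xn yn h s r;
    apply: (runs_if_some r yn) => [e hy|hy]; rewrite hy; last exact: runs_cst.
  apply: (runs_seq (T2 := 1%N) _ (runs_locate r yn hy (rep_ppar r))) => // s' [r' ht].
  apply: (runs_nset h _ (a := Dir (at_var x)) (v := enc (epar h e))) => //.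
    by rewrite /= /nval /= ht -addnA (rep_par r').
  exact: rep_write_var.
- case/andP=> yn xn h s r;
    apply: (runs_if_some r yn) => [e hy|hy]; rewrite hy; last exact: runs_skip.
  apply: (runs_seq (T2 := 1%N) _ (runs_locate r yn hy (rep_ppar r))) => // s' [r' ht].
  apply: (runs_nset h _ (a := Ind at_tmp) (v := enc (evar h x))) => //.
    by rewrite /= /nval /= (rep_var r' xn).
  by rewrite /= ht -addnA; apply: rep_write_par.
- case/andP=> jn xn h s r;
    apply: (runs_if_some r xn) => [e hx|hx]; rewrite hx; last exact: runs_skip.
  apply: (runs_seq (T2 := 1%N) _ (runs_locate r xn hx (rep_pset r jn))) => // s' [r' ht].
  apply: (runs_nset h _ (a := Ind at_tmp) (v := 1%N)) => //.
  by rewrite /= ht -addnA; apply: (rep_write_set e true jn r').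
- case/andP=> jn xn h s r;
    apply: (runs_if_some r xn) => [e hx|hx]; rewrite hx; last exact: runs_skip.
  apply: (runs_seq (T2 := 1%N) _ (runs_locate r xn hx (rep_pset r jn))) => // s' [r' ht].
  apply: (runs_nset h _ (a := Ind at_tmp) (v := 0%N)) => //.
  by rewrite /= ht -addnA; apply: (rep_write_set e false jn r').
- by move=> qn h s r; apply: runs_real => //; constructor.
- case/and3P=> qn rn rn' h s r1; apply: runs_real => //.
    by rewrite /= /rval /= (rep_preal r1 rn) (rep_preal r1 rn') !(rep_real r1).
  by rewrite -!(rep_real r1) //; constructor.
- case/and3P=> qn rn rn' h s r1; apply: runs_real => //.
    by rewrite /= /rval /= (rep_preal r1 rn) (rep_preal r1 rn') !(rep_real r1).
  by rewrite -!(rep_real r1) //; constructor.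
- case/and3P=> jn xn qn h s r; apply: (runs_if_some r xn) => [e hx|hx]; rewrite hx; last first.
    by apply: runs_real => //; constructor.
  apply: (runs_seq (T2 := 1%N) _ (runs_locate r xn hx (rep_parr r jn))) => // s' [r' ht].
  apply: runs_real => //; last by rewrite -(rep_arr r' e jn); constructor.
  by rewrite /= /rval /= ht (rep_arr r').
- case/and3P=> jn xn qn h s r;
    apply: (runs_if_some r xn) => [e hx|hx]; rewrite hx; last exact: runs_skip.
  apply: (runs_seq (T2 := 1%N) _ (runs_locate r xn hx (rep_parr r jn))) => // s' [r' ht].
  have vq : rval s' (Ind (at_real q)) = ereal h q.
    by rewrite /rval /= (rep_preal r' qn) (rep_real r').
  apply: runs_do => //=; rewrite /rset /= ht vq; first exact: rep_write_arr.
  by apply: derived_update; rewrite -(rep_real r') //; constructor.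
- move=> _ h s r; apply: (runs_nset h _ (a := Dir at_cnt) (v := 0%N)) => //.
  exact: rep_write_cnt.
- move=> _ h s r; apply: (runs_nset h _ (a := Dir at_cnt) (v := (ecnt h).+1)) => //.
    by rewrite /= /nval /= (rep_cnt r) (rep_one r) addn1.
  exact: rep_write_cnt.
- move=> qn h s r.
  have hh : holds (NLe (Dir at_cnt) (Dir 0%N)) s = (ecnt h <= n)%N.
    by rewrite /= /nval /= (rep_cnt r) (rep_size r).
  apply: runs_if; rewrite hh => hc; [rewrite hc | rewrite (negbTE hc)]; apply: runs_real => //.
  + by rewrite /= /nval /= (rep_cnt r).
  + by constructor.
  + by constructor.
Qed.

End Simulation.

(** ** Initialization and output *)

Definition block (l : seq instr) : prog := foldr (fun i p => Do i ;; p) Skip l.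

Definition chain b k c : seq instr :=
  [seq NAdd (Dir (b + j).+1) (Dir (b + j)) (Dir c) | j <- iota 0 k].

Definition prologue : seq instr :=
  [:: NCst (Dir at_one) 1%N; NCst (Dir (at_set 0)) n_scalars] ++
  chain (at_set 0) n_sets 0 ++ chain (at_arr 0) n_arrs 0 ++
  chain (at_real 0) n_reals.-1 at_one.

Definition epilogue j k : seq instr :=
  [:: NMov (Dir 1%N) (Dir (at_set j)); NMov (Dir 2%N) (Dir (at_set k))].

Definition program c j k : prog := block prologue ;; compile c ;; block (epilogue j k).

Section Programs.
Variables (R : realType) (E : finType) (I : instance R E).
Implicit Types s : state R.
Local Notation n := #|E|.

Definition init_env : env R E :=
  Env (fun=> None) (fun=> None) (fun=> set0)
      (fun j => if j is 0%N then cost1 I else if j is 1%N then cost2 I else fun=> 0)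
      (fun=> 0) 0.

Definition nat_instr i := match i with
  | NCst _ _ | NMov _ _ | NAdd _ _ _ | NSub _ _ _ => true | _ => false end.

Lemma runs_block l s : all nat_instr l ->
  runs I (block l) s (size l) (fun s' => s' = foldl (fun s i => step I i s) s l).
Proof.
elim: l s => [|i l IH] s /=; first by move=> _; apply: runs_skip.
case/andP=> ri rl; rewrite -[(size l).+1]add1n.
apply: (@runs_seq _ _ _ _ _ _ 1%N (size l) _ (fun s' => s' = step I i s)) => //.
  by apply: runs_nat => //; case: (i) ri.
by move=> _ ->; apply: IH.
Qed.

Lemma foldl_block_rmem l s : all nat_instr l ->
  rmem (foldl (fun s i => step I i s) s l) = rmem s.
Proof.
by elim: l s => //= i l IH s /andP[ri rl]; rewrite IH //; case: i ri.
Qed.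

Lemma foldl_chain b k c s a : (c < b)%N ->
  nmem (foldl (fun s i => step I i s) s (chain b k c)) a =
  if (b <= a <= b + k)%N then (nmem s b + (a - b) * nmem s c)%N else nmem s a.
Proof.
move=> cb; elim: k a => [|k IH] a.
  by rewrite /= addn0 -eqn_leq; case: eqP => // <-; rewrite subnn addn0.
rewrite /chain -addn1 iotaD map_cat foldl_cat /= -/(chain b k c) add0n.
have cF : (b <= c <= b + k)%N = false by lia.
rewrite /update /nval /= !IH leqnn leq_addr cF /=.
case: eqP => [->|ne].
  by rewrite ifT; last lia; rewrite subSn ?leq_addr // addKn mulSn; lia.
by congr (if _ then _ else _); apply/idP/idP; lia.
Qed.

Lemma prologue_represents :
  runs I (block prologue) (init I) (size prologue) (represents init_env).
Proof.
have np : all nat_instr prologue by [].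
apply: (runs_weaken (leqnn _) _ (runs_block _ np)) => _ ->.
have rE := foldl_block_rmem (init I) np.
have nE a : nmem (foldl (fun s i => step I i s) (init I) prologue) a =
    if (19 <= a <= 35)%N then (48 + (a - 19) * n)%N else
    if (36 <= a < 40)%N then ((a - 36) * n)%N else
    if (40 <= a <= 47)%N then (4 * n + (a - 40))%N else
    if a == 4 then 1%N else if a == 0%N then n else 0%N.
  rewrite /prologue !foldl_cat.
  set s2 := foldl _ _ (_ :: _).
  have s2E b : nmem s2 b = if b == 19 then 48%N else if b == 4 then 1%N else
                           if b == 0%N then n else 0%N by [].
  move: s2 s2E => s2 s2E.
  set s3 := foldl _ s2 _.
  have s3E b : nmem s3 b = if (19 <= b <= 35)%N then (48 + (b - 19) * n)%N
                           else nmem s2 b by rewrite [LHS]foldl_chain // !s2E.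
  move: s3 s3E => s3 s3E; set s4 := foldl _ s3 _.
  have s4E b : nmem s4 b = if (36 <= b <= 40)%N then ((b - 36) * n)%N
                           else nmem s3 b by rewrite [LHS]foldl_chain // !s3E !s2E.
  move: s4 s4E => s4 s4E; rewrite [LHS]foldl_chain // !s4E !s3E !s2E /at_real /= muln1.
  by do !(case: ifP => ?) => //; lia.
move: (foldl _ _ _) rE nE => s rE nE.
have n0 a : (n_scalars <= a)%N -> nmem s a = 0%N.
  by rewrite nE /n_scalars => ?; do !(case: ifP => ?) => //; lia.
split.
all: rewrite /cell_set /cell_par /cell_arr /cell_real.
all: rewrite ?/n_vars ?/n_sets ?/n_arrs ?/n_reals ?/at_zero ?/at_one ?/at_cnt ?/at_var ?/at_set ?/at_par ?/at_arr ?/at_real.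
- by rewrite nE.
- by rewrite nE.
- by rewrite nE.
- by rewrite nE.
- by move=> x xn; rewrite nE /= !ifF //; lia.
- by move=> j jn; rewrite nE /n_scalars; do !(case: ifP => ?); rewrite ?addKn //; lia.
- by rewrite nE.
- by move=> j jn; rewrite nE; do !(case: ifP => ?); rewrite ?addKn //; lia.
- by move=> q qn; rewrite nE; do !(case: ifP => ?); rewrite ?addKn //; lia.
- by move=> j e _; rewrite inE n0 // leq_addr.
- by move=> e; rewrite n0 // leq_addr.
- move=> j e jn; rewrite rE.
  have re : (enum_rank e < n)%N := rank_lt e.
  rewrite [LHS]/= nth_cat size_map -cardE.
  case: j jn => [|[|j]] jn /=.
  + by rewrite mul0n add0n re (nth_map e) -?cardE // nth_enum_rank.
  + by rewrite mul1n ltnNge leq_addr /= addKn (nth_map e) -?cardE // nth_enum_rank.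
  + rewrite ifF; last by lia.
    by rewrite nth_default // size_map -cardE; lia.
- move=> q qn; rewrite rE.
  by rewrite [LHS]/= nth_default // size_cat [size _]size_map [X in (_ + X)%N]size_map -cardE; lia.
Qed.

Lemma program_correct c j k : wf c -> (j < n_sets)%N -> (k < n_sets)%N ->
  runs I (program c j k) (init I) (size prologue + (cost n c + 2))%N
    (fun s => outX E s = eset (sem I c init_env) j /\ outY E s = eset (sem I c init_env) k).
Proof.
move=> wc jn kn; apply: (runs_seq (leqnn _) prologue_represents) => s1 r1.
apply: (runs_seq (leqnn _) (compile_correct I wc r1)) => s2 r2.
apply: (runs_weaken (leqnn _) _ (runs_block _ _)) => [_ ->|]; last by [].
have rd b s j' : represents (sem I c init_env) s2 -> (j' < n_sets)%N ->
    b = nmem s2 (at_set j') -> (forall a, (n_scalars <= a)%N -> nmem s a = nmem s2 a) ->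
    read_set E s b = eset (sem I c init_env) j'.
  move=> r jn' -> hs; rewrite -(read_set_rep r jn'); apply/setP => e; rewrite !inE hs //.
  by rewrite (rep_pset r jn') -addnA leq_addr.
split; [apply: rd r2 jn _ _ | apply: rd r2 kn _ _] => //.
all: by move=> a an; rewrite /= /update !ifF //; apply/eqP => ea; rewrite ea in an.
Qed.

End Programs.

(** ** Determinism *)

Lemma exec_det (R : realType) (E : finType) (I : instance R E) p s tr1 :
  exec I p s tr1 -> forall tr2, exec I p s tr2 -> tr1 = tr2.
Proof.
elim=> {p s tr1} [s|i s|p q s tr tr' _ IH1 _ IH2|t p q s tr h _ IH|t p q s tr h _ IH
  |t p s tr tr' h _ IH1 _ IH2|t p s h] tr2 e2; inversion e2; subst => //.
all: repeat match goal with
  | ih : forall u, exec _ ?p ?s u -> ?v = u, e : exec _ ?p ?s ?w |- _ =>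
      have := ih w e; clear ih e => ?; subst
  | h : is_true (holds ?t ?s), h' : is_true (~~ holds ?t ?s) |- _ =>
      by rewrite h in h'
  end.
all: by [].
Qed.

(** ** Bit lengths *)

Lemma horner_nat_le (f : {poly nat}) m k : (m <= k)%N -> (f.[m] <= f.[k])%N.
Proof.
move=> mk; rewrite !horner_coef; apply: leq_sum => i _.
by apply: leq_mul => //; elim: (nat_of_ord i) => // j IH; rewrite !exprS; apply: leq_mul.
Qed.

Lemma bits_nat_le m k : (m <= 2 ^ k)%N -> (bits_nat m <= k.+1)%N.
Proof.
by move=> mk; rewrite /bits_nat ltnS; have := leq_trunc_log 2 mk; rewrite trunc_expnK.
Qed.

Lemma bits_nat_ge m : (m <= 2 ^ bits_nat m)%N.
Proof. by rewrite ltnW // trunc_log_ltn. Qed.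

Lemma bits_rat_le (z : int) (d a b : nat) : (0 < d)%N -> (d <= 2 ^ a)%N ->
  (`|z| <= 2 ^ b)%N -> (bits_rat (z%:~R / d%:R) <= (b.+1 + a.+1).+1)%N.
Proof.
move=> d0 da zb; set x : rat := _ / _.
have dx : numq x * d%:Z = z * denq x.
  apply/eqP; rewrite -(eqr_int rat) !rmorphM /=.
  have dn0 : (denq x)%:~R != 0 :> rat by rewrite intr_eq0 denq_neq0.
  have d0' : (d%:Z)%:~R != 0 :> rat by rewrite intr_eq0; case: (d) d0.
  rewrite -{1}[(numq x)%:~R](divfK dn0) divq_num_den /x.
  by apply/eqP; field; exact: d0'.
have dd : (`|denq x| %| d)%N.
  have : (denq x %| numq x * d%:Z)%Z by rewrite dx dvdz_mull.
  rewrite dvdzE abszM Gauss_dvdr //; by rewrite coprime_sym coprime_num_den.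
have nz : (`|numq x| %| `|z|)%N.
  have : (numq x %| z * denq x)%Z by rewrite -dx dvdz_mulr.
  by rewrite dvdzE abszM Gauss_dvdl // coprime_num_den.
rewrite /bits_rat ltnS leq_add //; apply: bits_nat_le; last first.
  by apply: leq_trans da; apply: dvdn_leq.
case: (posnP `|z|%N) => [z0|z0]; last by apply: leq_trans zb; apply: dvdn_leq.
have -> : x = 0 by move/eqP: z0; rewrite absz_eq0 => /eqP z0; rewrite /x z0 mul0r.
by [].
Qed.

Section Numbers.
Variables (R : realType) (E : finType) (J : instance rat E).
Let I := map_instance (ratr : rat -> R) J.
Local Notation B := (bits_instance J).

Definition denominator : nat :=
  (\prod_(e : E) (`|denq (cost1 J e)| * `|denq (cost2 J e)|) *
   \prod_(k < #|E|.+1) `|denq (penalty J k)|)%N.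

Definition fits (m : nat) (x : R) : Prop :=
  exists2 z : int, x = z%:~R / denominator%:R & (`|z| <= m)%N.

Lemma bits_den (x : rat) : (`|denq x| <= 2 ^ bits_rat x)%N.
Proof.
apply: leq_trans (bits_nat_ge _) _; rewrite leq_exp2l // /bits_rat; lia.
Qed.

Lemma bits_num (x : rat) : (`|numq x| <= 2 ^ bits_rat x)%N.
Proof.
apply: leq_trans (bits_nat_ge _) _; rewrite leq_exp2l // /bits_rat; lia.
Qed.

Lemma denominator_le : (denominator <= 2 ^ B)%N.
Proof.
rewrite /denominator /bits_instance expnD !expn_sum; apply: leq_mul; apply: leq_prod => k _.
  by rewrite expnD leq_mul // bits_den.
exact: bits_den.
Qed.

Lemma denominator_gt0 : (0 < denominator)%N.
Proof.
have d0 (x : rat) : (0 < `|denq x|)%N by rewrite absz_gt0 denq_neq0.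
by rewrite muln_gt0 !prodn_gt0 // => e; rewrite muln_gt0 !d0.
Qed.

Lemma fits_le m m' x : (m <= m')%N -> fits m x -> fits m' x.
Proof. by move=> le [z -> zm]; exists z => //; apply: leq_trans le. Qed.

Lemma fits0 m : fits m 0.
Proof. by exists 0; rewrite ?mul0r. Qed.

Lemma fitsD m x y : fits m x -> fits m y -> fits (m * 2) (x + y).
Proof.
move=> [z -> zm] [t -> tm]; exists (z + t); first by rewrite rmorphD /= mulrDl.
lia.
Qed.

Lemma fitsB m x y : fits m x -> fits m y -> fits (m * 2) (x - y).
Proof.
move=> [z -> zm] [t -> tm]; exists (z - t); first by rewrite rmorphB /= mulrBl.
lia.
Qed.

Lemma fits_rat (x : rat) : (`|denq x| %| denominator)%N -> (bits_rat x <= B)%N ->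
  fits (2 ^ (B + B)) (ratr x).
Proof.
move=> /dvdnP[k dk] bx; exists (numq x * k%:Z); last first.
  rewrite abszM expnD leq_mul //.
    by apply: leq_trans (bits_num x) _; rewrite leq_exp2l.
  apply: leq_trans denominator_le; rewrite dk.
  by rewrite leq_pmulr // absz_gt0 denq_neq0.
have D0 : (denominator%:R : R) != 0 by rewrite pnatr_eq0 -lt0n denominator_gt0.
have := D0; rewrite dk natrM mulf_eq0 negb_or => /andP[k0 dx0].
have dE : (denq x)%:~R = (`|denq x|%N)%:R :> R.
  by rewrite pmulrn gez0_abs // ltW // denq_gt0.
rewrite rmorphM /= -pmulrn /ratr dE.
by field; rewrite k0 dx0.
Qed.

Lemma fits_cost1 e : fits (2 ^ (B + B)) (cost1 I e).
Proof.
apply: fits_rat.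
  by rewrite /denominator (bigD1 e) //=; apply/dvdn_mulr/dvdn_mulr/dvdn_mulr.
by rewrite /bits_instance (bigD1 e) //= -!addnA leq_addr.
Qed.

Lemma fits_cost2 e : fits (2 ^ (B + B)) (cost2 I e).
Proof.
apply: fits_rat.
  by rewrite /denominator (bigD1 e) //=; apply/dvdn_mulr/dvdn_mulr/dvdn_mull.
rewrite /bits_instance (bigD1 e) //=; lia.
Qed.

Lemma fits_penalty k : (k <= #|E|)%N -> fits (2 ^ (B + B)) (penalty I k).
Proof.
move=> kn; have kn' : (k < #|E|.+1)%N by [].
apply: fits_rat.
  rewrite /denominator [X in (_ * X)%N](bigD1 (Ordinal kn')) //=.
  exact/dvdn_mull/dvdn_mulr.
rewrite /bits_instance [X in (_ + X)%N](bigD1 (Ordinal kn')) //=; lia.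
Qed.

Lemma fits_init a : fits (2 ^ (B + B)) (rmem (init I) a).
Proof.
rewrite /init /= nth_cat size_map -cardE; case: ifP => [an|_].
  have [x0] : exists x0 : E, x0 \in enum E.
    by case E0: (enum E) an => [|x l]; [rewrite cardE E0 | exists x; rewrite mem_head].
  by rewrite (nth_map x0) -?cardE // => _; apply: fits_cost1.
case: (ltnP (a - #|E|) #|E|) => [an|an]; last first.
  rewrite nth_default; first exact: fits0.
  by rewrite size_map -cardE.
have [x0] : exists x0 : E, x0 \in enum E.
  by case E0: (enum E) an => [|x l]; [rewrite cardE E0 | exists x; rewrite mem_head].
by rewrite (nth_map x0) -?cardE // => _; apply: fits_cost2.
Qed.

Lemma fits_derived m s x : (2 ^ (B + B) <= m)%N -> (forall a, fits m (rmem s a)) ->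
  derived I s x -> fits (m * 2) x.
Proof.
move=> mB fm; have m2 : (m <= m * 2)%N by rewrite leq_pmulr.
case=> [|a|a b|a b|k kn].
- exact: fits0.
- exact: fits_le (fm a).
- exact: fitsD.
- exact: fitsB.
- by apply: fits_le (fits_penalty kn); apply: leq_trans m2.
Qed.

Lemma fits_additive m s tr : (2 ^ (B + B) <= m)%N -> (forall a, fits m (rmem s a)) ->
  additive_run I s tr -> forall t a, fits (m * 2 ^ size tr) (rmem (nth s tr t) a).
Proof.
elim: tr m s => [|s' tr IH] m s mB fm /=.
  by move=> _ t a; rewrite nth_nil expn0 muln1.
case=> d ad [|t] a /=.
  apply: fits_le (fits_derived mB fm (d a)).
  by rewrite leq_mul2l expnS leq_pmulr ?expn_gt0 ?orbT.
have m2 : (m <= m * 2)%N by rewrite leq_pmulr.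
have fm' b : fits (m * 2) (rmem s' b) by apply: fits_derived (d b).
have := IH (m * 2)%N s' (leq_trans mB m2) fm' ad t a.
rewrite -mulnA -expnS; case: (ltnP t (size tr)) => tt.
  by rewrite (set_nth_default s').
move=> _; rewrite nth_default //.
by apply: fits_le (fm a); rewrite leq_pmulr // expn_gt0.
Qed.

Lemma card_le_bits : (#|E| <= B)%N.
Proof.
rewrite -sum1_card /bits_instance; apply: leq_trans (leq_addr _ _).
by apply: leq_sum => e _; rewrite /bits_rat; lia.
Qed.

End Numbers.

(** Over the common denominator of the instance, each step without
    multiplication at most doubles the numerators. *)
Lemma strongly_polynomial_additive (R : realType) (p : prog) (f : {poly nat}) :
    (forall (E : finType) (I : instance R E),
      exists Q, runs I p (init I) f.[#|E|] Q) ->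
  strongly_polynomial R p.
Proof.
move=> H; split.
  exists f => E I; have [Q [tr [e _ st _]]] := H E I; by exists tr.
exists (3%:P * 'X + f + 3%:P) => E J I tr e t a.
have [Q [tr' [e' _ st ad]]] := H E I.
rewrite (exec_det e e') {tr e}.
have [z -> zm] := fits_additive (leqnn _) (fits_init R J) ad t a.
exists (z%:~R / (denominator J)%:R).
  by rewrite fmorph_div /= rmorph_int rmorph_nat.
rewrite !hornerD hornerM hornerX !hornerC.
have zb : (`|z| <= 2 ^ (bits_instance J + bits_instance J + f.[bits_instance J]))%N.
  apply: leq_trans zm _; rewrite -expnD leq_exp2l // leq_add2l.
  exact: leq_trans st (horner_nat_le _ (card_le_bits J)).
apply: leq_trans (bits_rat_le (denominator_gt0 J) (denominator_le J) zb) _.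
rewrite -?[GRing.add]/addn -?[GRing.mul]/muln; lia.
Qed.

(** * Assignments and the greedy algorithm *)

Declare Scope cmd_scope.
Delimit Scope cmd_scope with C.
Bind Scope cmd_scope with cmd.
Infix ";;" := KSeq (at level 60, right associativity) : cmd_scope.
Notation "'IF' b 'THEN' p 'ELSE' q" := (KIf b p q)
  (at level 58, b at level 50, p at level 58, q at level 58) : cmd_scope.
Notation "'WHEN' b 'DO' p" := (KIf b p KSkip)
  (at level 58, b at level 50, p at level 58) : cmd_scope.
Local Open Scope cmd_scope.
Local Open Scope nat_scope.

Notation vE := 0 (only parsing).
Notation vU := 1 (only parsing).
Notation vV := 2 (only parsing).
Notation vI := 3 (only parsing).
Notation vJ := 4 (only parsing).
Notation vB := 5 (only parsing).
Notation vT := 6 (only parsing).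
Notation vN := 7 (only parsing).
Notation vR := 8 (only parsing).
Notation vP := 9 (only parsing).

(** The two bases have the sides [false] and [true].  The set [base_id b] is the
    symmetric difference of the base of side [b] and its mask, which is empty or
    the whole ground set, so that a matroid and its dual are treated by the same
    code. *)
Definition base_id (b : bool) := if b then 1 else 0.
Definition mask_id (b : bool) := if b then 3 else 2.
Notation sX := 0 (only parsing).
Notation sY := 1 (only parsing).
Notation sMask := 3 (only parsing).
Notation sW := 4 (only parsing).
Notation sReach := 5 (only parsing).
Notation sFront := 6 (only parsing).
Notation sNext := 7 (only parsing).
Notation sSide := 8 (only parsing).
Notation sBestX := 9 (only parsing).
Notation sBestY := 10 (only parsing).
Notation sX0 := 11 (only parsing).
Notation sY0 := 12 (only parsing).
Notation sYout := 13 (only parsing).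

Notation aC1 := 0 (only parsing).
Notation aC2 := 1 (only parsing).
Notation aP := 2 (only parsing).
Notation aW := 3 (only parsing).
Definition weight_id (b : bool) := if b then aW else aC1.

Notation rA := 0 (only parsing).
Notation rB := 1 (only parsing).
Notation rEps := 2 (only parsing).
Notation rBest := 3 (only parsing).

Definition COr a b := CNot (CAnd (CNot a) (CNot b)).
Definition CFalse := CNot (CEq vE vE).

Definition assign j b := KFor vE (KIf b (KIns j vE) (KDel j vE)).

Definition copy q r := KZero rB ;; KAdd q r rB.

Definition keep_least (q : nat) :=
  IF CAnd (CSome vB) (CNot (CLt q rEps)) THEN KSkip ELSE (copy rEps q ;; KMov vB vV).

Definition greedy_scan a :=
  KNone vB ;;
  KFor vV (
    IF CIn vV sW THEN KSkip ELSE (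
      KIns sW vV ;;
      IF CIndep sW THEN (KDel sW vV ;; KLoad rA a vV ;; keep_least rA)
      ELSE KDel sW vV)).

Definition greedy a :=
  assign sW CFalse ;; KFor vR (greedy_scan a ;; KIns sW vB).

Local Open Scope ring_scope.

Section Semantics.
Variables (R : realType) (E : finType) (I : instance R E).
Local Notation M := (imat I).
Local Notation n := #|E|.
Implicit Types h k : env R E.

Lemma sem_seq a b h : sem I (a ;; b) h = sem I b (sem I a h). Proof. by []. Qed.
Lemma sem_if b p q h :
  sem I (KIf b p q) h = if ceval I b h then sem I p h else sem I q h.
Proof. by []. Qed.

Lemma updS T (f : nat -> T) i v : upd f i v i = v.
Proof. by rewrite /upd PeanoNat.Nat.eqb_refl. Qed.

(** Such a condition reads the sets only at the current element of the loop
    in [assign], hence it may mention the set that is being overwritten. *)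
Fixpoint pointwise b : bool :=
  match b with
  | CIn x _ => Nat.eqb x vE
  | CEq _ _ | CSome _ => true
  | CNot a => pointwise a
  | CAnd a c | CXor a c => pointwise a && pointwise c
  | _ => false
  end.

Lemma pointwise_eval b h k e : pointwise b ->
    evar k =1 evar (set_var h vE (Some e)) ->
    (forall j, (e \in eset k j) = (e \in eset h j)) ->
  ceval I b k = ceval I b (set_var h vE (Some e)).
Proof.
move=> pb hv hs; elim: b pb => //= [x j|x|x y|a IH|a IHa c IHc|a IHa c IHc].
- by move/PeanoNat.Nat.eqb_eq => ->; rewrite hv /= hs.
- by move=> _; rewrite hv.
- by move=> _; rewrite !hv.
- by move=> pa; rewrite IH.
- by case/andP=> pa pc; rewrite IHa ?IHc.
- by case/andP=> pa pc; rewrite IHa ?IHc.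
Qed.

Lemma assign_set j b h : pointwise b ->
  eset (sem I (assign j b) h) j = [set e | ceval I b (set_var h vE (Some e))].
Proof.
move=> pb; rewrite /assign; apply/setP => e0.
pose P (S : {set E}) k := forall e, (e \in eset k j) =
  if e \in S then ceval I b (set_var h vE (Some e)) else e \in eset h j.
suff main : P setT (sem I (assign j b) h) by rewrite main !inE.
apply: for_ind => [|S e k eS IH ak] e'; first by rewrite inE.
have ev : ceval I b (set_var k vE (Some e)) = ceval I b (set_var h vE (Some e)).
  apply: pointwise_eval => // [x|i] /=.
    rewrite /upd; case: (PeanoNat.Nat.eqb_spec x vE) => // x0.
    by rewrite (agree_var ak) //= !inE; apply/eqP.
  case: (eqVneq i j) => [->|ij]; last by rewrite (agree_set ak) //= !inE orbb.
  by rewrite IH (negbTE eS).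
rewrite sem_if ev in_setU1; case cb: (ceval _ _ _); rewrite /= updS in_set ?in_set1 IH.
- by case: (eqVneq e' e) => [->|ne] /=; rewrite ?cb.
- by case: (eqVneq e' e) => [->|ne] /=; rewrite ?cb.
Qed.

(** ** The greedy algorithm *)

(** The state of a search for a least number: [P] relates the candidates met so
    far to their numbers, and [vB] is empty as long as there are none. *)
Definition least_of (P : E -> R -> Prop) k : Prop :=
  if evar k vB is Some v then
    P v (ereal k rEps) /\ forall e x, P e x -> ereal k rEps <= x
  else forall e x, ~ P e x.

Lemma least_of_iff (P Q : E -> R -> Prop) k :
  (forall e x, P e x <-> Q e x) -> least_of P k -> least_of Q k.
Proof.
rewrite /least_of => PQ; case: (evar k vB) => [v [Pv le]|nP].
  by split; [apply/PQ | move=> e x /PQ; apply: le].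
by move=> e x /PQ; apply: nP.
Qed.

Lemma keep_least_spec (P : E -> R -> Prop) k e :
    evar k vV = Some e -> least_of P k ->
  least_of (fun v x => P v x \/ v = e /\ x = ereal k rA) (sem I (keep_least rA) k).
Proof.
move=> ke; rewrite /keep_least sem_if /least_of /= ke /upd /= addr0.
case vb: (evar k vB) => [v|] /=; last first.
  move=> nP; split; first by right.
  by move=> e' x [/nP|[_ ->]].
move=> [Pv le]; case: ltP => ab /=; rewrite ?vb; split.
- by right.
- by move=> e' x [/le|[_ ->]] //; apply: le_trans (ltW ab).
- by left.
- by move=> e' x [/le|[_ ->]].
Qed.

Section Greedy.
Variables (a : nat) (w : E -> R).

Definition addable (G : {set E}) e := (e \notin G) && indep M (e |: G).

Lemma greedy_select h (G : {set E}) : earr h a = w -> eset h sW = G ->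
  let k := sem I (greedy_scan a) h in
  eset k sW = G /\ least_of (fun e x => addable G e /\ x = w e) k.
Proof.
move=> hw hG; rewrite /greedy_scan sem_seq.
pose P (S : {set E}) k := eset k sW = G /\
  least_of (fun e x => [/\ e \in S, addable G e & x = w e]) k.
suff [GE lo] : P setT (sem I (KFor vV (IF CIn vV sW THEN KSkip ELSE (
      KIns sW vV ;;
      IF CIndep sW THEN (KDel sW vV ;; KLoad rA a vV ;; keep_least rA)
      ELSE KDel sW vV))) (sem I (KNone vB) h)).
  split; first exact: GE.
  by apply: least_of_iff lo => e x; split=> [[_ ad ->]|[ad ->]]; rewrite ?inE.
apply: for_ind => [|S e k eS [kG lo] ak].
  by split => //; rewrite /least_of /= => e x []; rewrite inE.
set k1 := set_var k vV (Some e).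
have lo1 : least_of (fun e x => [/\ e \in S, addable G e & x = w e]) k1 by [].
have k1G : eset k1 sW = G by [].
have k1w : earr k1 a = w by rewrite /= (agree_arr ak) //= !inE.
have k1e : evar k1 vV = Some e by [].
move: k1 lo1 k1G k1w k1e => {ak lo kG}k lo kG kw ke.
have skip : ~~ addable G e -> least_of (fun e' x => [/\ e' \in e |: S, addable G e' & x = w e']) k.
  move=> na; apply: least_of_iff lo => e' x; rewrite in_setU1.
  split=> [[-> -> ->]|[/predU1P[->|->] ad ->]]; rewrite ?orbT //.
  by rewrite ad in na.
rewrite sem_if [ceval _ _ _]/= ke kG; case: ifP => eG.
  by split => //; apply: skip; rewrite /addable eG.
rewrite sem_seq; have -> : sem I (KIns sW vV) k = set_set k sW (e |: G).
  by rewrite /= ke kG.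
set k2 := set_set _ _ _; rewrite sem_if.
have -> : ceval I (CIndep sW) k2 = addable G e by rewrite /= updS /addable eG.
have del : sem I (KDel sW vV) k2 = set_set k2 sW G.
  by rewrite /= ke updS setU1K // eG.
case: ifP => ad; last first.
  rewrite del; split; first exact: updS.
  by apply: skip; rewrite ad.
rewrite 2!sem_seq del; set k3 := sem I (KLoad rA a vV) _.
have k3w : ereal k3 rA = w e by rewrite /k3 /= updS ke kw.
split; first by rewrite (agree_set (sem_agree I (keep_least rA) k3)) //= updS.
have := @keep_least_spec _ k3 e _ lo; rewrite k3w => /(_ ke).
apply: least_of_iff => e' x; rewrite in_setU1; split.
  by case=> [[-> -> ->]|[-> ->]]; rewrite ?eqxx ?orbT.
by case=> /predU1P[->|eS'] ad' ->; [right|left].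
Qed.

(** The set built so far lies in a lightest base [B]: if the lightest addable
    element is not in [B], it replaces an element of [B] that was addable too. *)
Lemma greedy_spec h : earr h a = w ->
  eset (sem I (greedy a) h) sW \in minimizers (bases M) w.
Proof.
move=> hw; rewrite /greedy sem_seq.
set h0 := sem I (assign _ _) h.
have h0w : earr h0 a = w by rewrite (agree_arr (sem_agree I _ _)).
have h0G : eset h0 sW = set0.
  by apply/setP => e; rewrite assign_set // !inE /= eqxx.
move: h0 h0w h0G => {hw}{}h hw hG.
pose P i k := exists B, [/\ B \in minimizers (bases M) w, eset k sW \subset B
  & (i <= #|eset k sW|)%N || (eset k sW == B)].
suff [B [Bm GB iG]] : P n (sem I (KFor vR (greedy_scan a ;; KIns sW vB)) h).
  suff -> : eset (sem I (KFor vR (greedy_scan a ;; KIns sW vB)) h) sW = B by [].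
  case/orP: iG => [iG|/eqP //].
  by apply/eqP; rewrite eqEcard GB (leq_trans (max_card _)).
apply: for_iter => [|i e k li [B [Bm GB iG]] ak].
  have [B0 B0M] : exists B0, B0 \in bases M by apply/set0Pn; apply: bases_neq0.
  have [B BM mB] := arg_minP (weight w) B0M.
  by exists B; rewrite /= hG sub0set; split => //; apply/minimizersP.
have kw : earr (set_var k vR (Some e)) a = w by rewrite /= (agree_arr ak) //= !inE.
rewrite sem_seq; case: (greedy_select kw erefl).
set k1 := sem I (greedy_scan a) _; rewrite [eset (set_var _ _ _) _]/= => k1G lo.
have /minimizersP[BM mB] := Bm.
move: lo; rewrite /P /= /least_of; case: (evar k1 vB) => [v|] => [[[/andP[vG iv] k1v] le]|no].
  rewrite /= updS k1G; set G := eset k sW in GB iG vG iv k1G le *.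
  have iG' : (i <= #|G|)%N.
    case/orP: iG => // /eqP GE; move: iv; rewrite GE => /indepP[A AM] /subset_leq_card.
    by rewrite cardsU1 -GE vG GE (base_card AM BM) ltnn.
  case: (boolP (v \in B)) => vB.
    by exists B; rewrite subUset sub1set vB GB cardsU1 vG add1n ltnS iG'.
  have [y [yB yG sM]] := indep_swap iv BM vB GB.
  exists (swap B y v); split.
  - rewrite (swap_minimizers Bm) // sM -k1v (le y) //; split => //; rewrite /addable yG.
    by apply/indepP; exists B; rewrite // subUset sub1set yB.
  - rewrite setUS //; apply/subsetP => x xG; rewrite !inE (subsetP GB) // andbT.
    by apply: contraNneq yG => <-.
  - by rewrite cardsU1 vG add1n ltnS iG'.
exists B; rewrite k1G; split => //; apply/orP; right.
rewrite eqEsubset GB; apply/subsetP => y yB; apply/negPn/negP => yG.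
apply: (no y (w y)); split => //; rewrite /addable yG.
by apply/indepP; exists B; rewrite // subUset sub1set yB.
Qed.

End Greedy.

End Semantics.

(** * Breadth-first search *)

(** The exchange is tried in the scratch set [sW]; [p] finds the slack of the arc
    in [rA]. *)
Definition test_arc b p :=
  WHEN CAnd (CIn vU (base_id b)) (CNot (CIn vV (base_id b))) DO (
    assign sW (CXor (COr (CAnd (CIn vE (base_id b)) (CNot (CEq vE vU))) (CEq vE vV))
                    (CIn vE (mask_id b))) ;;
    WHEN CIndep sW DO (
      KLoad rA (weight_id b) vV ;; KLoad rB (weight_id b) vU ;; KSub rA rA rB ;;
      KLoad rB aP vV ;; KSub rA rA rB ;; KLoad rB aP vU ;; KAdd rA rA rB ;; p)).

Definition mark b :=
  KIns sNext vV ;; KPut vV vU ;; if b then KIns sSide vV else KDel sSide vV.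

Definition visit b :=
  WHEN CAnd (CNot (CIn vV sReach)) (CNot (CIn vV sNext)) DO
    test_arc b (KZero rB ;; IF CLt rB rA THEN KSkip ELSE mark b).

Definition scan_front :=
  assign sNext CFalse ;;
  KFor vU (WHEN CIn vU sFront DO KFor vV (visit false ;; visit true)).

Definition search_round :=
  scan_front ;;
  assign sReach (COr (CIn vE sReach) (CIn vE sNext)) ;;
  assign sFront (CIn vE sNext).

Definition search_init :=
  assign sReach (CAnd (CIn vE sX) (CIn vE sY)) ;;
  assign sFront (CIn vE sReach) ;;
  KNone vN ;; KFor vU (KPut vU vN).

Definition search := search_init ;; KFor vR search_round.

Section Phase.
Variables (R : realType) (E : finType) (I : instance R E).
Local Notation M := (imat I).
Local Notation n := #|E|.
Implicit Types (h k : env R E) (S U G : {set E}).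
Local Notation sem := (sem I).

Variable D : {set E}.

Definition mask (b : bool) : {set E} := if b then D else set0.
Definition fam b : {set {set E}} := [set B | symdiff B (mask b) \in bases M].
Definition wgt b (e : E) : R :=
  if b then if e \in D then 0 - cost2 I e else cost2 I e else cost1 I e.

Hypothesis D_trivial : D = set0 \/ D = setT.

Lemma symdiff_in (A B : {set E}) e : (e \in symdiff A B) = (e \in A) (+) (e \in B).
Proof. by rewrite !inE; case: (e \in A); case: (e \in B). Qed.

Lemma symdiff0 (A : {set E}) : symdiff A set0 = A.
Proof. by apply/setP => e; rewrite symdiff_in inE addbF. Qed.

Lemma symdiffT (A : {set E}) : symdiff A setT = ~: A.
Proof. by apply/setP => e; rewrite symdiff_in !inE addbT. Qed.

Lemma mask_trivial b : mask b = set0 \/ mask b = setT.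
Proof. by case: b; [exact: D_trivial | left]. Qed.

Lemma fam_exchange b : sym_exchange (fam b).
Proof.
have sM := @bases_sym_exchange _ M.
rewrite /fam; case: (mask_trivial b) => ->.
  rewrite (_ : [set B | _] = bases M) //.
  by apply/setP => B; rewrite inE symdiff0.
rewrite (_ : [set B | _] = [set ~: B | B in bases M]); first exact: sym_exchangeC.
apply/setP => B; rewrite inE symdiffT; apply/idP/imsetP => [BM|[A AM ->]].
  by exists (~: B); rewrite // setCK.
by rewrite setCK.
Qed.

(** The oracle decides independence only, but the set that is tested is as large
    as a base. *)
Lemma fam_indep b Z u v : Z \in fam b -> u \in Z -> v \notin Z ->
  indep M (symdiff (swap Z u v) (mask b)) = (swap Z u v \in fam b).
Proof.
rewrite !inE => ZM uZ vZ; apply: (indep_base ZM).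
have := card_swap uZ vZ; case: (mask_trivial b) => ->; rewrite ?symdiff0 // !symdiffT.
by move=> e; apply: (@addnI #|Z|); rewrite -{1}e !cardsC.
Qed.

Record static k : Prop := Static {
  st_mask : forall b, eset k (mask_id b) = mask b;
  st_c1 : earr k aC1 = cost1 I;
  st_c2 : earr k aC2 = cost2 I;
  st_w : earr k aW = wgt true
}.

Definition cur k b : {set E} := eset k (base_id b).
Definition pot k : E -> R := earr k aP.
Definition in_fam k := forall b, cur k b \in fam b.

Definition keeps_static f := [&& 2 \notin mset f, 3 \notin mset f, aC1 \notin marr f,
  aC2 \notin marr f & aW \notin marr f].

Lemma static_agree f k k' : keeps_static f -> agree f k k' -> static k -> static k'.
Proof.
case/and5P=> m2 m3 m0 m1 m4 a [s1 s2 s3 s4]; split.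
- by case; rewrite /= (agree_set a) //; [exact: (s1 true) | exact: (s1 false)].
- by rewrite (agree_arr a).
- by rewrite (agree_arr a).
- by rewrite (agree_arr a).
Qed.

Lemma static_weight k b : static k -> earr k (weight_id b) = wgt b.
Proof. by move=> s; case: b; [exact: st_w s | exact: st_c1 s]. Qed.

Definition fp_arc := Footprint [:: vE] [:: sW] [::] [:: rA; rB] false false.

Lemma test_arc_spec b p k u v : static k -> in_fam k ->
    evar k vU = Some u -> evar k vV = Some v ->
  exists k', [/\ agree fp_arc k k',
     sem (test_arc b p) k = if swap_arc fam (cur k) b u v then sem p k' else k'
   & swap_arc fam (cur k) b u v -> ereal k' rA = slack wgt (pot k) b u v].
Proof.
move=> sk fk ku kv; rewrite /test_arc sem_if.
have -> : ceval I (CAnd (CIn vU (base_id b)) (CNot (CIn vV (base_id b)))) k =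
          (u \in cur k b) && (v \notin cur k b) by rewrite /= ku kv.
case: ifP => [/andP[uZ vZ]|uv]; last first.
  exists k; split => //; rewrite /swap_arc andbA uv //=.
rewrite sem_seq; set c := assign _ _; set k1 := sem c k.
have a1 : agree fp_arc k k1 by apply: agree_sub (sem_agree I c k); case: (b).
have k1W : eset k1 sW = symdiff (swap (cur k b) u v) (mask b).
  rewrite /k1 assign_set; last by case: (b).
  apply/setP => e; rewrite inE symdiff_in in_swap -(st_mask sk) /cur.
  have vx x : upd (evar k) 0%N (Some e) x = if Nat.eqb x 0 then Some e else evar k x by [].
  have se x : (Some e == Some x) = (e == x) by [].
  rewrite /= !vx /= ku kv !se.
  by rewrite negb_and !negbK orbC andbC.
have k1E : ceval I (CIndep sW) k1 = (swap (cur k b) u v \in fam b).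
  by rewrite /= k1W fam_indep.
rewrite sem_if k1E; have -> : swap_arc fam (cur k) b u v = (swap (cur k b) u v \in fam b).
  by rewrite /swap_arc uZ vZ.
case: ifP => sF; last by exists k1.
rewrite !(sem_seq I (KLoad _ _ _), sem_seq I (KSub _ _ _), sem_seq I (KAdd _ _ _)).
set k8 := sem (KAdd rA rA rB) _; exists k8; split => //.
  apply: agree_trans a1 _.
  pose c8 := KLoad rA (weight_id b) vV ;; KLoad rB (weight_id b) vU ;; KSub rA rA rB ;;
      KLoad rB aP vV ;; KSub rA rA rB ;; KLoad rB aP vU ;; KAdd rA rA rB.
  by apply: agree_sub (sem_agree I c8 k1).
move=> _; rewrite /k8 /= /upd /= !(agree_var a1) // ku kv !(agree_arr a1) //.
by rewrite (static_weight b sk).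
Qed.

Definition fp_visit := Footprint [:: vE] [:: sW; sNext; sSide] [::] [:: rA; rB] true false.

Lemma mark_spec b k u v : evar k vU = Some u -> evar k vV = Some v ->
  [/\ eset (sem (mark b) k) sNext = v |: eset k sNext,
      epar (sem (mark b) k) =1 (fun e => if e == v then Some u else epar k e)
    & forall e, (e \in eset (sem (mark b) k) sSide) = if e == v then b else e \in eset k sSide].
Proof.
move=> ku kv; rewrite /mark !sem_seq.
have -> : sem (KIns sNext vV) k = set_set k sNext (v |: eset k sNext) by rewrite /= kv.
set k1 := set_set _ _ _; have k1v : evar k1 vV = Some v by [].
have -> : sem (KPut vV vU) k1 = set_par k1 v (Some u) by rewrite /= kv ku.
set k2 := set_par _ _ _; have k2v : evar k2 vV = Some v by [].
have -> : sem (if b then KIns sSide vV else KDel sSide vV) k2 =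
   set_set k2 sSide (if b then v |: eset k sSide else eset k sSide :\ v).
  by case: (b); rewrite /= kv.
split => //= e; rewrite updS.
by case: (b); rewrite !inE; case: (e == v).
Qed.

Lemma visit_spec b k u v : static k -> in_fam k ->
    evar k vU = Some u -> evar k vV = Some v ->
  let t := [&& v \notin eset k sReach, v \notin eset k sNext
             & tight fam wgt (cur k) (pot k) b u v] in
  let k' := sem (visit b) k in
  [/\ agree fp_visit k k',
      eset k' sNext = if t then v |: eset k sNext else eset k sNext,
      epar k' =1 (fun e => if t && (e == v) then Some u else epar k e)
    & forall e, (e \in eset k' sSide) = if t && (e == v) then b else e \in eset k sSide].
Proof.
move=> sk fk ku kv t k'; rewrite {}/k' {}/t /visit sem_if.
have -> : ceval I (CAnd (CNot (CIn vV sReach)) (CNot (CIn vV sNext))) k =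
   (v \notin eset k sReach) && (v \notin eset k sNext) by rewrite /= kv.
rewrite andbA; case: ifP => // vRN.
set c := KZero rB ;; _; have [k1 [a1 -> sl]] := test_arc_spec b c sk fk ku kv.
have cE : sem c k1 = if ereal k1 rA <= 0 then sem (mark b) (sem (KZero rB) k1)
                     else sem (KZero rB) k1.
  by rewrite /c sem_seq sem_if /= /upd /= ltNge; case: (_ <= _).
have a2 : agree fp_visit k (sem c k1).
  apply: (@agree_trans _ _ _ _ k1); first exact: agree_sub a1.
  by apply: agree_sub (sem_agree I c k1); rewrite /c /mark; case: (b).
have k1N : eset k1 sNext = eset k sNext by rewrite (agree_set a1).
have k1S : eset k1 sSide = eset k sSide by rewrite (agree_set a1).
have k1P : epar k1 = epar k by rewrite (agree_par a1).
have k1u : evar k1 vU = Some u by rewrite (agree_var a1).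
have k1v : evar k1 vV = Some v by rewrite (agree_var a1).
rewrite /tight !andTb; case: ifP => av; last first.
  by split; rewrite ?k1N //; [apply: agree_sub a1 | move=> e; rewrite k1P | move=> e; rewrite k1S].
split; first exact: a2.
all: rewrite cE sl //; case: (_ <= 0).
- by have [-> _ _] := @mark_spec b (sem (KZero rB) k1) u v k1u k1v; rewrite -k1N.
- by rewrite -k1N.
- move=> e; have [_ -> _] := @mark_spec b (sem (KZero rB) k1) u v k1u k1v.
  by rewrite -k1P.
- by move=> e; rewrite -k1P.
- move=> e; have [_ _ ->] := @mark_spec b (sem (KZero rB) k1) u v k1u k1v.
  by rewrite -k1S.
- by move=> e; rewrite -k1S.
Qed.

Definition keeps_pair f :=
  [&& keeps_static f, sX \notin mset f, sY \notin mset f & aP \notin marr f].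

Lemma cur_agree f k k' b : keeps_pair f -> agree f k k' -> cur k' b = cur k b.
Proof. by case/and4P=> _ m0 m1 _ a; case: b; rewrite /cur (agree_set a). Qed.

Lemma pot_agree f k k' : keeps_pair f -> agree f k k' -> pot k' = pot k.
Proof. by case/and4P=> _ _ _ m a; rewrite /pot (agree_arr a). Qed.

Lemma tight_agree f k k' b u v : keeps_pair f -> agree f k k' ->
  tight fam wgt (cur k') (pot k') b u v = tight fam wgt (cur k) (pot k) b u v.
Proof. by move=> f_ a; rewrite /tight /swap_arc (cur_agree b f_ a) (pot_agree f_ a). Qed.

Lemma in_fam_agree f k k' : keeps_pair f -> agree f k k' -> in_fam k -> in_fam k'.
Proof. by move=> f_ a fk b; rewrite (cur_agree b f_ a). Qed.

Section Scan.
Variable h : env R E.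
Hypotheses (sh : static h) (fh : in_fam h).
Local Notation T := (tight fam wgt (cur h) (pot h)).
Local Notation Rh := (eset h sReach).
Local Notation Fh := (eset h sFront).

Definition scanning k : Prop :=
  [/\ forall v, v \in eset k sNext -> v \notin Rh /\
        exists u, [/\ u \in Fh, epar k v = Some u & T (v \in eset k sSide) u v],
      {in Rh, epar k =1 epar h}
    & forall v, v \in Rh -> (v \in eset k sSide) = (v \in eset h sSide)].

Definition found k b u v := T b u v -> (v \in Rh) || (v \in eset k sNext).

Definition fp_scan := Footprint [:: vE; vU; vV] [:: sW; sNext; sSide] [::] [:: rA; rB] true false.

Lemma visit_scanning b k u v : agree fp_scan h k -> scanning k ->
    evar k vU = Some u -> evar k vV = Some v -> u \in Fh ->
  let k' := sem (visit b) k in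
  [/\ agree fp_visit k k', scanning k', found k' b u v
    & eset k sNext \subset eset k' sNext].
Proof.
move=> ak [g1 g2 g3] ku kv uF k'.
have [] := @visit_spec b k u v (static_agree _ ak sh) (in_fam_agree _ ak fh) ku kv => //.
rewrite -/k' (tight_agree b u v _ ak) // (agree_set ak) // => a kN kP kS.
have kR : eset k' sReach = Rh by rewrite (agree_set a) // (agree_set ak).
split => //.
- case vt: [&& _, _ & _] kN kP kS => kN kP kS; last first.
    split=> [x|x xR|x xR]; rewrite ?kN ?kP ?kS //=; [|exact: g2|exact: g3].
    by move/g1 => [xR [y [yF py ty]]]; split => //; exists y.
  case/and3P: vt => vR vN tv.
  have nv x : x \in Rh -> x == v = false by move=> xR; apply: contraNF vR => /eqP <-.
  split=> [x|x xR|x xR]; rewrite ?kN ?kP ?kS /=; last 2 first.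
  - by rewrite nv //; apply: g2.
  - by rewrite nv //; apply: g3.
  rewrite in_setU1; case: (eqVneq x v) => [->|ne] /=.
    by move=> _; split => //; exists u.
  move/g1 => [xR [y [yF py ty]]]; split => //; by exists y.
- rewrite /found => tv; rewrite kN tv andbT.
  case: (boolP (v \in Rh)) => //= vR; case: (boolP (v \in eset k sNext)) => //= vN.
  by rewrite setU11.
- by rewrite kN; case: ifP => // _; apply: subsetUr.
Qed.

Lemma found_sub k k' b u v : eset k sNext \subset eset k' sNext ->
  found k b u v -> found k' b u v.
Proof.
by move=> sN fk t; case/orP: (fk t) => [->//|/(subsetP sN)->]; rewrite orbT.
Qed.

Lemma scan_front_spec : let k := sem scan_front h in
  [/\ agree fp_scan h k, scanning k & forall b u v, u \in Fh -> found k b u v].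
Proof.
set k := sem scan_front h.
have ak : agree fp_scan h k by apply: agree_sub (sem_agree I scan_front h).
suff main : scanning k /\ forall b u v, u \in Fh -> found k b u v.
  by case: main.
rewrite /k /scan_front sem_seq; set h0 := sem (assign _ _) h.
have a0 : agree fp_scan h h0 by apply: agree_sub (sem_agree I (assign _ _) h).
pose body := WHEN CIn vU sFront DO KFor vV (visit false ;; visit true).
pose P (S : {set E}) k := scanning k /\ forall b u v, u \in S -> u \in Fh -> found k b u v.
suff [] : P setT (sem (KFor vU body) h0).
  by move=> g fd; split => // b u v; apply: fd.
apply: for_ind => [|S u k1 uS [g fd] a1].
  split=> [|b u v]; last by rewrite inE.
  have hN : eset h0 sNext = set0.
    by apply/setP => e; rewrite assign_set // !inE /= eqxx.
  split=> [v|v vR|v vR] /=; first by rewrite hN inE.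
    by rewrite (agree_par (sem_agree I (assign sNext CFalse) h)).
  by rewrite (agree_set (sem_agree I (assign sNext CFalse) h)).
set k2 := set_var k1 vU (Some u).
have a2 : agree fp_scan h k2.
  apply: agree_trans a0 (agree_trans (agree_sub _ a1) _) => //.
  by split => //= z; rewrite !inE !negb_or => /and3P[_ zu _]; rewrite updE.
have F2 : eset k2 sFront = Fh by rewrite (agree_set a2).
rewrite /body sem_if [ceval _ _ _]/= F2; case: (boolP (u \in Fh)) => uF; last first.
  split=> // b u' v; rewrite in_setU1 => /predU1P[->|u'S u'F]; first by rewrite (negbTE uF).
  exact: fd.
pose P2 (S2 : {set E}) k := [/\ scanning k,
  forall b u v, u \in S -> u \in Fh -> found k b u v
  & forall b v, v \in S2 -> found k b u v].
suff [g' fd' fu] : P2 setT (sem (KFor vV (visit false ;; visit true)) k2).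
  split=> // b u' v; rewrite in_setU1 => /predU1P[-> _|]; first exact: fu.
  exact: fd'.
apply: for_ind => [|S2 v k3 vS2 [g3 fd3 fu3] a3]; first by split => // b v; rewrite inE.
set k4 := set_var k3 vV (Some v).
have a4 : agree fp_scan h k4.
  apply: agree_trans a2 (agree_trans (agree_sub _ a3) _) => //.
  by split => //= z; rewrite !inE !negb_or => /and3P[_ _ zu]; rewrite updE.
have k4u : evar k4 vU = Some u by have : evar k3 vU = Some u by rewrite (agree_var a3).
rewrite sem_seq.
have [a5 g5 fu5 s5] := @visit_scanning false k4 u v a4 g3 k4u erefl uF.
set k5 := sem (visit false) k4 in a5 g5 fu5 s5 *.
have a5' : agree fp_scan h k5 by apply: agree_trans a4 (agree_sub _ a5).
have k5u : evar k5 vU = Some u by rewrite (agree_var a5).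
have k5v : evar k5 vV = Some v by rewrite (agree_var a5).
have [a6 g6 fu6 s6] := @visit_scanning true k5 u v a5' g5 k5u k5v uF.
set k6 := sem (visit true) k5 in a6 g6 fu6 s6 *.
have s46 : eset k3 sNext \subset eset k6 sNext by apply: subset_trans s5 s6.
split=> // [b u' v' u'S u'F|b v'].
  by apply: found_sub (fd3 _ _ _ u'S u'F).
rewrite in_setU1 => /predU1P[->|v'S]; last exact: found_sub (fu3 _ _ v'S).
by case: b => //; apply: found_sub s6 fu5.
Qed.

End Scan.

Lemma or_eval a b k : ceval I (COr a b) k = ceval I a k || ceval I b k.
Proof. by rewrite /= -negb_or negbK. Qed.

Section Search.
Variable h : env R E.
Hypotheses (sh : static h) (fh : in_fam h).
Local Notation T := (tight fam wgt (cur h) (pot h)).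

Definition fp_search := Footprint [:: vE; vU; vV; vN; vR]
  [:: sW; sNext; sSide; sReach; sFront] [::] [:: rA; rB] true false.

(** After [i] rounds the reached elements are those at distance at most [i],
    and the front consists of those at distance [i].  Since each
    round with a nonempty front reaches a new element, the front is empty after
    [n] rounds. *)
Definition search_inv i k : Prop := exists lev : E -> nat,
  [/\ [/\ forall v, v \in both (cur h) -> [/\ v \in eset k sReach, lev v = 0%N & epar k v = None],
       forall v, v \in eset k sReach -> (lev v <= i)%N
     & forall v, v \in eset k sReach -> v \notin both (cur h) -> exists u,
        [/\ epar k v = Some u, u \in eset k sReach, lev v = (lev u).+1
          & T (v \in eset k sSide) u v]],
      forall v, (v \in eset k sFront) = (v \in eset k sReach) && (lev v == i),
      forall b u v, u \in eset k sReach -> (lev u < i)%N -> T b u v ->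
        v \in eset k sReach /\ (lev v <= (lev u).+1)%N
    & eset k sFront = set0 \/ (i < #|eset k sReach|)%N].

Lemma search_init_spec : search_inv 0 (sem search_init h).
Proof.
rewrite /search_init sem_seq; set h1 := sem _ h.
have a1 : agree fp_search h h1 by apply: agree_sub (sem_agree I (assign _ _) h).
have h1R : eset h1 sReach = both (cur h).
  by rewrite /h1 assign_set //; apply/setP => e; rewrite !inE.
rewrite sem_seq; set h2 := sem _ h1.
have a2 := sem_agree I (assign sFront (CIn vE sReach)) h1.
have h2R : eset h2 sReach = both (cur h) by rewrite (agree_set a2).
have h2F : eset h2 sFront = both (cur h).
  by rewrite /h2 assign_set //; apply/setP => e; rewrite inE /= h1R.
rewrite sem_seq; set h3 := sem (KNone vN) h2.
pose P (S : {set E}) k := forall e, e \in S -> epar k e = None.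
set k := sem (KFor vU _) h3.
have kP e : epar k e = None.
  suff : P setT k by apply; rewrite inE.
  apply: for_ind => [e'|S e' k1 eS IH ak e2]; first by rewrite inE.
  rewrite in_setU1 /= /upd /= (agree_var ak) //=.
  by case: (eqVneq e2 e') => //= _; apply: IH.
have ak := sem_agree I (KFor vU (KPut vU vN)) h3.
have kR : eset k sReach = both (cur h) by rewrite (agree_set ak).
have kF : eset k sFront = both (cur h) by rewrite (agree_set ak).
exists (fun=> 0%N); split => //.
- by split => [v|//|v]; rewrite ?kR // => ->.
- by move=> v; rewrite kF kR andbT.
- rewrite kF kR; case: (set_0Vmem (both (cur h))) => [->|[x xb]]; first by left.
  by right; rewrite (cardD1 x) xb.
Qed.

Lemma search_round_spec i k : agree fp_search h k -> search_inv i k ->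
  search_inv i.+1 (sem search_round k).
Proof.
move=> ak [lev [[l1 l2 l3] l4 l5 l6]].
have sk : static k by apply: static_agree ak sh.
have fk : in_fam k by apply: in_fam_agree ak fh.
have TE b u v : tight fam wgt (cur k) (pot k) b u v = T b u v by apply: tight_agree ak.
have [] := scan_front_spec sk fk.
rewrite /search_round sem_seq; set k1 := sem scan_front k => a1 [g1 g2 g3] fd.
have R1 : eset k1 sReach = eset k sReach by rewrite (agree_set a1).
rewrite sem_seq; set k2 := sem (assign sReach _) k1; set k3 := sem _ k2.
have a2 := sem_agree I (assign sReach (COr (CIn vE sReach) (CIn vE sNext))) k1.
have a3 := sem_agree I (assign sFront (CIn vE sNext)) k2.
have kR : eset k3 sReach = eset k sReach :|: eset k1 sNext.
  rewrite (agree_set a3) // /k2 assign_set //; apply/setP => e.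
  by rewrite in_set in_setU or_eval /= R1.
have kF : eset k3 sFront = eset k1 sNext.
  by rewrite /k3 assign_set //; apply/setP => e; rewrite inE /= (agree_set a2).
have kP : epar k3 = epar k1 by rewrite (agree_par a3) // (agree_par a2).
have kS : eset k3 sSide = eset k1 sSide by rewrite (agree_set a3) // (agree_set a2).
set Rk := eset k sReach in l1 l2 l3 l4 l5 l6 g1 g2 g3 fd kR R1.
set Nk := eset k1 sNext in g1 fd kR kF.
have NR v : v \in Nk -> v \notin Rk by case/g1.
have RN v : v \in Rk -> v \notin Nk by move=> vR; apply: contraL vR => /NR.
pose lev' v := if v \in Nk then i.+1 else lev v.
have lR v : v \in Rk -> lev' v = lev v by move=> /RN vN; rewrite /lev' (negbTE vN).
have lN v : v \in Nk -> lev' v = i.+1 by move=> vN; rewrite /lev' vN.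
have Fk v : v \in eset k sFront -> v \in Rk /\ lev v = i by rewrite l4 => /andP[-> /eqP].
exists lev'; rewrite kR kF kP kS; split.
- split=> [v vb|v|v].
  + have [vR lv pv] := l1 v vb; rewrite in_setU vR lR // lv; split => //.
    by rewrite g2.
  + by rewrite in_setU => /orP[vR|/lN-> //]; rewrite lR // leqW // l2.
  + rewrite in_setU => /orP[vR vb|vN _].
      have [u [pu uR lu tu]] := l3 v vR vb; exists u.
      by rewrite in_setU uR !lR // g2 // g3.
    have [_ [u [uF pu tu]]] := g1 v vN; have [uR lu] := Fk u uF.
    by exists u; rewrite in_setU uR lN // lR // lu -TE.
- move=> v; rewrite in_setU; case: (boolP (v \in Nk)) => vN; first by rewrite orbT lN // eqxx.
  case: (boolP (v \in Rk)) => //= vR; rewrite lR //.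
  by apply/esym/eqP => lv; have := l2 v vR; rewrite lv ltnn.
- move=> b u v; rewrite in_setU => /orP[uR|/lN->]; last by rewrite ltnn.
  rewrite lR // ltnS leq_eqVlt => /predU1P[lu|lu] tuv; last first.
    by have [vR lv] := l5 b u v uR lu tuv; rewrite in_setU vR lR.
  have uF : u \in eset k sFront by rewrite l4 uR lu eqxx.
  have /orP[vR|vN] : (v \in Rk) || (v \in Nk) by apply: (fd b u v uF); rewrite TE.
    by rewrite in_setU vR lR // lu leqW // l2.
  by rewrite in_setU vN orbT lN // lu.
- case: (set_0Vmem Nk) => [->|[v vN]]; [by left | right].
  have [_ [u [uF _ _]]] := g1 v vN.
  case: l6 => [F0|iR]; first by rewrite F0 inE in uF.
  rewrite cardsU (_ : Rk :&: Nk = set0) ?cards0 ?subn0; last first.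
    by apply/setP => x; rewrite !inE; apply/negbTE/nandP/orP; case: (boolP (x \in Rk)) => // /RN.
  by rewrite -addn1 leq_add // (cardD1 v) vN.
Qed.

Lemma search_spec : let k := sem search h in
  exists2 lev, searched fam wgt (cur h) (pot h) (eset k sReach) lev (epar k)
     (fun v => v \in eset k sSide)
  & forall v, v \in eset k sReach -> (lev v <= n)%N.
Proof.
rewrite /search; set k := sem _ h.
have [lev [[l1 l2 l3] l4 l5 l6]] : search_inv n k.
  rewrite /k sem_seq; set h1 := sem search_init h.
  have a1 : agree fp_search h h1 by apply: agree_sub (sem_agree I search_init h).
  apply: for_iter => [|i e k1 li IH ak1]; first exact: search_init_spec.
  apply: (@search_round_spec i (set_var k1 vR (Some e))) IH.
  apply: agree_trans a1 (agree_trans (agree_sub _ ak1) _) => //.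
  by split => //= z; rewrite !inE !negb_or => /and5P[_ _ _ _ zu]; rewrite updE.
exists lev => //; split => // b u v uR; apply: l5 => //.
have := l2 u uR; rewrite leq_eqVlt => /predU1P[lu|//].
have uF : u \in eset k sFront by rewrite l4 uR lu eqxx.
case: l6 => [F0|]; first by rewrite F0 inE in uF.
by rewrite ltnNge max_card.
Qed.

End Search.

End Phase.

(** * Augmentation, dual steps and the best pair *)

Definition pick_target :=
  KNone vT ;;
  KFor vV (WHEN CAnd (CIn vV sReach) (CAnd (CNot (CIn vV sX)) (CNot (CIn vV sY))) DO
    KMov vT vV).

Definition exchange_back b := KDel (base_id b) vP ;; KIns (base_id b) vT.

(** The exchanges are made from the sink back to the source, in the order of
    [trace].  At the source there is no predecessor, and the remaining rounds of
    the loop are idle. *)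
Definition trace_back :=
  KFor vR (
    KGet vP vT ;;
    WHEN CSome vP DO (
      (IF CIn vT sSide THEN exchange_back true ELSE exchange_back false) ;;
      KMov vT vP)).

Definition probe b := test_arc b (keep_least rA).

Definition dual_scan :=
  KNone vB ;;
  KFor vU (WHEN CIn vU sReach DO
    KFor vV (IF CIn vV sReach THEN KSkip ELSE (probe false ;; probe true))).

Definition raise_pot :=
  KFor vV (IF CIn vV sReach THEN KSkip ELSE
    (KLoad rA aP vV ;; KAdd rA rA rEps ;; KStore aP vV rA)).

Definition tally :=
  (WHEN CIn vV sX DO (KLoad rB aC1 vV ;; KAdd rA rA rB)) ;;
  (WHEN CIn vV sYout DO (KLoad rB aC2 vV ;; KAdd rA rA rB)) ;;
  (WHEN CXor (CIn vV sX) (CIn vV sYout) DO KIncr).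

Definition evaluate :=
  KZero rA ;; KReset ;; KFor vV tally ;; KPenalty rB ;; KAdd rA rA rB.

Definition save :=
  assign sBestX (CIn vE sX) ;; assign sBestY (CIn vE sYout) ;; copy rBest rA.

Definition record :=
  assign sYout (CXor (CIn vE sY) (CIn vE sMask)) ;;
  evaluate ;; WHEN CLt rA rBest DO save.

Section Phase.
Variables (R : realType) (E : finType) (I : instance R E).
Local Notation M := (imat I).
Local Notation n := #|E|.
Implicit Types (h k : env R E) (S U G : {set E}).
Local Notation sem := (sem I).

Lemma pick_target_spec h : let k := sem pick_target h in
  if evar k vT is Some t then t \in eset h sReach /\ t \in none (cur h)
  else [disjoint none (cur h) & eset h sReach].
Proof.
move=> k; pose P (S : {set E}) k := if evar k vT is Some t then
    t \in eset h sReach /\ t \in none (cur h)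
  else forall e, e \in S -> e \in eset h sReach -> e \notin none (cur h).
have : P setT k.
  rewrite /k /pick_target sem_seq; apply: for_ind => [|S e k1 eS IH ak].
    by move=> e; rewrite inE.
  rewrite sem_if.
  have -> : ceval I (CAnd (CIn vV sReach) (CAnd (CNot (CIn vV sX)) (CNot (CIn vV sY))))
      (set_var k1 vV (Some e)) = (e \in eset h sReach) && (e \in none (cur h)).
    by rewrite /= !(agree_set ak) // !inE negb_or.
  case: ifP => [/andP[eR en]|eRn].
    by [].
  suff : P (e |: S) k1 by [].
  move: IH; rewrite /P; case: (evar k1 vT) => // IH e'.
  rewrite in_setU1 => /predU1P[->|] => [eR|]; last exact: IH.
  by move: eRn; rewrite eR => /= ->.
rewrite /P; case: (evar k vT) => // H.
by apply/pred0P => e /=; apply/negbTE/nandP; case: (boolP (e \in eset h sReach)) => eR;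
  [left; apply: H; rewrite ?inE | right].
Qed.

(** After [i] rounds the part of the path that is left has length at most
    [n - i]. *)
Lemma trace_back_spec h t : evar h vT = Some t ->
  let k := sem trace_back h in
  cur k = foldl (@exch_arc E) (cur h)
    (trace (epar h) (fun v => v \in eset h sSide) n t).
Proof.
move=> ht k; set tr := trace _ _.
pose P i k := exists2 v, evar k vT = Some v &
  forall b, foldl (@exch_arc E) (cur k) (tr (n - i)%N v) b =
            foldl (@exch_arc E) (cur h) (tr n t) b.
suff [v _ kE] : P n k.
  by apply: functional_extensionality => b; rewrite -kE subnn.
apply: for_iter => [|i e k1 li [v kv IH] ak]; first by exists t; rewrite ?subn0.
set k2 := set_var k1 vR (Some e); rewrite sem_seq.
have a2 : agree (modified trace_back) h k2.
  by apply: agree_trans ak (agree_set_var _ _ _).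
have -> : sem (KGet vP vT) k2 = set_var k2 vP (epar h v).
  by rewrite /= /upd /= kv (agree_par ak).
set k3 := set_var k2 vP _.
have k3v : evar k3 vT = Some v by [].
have a3 : agree (modified trace_back) h k3.
  by apply: agree_trans a2 (agree_set_var _ _ _).
have k3S : eset k3 sSide = eset h sSide by rewrite (agree_set a3).
have ni : (n - i = (n - i.+1).+1)%N by rewrite subnSK.
rewrite sem_if; have -> : ceval I (CSome vP) k3 = isSome (epar h v) by rewrite /= updS.
have trS m x : tr m.+1 x = if epar h x is Some u then
    (x \in eset h sSide, (u, x)) :: tr m u else [::] by [].
move: IH; rewrite ni trS; case pv: (epar h v) => [u|] IH; rewrite [isSome _]/=; last first.
  by exists v => // b; rewrite -IH; case: (n - i.+1)%N => // m; rewrite trS pv.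
rewrite sem_seq.
rewrite sem_if; have -> : ceval I (CIn vT sSide) k3 = (v \in eset h sSide).
  by rewrite -k3S /= /upd /= kv.
have k3P : evar k3 vP = Some u by rewrite /k3 /= updS pv.
have ex b : sem (exchange_back b) k3 = set_set (set_set k3 (base_id b) (cur k1 b :\ u))
     (base_id b) (swap (cur k1 b) u v).
  rewrite /exchange_back sem_seq.
  have -> : sem (KDel (base_id b) vP) k3 = set_set k3 (base_id b) (cur k1 b :\ u).
    by rewrite /= /upd /= pv.
  by rewrite /= /upd /= kv PeanoNat.Nat.eqb_refl.
exists u; first by case: ifP => _; rewrite ex /= /upd /= pv.
move=> b; rewrite -IH.
rewrite [RHS](_ : _ = foldl (@exch_arc E)
  (exch_arc (cur k1) (v \in eset h sSide, (u, v))) (tr (n - i.+1)%N u) b) //.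
rewrite !foldl_exch_arc; congr (foldl _ _ _).
by case: (v \in eset h sSide); rewrite ex /exch_arc /= /cur; case: b.
Qed.

(** ** Search for the least slack *)

Lemma least_of_agree (P : E -> R -> Prop) f k k' : vB \notin mvar f -> rEps \notin mreal f ->
  agree f k k' -> least_of P k -> least_of P k'.
Proof. by move=> fv fr a; rewrite /least_of (agree_var a) // (agree_real a). Qed.

Variable D : {set E}.
Hypothesis D_trivial : D = set0 \/ D = setT.
Local Notation static := (static I D).
Local Notation fam := (fam I D).
Local Notation wgt := (wgt I D).
Local Notation in_fam := (in_fam I D).

Definition fp_dual := Footprint [:: vE; vU; vV; vB] [:: sW] [::] [:: rA; rB; rEps] false false.

Section DualScan.
Variable h : env R E.
Hypotheses (sh : static h) (fh : in_fam h).
Local Notation Rh := (eset h sReach).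

Definition leaving b u v x := [/\ u \in Rh, v \notin Rh, swap_arc fam (cur h) b u v
  & x = slack wgt (pot h) b u v].

Lemma probe_spec (P : E -> R -> Prop) b k u v : agree fp_dual h k -> least_of P k ->
    evar k vU = Some u -> evar k vV = Some v -> u \in Rh -> v \notin Rh ->
  let k' := sem (probe b) k in
  agree fp_dual k k' /\ least_of (fun v' x => P v' x \/ v' = v /\ leaving b u v x) k'.
Proof.
move=> ak lo ku kv uR vR k'.
have kp : keeps_pair fp_dual by [].
have [|k1 [a1 kE sl]] := test_arc_spec D_trivial b (keep_least rA) (static_agree _ ak sh)
  (in_fam_agree kp ak fh) ku kv => //.
have ac : swap_arc fam (cur k) b u v = swap_arc fam (cur h) b u v.
  by rewrite /swap_arc (cur_agree b kp ak).
have pk : pot k = pot h := pot_agree kp ak.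
rewrite {}/k' /probe; rewrite {}kE ac; rewrite ac pk in sl.
have a1' : agree fp_dual k k1 by apply: agree_sub a1.
have lo1 : least_of P k1 by apply: least_of_agree a1 lo.
case: ifP => av; last first.
  split=> //; apply: least_of_iff lo1 => v' x; split; first by left.
  by case=> // -[_ []]; rewrite av.
split; first by apply: agree_trans a1' (agree_sub _ (sem_agree I (keep_least rA) k1)).
have k1v : evar k1 vV = Some v by rewrite (agree_var a1).
apply: least_of_iff (keep_least_spec I k1v lo1) => v' x; rewrite (sl av).
split=> -[Pv|[-> H]]; [by left | right | by left | right]; split=> //.
by case: H.
Qed.

Lemma dual_scan_spec : let k := sem dual_scan h in
  agree fp_dual h k /\ least_of (fun v x => exists b u, leaving b u v x) k.
Proof.
move=> k; split; first by apply: agree_sub (sem_agree I dual_scan h).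
rewrite /k /dual_scan sem_seq; set h0 := sem (KNone vB) h.
have a0 : agree fp_dual h h0 by apply: agree_set_var.
pose loop := KFor vV (IF CIn vV sReach THEN KSkip ELSE (probe false ;; probe true)).
pose P S := least_of (fun v x => exists b u, u \in S /\ leaving b u v x).
suff : P setT (sem (KFor vU (WHEN CIn vU sReach DO loop)) h0).
  apply: least_of_iff => v x; split=> -[b [u]]; first by case=> _; exists b, u.
  by exists b, u; rewrite inE.
apply: for_ind => [|S u k1 uS lo a1].
  by rewrite /P /least_of /= => v x [b [u []]]; rewrite inE.
set k2 := set_var k1 vU (Some u).
have a2 : agree fp_dual h k2.
  by apply: agree_trans a0 (agree_trans (agree_sub _ a1) (agree_set_var _ _ _)).
have lo2 : P S k2 by [].
have R2 : eset k2 sReach = Rh by rewrite (agree_set a2).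
rewrite sem_if; have -> : ceval I (CIn vU sReach) k2 = (u \in Rh) by rewrite -R2.
case: (boolP (u \in Rh)) => uR; last first.
  apply: least_of_iff lo2 => v x; split=> -[b [u' [u'S lv]]]; exists b, u'; split => //.
    by rewrite in_setU1 u'S orbT.
  move: u'S; rewrite in_setU1 => /predU1P[u'u|//].
  by case: lv; rewrite u'u (negbTE uR).
pose P2 S2 := least_of (fun v x => (exists b u', u' \in S /\ leaving b u' v x) \/
   v \in S2 /\ exists b, leaving b u v x).
suff : P2 setT (sem loop k2).
  apply: least_of_iff => v x; split.
    case=> [[b [u' [u'S lv]]]|[_ [b lv]]]; first by exists b, u'; rewrite in_setU1 u'S orbT.
    by exists b, u; rewrite setU11.
  case=> b [u' [u'S lv]]; move: u'S; rewrite in_setU1 => /predU1P[u'u|u'S].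
    by right; rewrite inE; split => //; exists b; rewrite -u'u.
  by left; exists b, u'.
apply: for_ind => [|S2 v k3 vS2 lo3 a3].
  by apply: least_of_iff lo2 => v x; split=> [|[|[]]]; [left | | rewrite inE].
set k4 := set_var k3 vV (Some v).
have a4 : agree fp_dual h k4.
  by apply: agree_trans a2 (agree_trans (agree_sub _ a3) (agree_set_var _ _ _)).
have lo4 : P2 S2 k4 by [].
have R4 : eset k4 sReach = Rh by rewrite (agree_set a4).
rewrite sem_if; have -> : ceval I (CIn vV sReach) k4 = (v \in Rh) by rewrite -R4.
case: (boolP (v \in Rh)) => vR.
  apply: least_of_iff lo4 => v' x; split=> -[?|[v'S lv]]; [by left|right|by left|right]; split=> //.
    by rewrite in_setU1 v'S orbT.
  move: v'S; rewrite in_setU1 => /predU1P[v'v|//].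
  by case: lv => b [_]; rewrite v'v vR.
have k4u : evar k4 vU = Some u.
  by have : evar k3 vU = Some u by rewrite (agree_var a3).
have k4v : evar k4 vV = Some v by [].
rewrite sem_seq; have [] := probe_spec false a4 lo4 k4u k4v uR vR.
set k5 := sem (probe false) k4 => a5 lo5.
have a45 := sem_agree I (probe false) k4.
have k5u : evar k5 vU = Some u by rewrite (agree_var a45).
have k5v : evar k5 vV = Some v by rewrite (agree_var a45).
have [_] := probe_spec true (agree_trans a4 a5) lo5 k5u k5v uR vR.
apply: least_of_iff => v' x; split.
  case=> [[[?|[v'S lv]]|[-> lv]]|[-> lv]].
  - by left.
  - by right; rewrite in_setU1 v'S orbT.
  - by right; rewrite setU11; split => //; exists false.
  - by right; rewrite setU11; split => //; exists true.
case=> [?|[]]; first by do 3 left.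
rewrite in_setU1 => /predU1P[->|v'S lv]; last by left; left; right.
by case=> -[] lv; [right | left; right].
Qed.

End DualScan.

Lemma raise_pot_spec h : let k := sem raise_pot h in
  pot k = raise (eset h sReach) (pot h) (ereal h rEps).
Proof.
move=> k; apply: functional_extensionality => e0.
pose P S k := forall e, pot k e =
  if e \in S then raise (eset h sReach) (pot h) (ereal h rEps) e else pot h e.
suff main : P setT k by rewrite main inE.
apply: for_ind => [|S e k1 eS IH ak e']; first by move=> e; rewrite inE.
set k2 := set_var k1 vV (Some e).
have a2 : agree (modified raise_pot) h k2 by apply: agree_trans ak (agree_set_var _ _ _).
have R2 : eset k2 sReach = eset h sReach by rewrite (agree_set a2).
have E2 : ereal k2 rEps = ereal h rEps by rewrite (agree_real a2).
have p2 : pot k2 = pot k1 by [].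
rewrite sem_if; have -> : ceval I (CIn vV sReach) k2 = (e \in eset h sReach) by rewrite -R2.
rewrite in_setU1; case: ifP => eR.
  case: (eqVneq e' e) => [->|_] /=; last by rewrite -IH.
  by rewrite /raise eR -[LHS]/(pot k1 e) IH (negbTE eS).
have -> : sem (KLoad rA aP vV ;; KAdd rA rA rEps ;; KStore aP vV rA) k2 =
  set_arr (set_real (set_real k2 rA (pot k1 e)) rA (pot k1 e + ereal h rEps)) aP e
     (pot k1 e + ereal h rEps) by rewrite -E2.
rewrite /pot [LHS]/= /upd /=.
case: (eqVneq e' e) => [->|_] /=; last by rewrite -IH.
by rewrite /raise eR -/(pot k1) IH (negbTE eS).
Qed.

(** ** Recording the value of a pair *)

Definition holds_best k : Prop :=
  [/\ eset k sBestX \in bases M, eset k sBestY \in bases M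
    & ereal k rBest = objective I (eset k sBestX) (eset k sBestY)].

Lemma evaluate_spec h : earr h aC1 = cost1 I -> earr h aC2 = cost2 I ->
  ereal (sem evaluate h) rA = objective I (eset h sX) (eset h sYout).
Proof.
move=> c1 c2; set X := eset h sX; set Y := eset h sYout.
rewrite /evaluate 2!sem_seq; set h1 := sem KReset _.
rewrite sem_seq; set k := sem (KFor _ _) h1.
pose P S k := ereal k rA = \sum_(e in S) (if e \in X then cost1 I e else 0)
   + \sum_(e in S) (if e \in Y then cost2 I e else 0) /\
  ecnt k = (\sum_(e in S) (e \in symdiff X Y))%N.
have [kA kC] : P setT k.
  apply: for_ind => [|S e k1 eS [IHA IHC] ak].
    by split; rewrite /= ?big_set0 ?addr0 /upd.
  set k2 := set_var k1 vV (Some e).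
  have k2A : ereal k2 rA = ereal k1 rA by [].
  have k2C : ecnt k2 = ecnt k1 by [].
  have a2 : agree (modified (KFor vV tally)) h1 k2 by apply: agree_trans ak (agree_set_var _ _ _).
  have k2X : eset k2 sX = X by rewrite (agree_set a2).
  have k2Y : eset k2 sYout = Y by rewrite (agree_set a2).
  have k2c1 : earr k2 aC1 = cost1 I by rewrite (agree_arr a2).
  have k2c2 : earr k2 aC2 = cost2 I by rewrite (agree_arr a2).
  have k2v : evar k2 vV = Some e by [].
  move: k2 k2A k2C k2X k2Y k2c1 k2c2 k2v {a2} => k2 k2A k2C k2X k2Y k2c1 k2c2 k2v.
  rewrite /P !big_setU1 // symdiff_in -IHC -k2C /tally !sem_seq.
  have -> : sem (WHEN CIn vV sX DO (KLoad rB aC1 vV ;; KAdd rA rA rB)) k2 =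
     if e \in X then set_real (set_real k2 rB (cost1 I e)) rA (ereal k2 rA + cost1 I e) else k2.
    by rewrite sem_if /= k2v k2X k2c1.
  set k3 := if _ then _ else _.
  have k3E : [/\ evar k3 vV = Some e, eset k3 sX = X, eset k3 sYout = Y,
      earr k3 aC2 = cost2 I & ecnt k3 = ecnt k2] by rewrite /k3; case: (e \in X).
  have k3A : ereal k3 rA = ereal k2 rA + if e \in X then cost1 I e else 0.
    by rewrite /k3; case: (e \in X); rewrite ?addr0.
  case: k3E k3A; move: k3 => k3 k3v k3X k3Y k3c2 k3C k3A.
  have -> : sem (WHEN CIn vV sYout DO (KLoad rB aC2 vV ;; KAdd rA rA rB)) k3 =
     if e \in Y then set_real (set_real k3 rB (cost2 I e)) rA (ereal k3 rA + cost2 I e) else k3.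
    by rewrite sem_if /= k3v k3Y k3c2.
  set k4 := if _ then _ else _.
  have k4E : [/\ evar k4 vV = Some e, eset k4 sX = X, eset k4 sYout = Y
      & ecnt k4 = ecnt k2] by rewrite /k4; case: (e \in Y).
  have k4A : ereal k4 rA = ereal k3 rA + if e \in Y then cost2 I e else 0.
    by rewrite /k4; case: (e \in Y); rewrite ?addr0.
  case: k4E k4A; move: k4 => k4 k4v k4X k4Y k4C k4A.
  have -> : sem (WHEN CXor (CIn vV sX) (CIn vV sYout) DO KIncr) k4 =
     if (e \in X) (+) (e \in Y) then set_cnt k4 (ecnt k4).+1 else k4.
    by rewrite sem_if /= k4v k4X k4Y.
  split.
    have -> : ereal (if (e \in X) (+) (e \in Y) then set_cnt k4 (ecnt k4).+1 else k4) rA = ereal k4 rA.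
      by case: ifP.
    by rewrite k4A k3A k2A IHA -addrA addrACA; congr (_ + _); apply: addrC.
  by case: ifP; rewrite /= k4C.
have kC' : ecnt k = #|symdiff X Y|.
  by rewrite kC -sum1_card big_mkcond [RHS]big_mkcond /=; apply: eq_bigr => e _; rewrite inE; case: (e \in _).
rewrite sem_seq /= /upd /= kC' max_card kA /objective.
have tE (A : {set E}) (f : E -> R) :
    \sum_(e in [set: E]) (if e \in A then f e else 0) = \sum_(e in A) f e.
  by rewrite [RHS]big_mkcond /=; apply: eq_bigl => e; rewrite inE.
by rewrite !tE.
Qed.

Lemma save_spec h : let k := sem save h in
  [/\ eset k sBestX = eset h sX, eset k sBestY = eset h sYout & ereal k rBest = ereal h rA].
Proof.
move=> k; rewrite /k /save 2!sem_seq; set k1 := sem _ h; set k2 := sem _ k1.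
have ak1 := sem_agree I (assign sBestX (CIn vE sX)) h.
have ak2 := sem_agree I (assign sBestY (CIn vE sYout)) k1.
set k3 := sem _ k2; have ak3 := sem_agree I (copy rBest rA) k2.
split.
- rewrite (agree_set ak3) // (agree_set ak2) // /k1 assign_set //.
  by apply/setP => e; rewrite inE.
- rewrite (agree_set ak3) // /k2 assign_set //.
  by apply/setP => e; rewrite inE /= (agree_set ak1).
- by rewrite /k3 /= /upd /= addr0 (agree_real ak2) // (agree_real ak1).
Qed.

Lemma record_spec h : static h -> in_fam h -> holds_best h ->
  let k := sem record h in
  [/\ holds_best k, ereal k rBest <= ereal h rBest
    & ereal k rBest <= objective I (cur h false) (symdiff (cur h true) D)].
Proof.
move=> sh fh [bX bY hb] k.
rewrite /k /record sem_seq; set h1 := sem _ h.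
have a1 := sem_agree I (assign sYout (CXor (CIn vE sY) (CIn vE sMask))) h.
have h1Y : eset h1 sYout = symdiff (cur h true) D.
  rewrite /h1 assign_set //; apply/setP => e; rewrite inE symdiff_in /= /cur.
  by rewrite (st_mask sh true).
rewrite sem_seq; set h2 := sem evaluate h1.
have a2 := sem_agree I evaluate h1.
have h2A : ereal h2 rA = objective I (cur h false) (symdiff (cur h true) D).
  rewrite /h2 evaluate_spec ?h1Y //.
  - by rewrite (agree_set a1).
  - by rewrite (agree_arr a1) // (st_c1 sh).
  - by rewrite (agree_arr a1) // (st_c2 sh).
have h2b : ereal h2 rBest = ereal h rBest by rewrite (agree_real a2) // (agree_real a1).
have h2X : eset h2 sX = cur h false by rewrite (agree_set a2) // (agree_set a1).
have h2Y : eset h2 sYout = symdiff (cur h true) D by rewrite (agree_set a2) // h1Y.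
rewrite sem_if; have -> : ceval I (CLt rA rBest) h2 = (ereal h2 rA < ereal h2 rBest) by [].
rewrite -h2A -h2b; case: ltP => lt; last first.
  have h2BX : eset h2 sBestX = eset h sBestX by rewrite (agree_set a2) // (agree_set a1).
  have h2BY : eset h2 sBestY = eset h sBestY by rewrite (agree_set a2) // (agree_set a1).
  by rewrite -[sem KSkip h2]/h2; split=> //; split; rewrite ?h2b ?h2BX ?h2BY.
have [] := save_spec h2; set k3 := sem save h2.
rewrite h2X h2Y => k3X k3Y k3b.
split; last by rewrite k3b.
  split; rewrite ?k3b ?k3X ?k3Y //.
  - by have := fh false; rewrite inE symdiff0.
  - by have := fh true; rewrite inE.
by rewrite k3b ltW.
Qed.

End Phase.

(** * The two phases *)

Definition iteration :=
  search ;; pick_target ;;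
  IF CSome vT THEN (trace_back ;; record)
  ELSE (dual_scan ;; WHEN CSome vB DO raise_pot).

Definition rep x c := c ;; KFor x c.

Definition set_weight :=
  KLoad rA aC2 vV ;; (WHEN CIn vV sMask DO (KZero rB ;; KSub rA rB rA)) ;;
  KStore aW vV rA ;; KZero rA ;; KStore aP vV rA.

Definition start :=
  assign sX (CIn vE sX0) ;; assign sY (CXor (CIn vE sY0) (CIn vE sMask)) ;;
  KFor vV set_weight.

Definition phase := start ;; record ;; rep vI (rep vJ iteration).

Definition main :=
  greedy aC1 ;; assign sX0 (CIn vE sW) ;;
  greedy aC2 ;; assign sY0 (CIn vE sW) ;;
  assign sX (CIn vE sX0) ;; assign sYout (CIn vE sY0) ;; evaluate ;; save ;;
  phase ;; assign sMask (CEq vE vE) ;; phase.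

Section Phase.
Variables (R : realType) (E : finType) (I : instance R E).
Local Notation M := (imat I).
Local Notation n := #|E|.
Implicit Types (h k : env R E) (S U G X Y : {set E}).
Local Notation sem := (sem I).
Variable D : {set E}.
Hypothesis D_trivial : D = set0 \/ D = setT.
Local Notation static := (static I D).
Local Notation fam := (fam I D).
Local Notation wgt := (wgt I D).
Local Notation in_fam := (in_fam I D).
Local Notation certificate := (certificate fam wgt).
Local Notation searched := (searched fam wgt).

Definition value (Z : bool -> {set E}) : R :=
  objective I (Z false) (symdiff (Z true) D).

Lemma symdiffK X Y : symdiff (symdiff X Y) Y = X.
Proof. by apply/setP => e; rewrite !symdiff_in -addbA addbb addbF. Qed.

Lemma weight_symdiff : exists c, forall Y,
  weight (wgt true) (symdiff Y D) = weight (cost2 I) Y + c.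
Proof.
case: D_trivial => ->.
  exists 0 => Y; rewrite symdiff0 addr0 /weight /=.
  by apply: eq_bigr => e _; rewrite inE.
exists (- weight (cost2 I) setT) => Y; rewrite symdiffT /weight.
have -> : \sum_(e in [set: E]) cost2 I e =
    \sum_(e in Y) cost2 I e + \sum_(e in ~: Y) cost2 I e.
  rewrite (big_setID Y) /= setTI setTD //.
rewrite (eq_bigr (fun e => - cost2 I e)); last by move=> e _; rewrite /= inE sub0r.
by rewrite sumrN; ring.
Qed.

Lemma card_symdiff X Y : #|symdiff X Y| = (#|X| + #|Y| - 2 * #|X :&: Y|)%N.
Proof.
rewrite /symdiff cardsU (_ : _ :&: _ = set0) ?cards0 ?subn0; last first.
  by apply/setP => e; rewrite !inE; case: (e \in X); case: (e \in Y).
rewrite !cardsD [Y :&: X]setIC.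
have := subset_leq_card (subsetIl X Y); have := subset_leq_card (subsetIr X Y); lia.
Qed.

(** Given the size of the intersection, the penalty is constant, and complementing
    the second base changes its cost into a constant minus the cost of the
    complement. *)
Lemma value_le Z Z' : (forall b, Z b \in fam b) -> (forall b, Z' b \in fam b) ->
    #|both Z| = #|both Z'| -> pair_weight wgt Z <= pair_weight wgt Z' ->
  value Z <= value Z'.
Proof.
move=> ZF ZF' ek; have [c wE] := weight_symdiff.
have cZ b : #|Z b| = #|Z' b|.
  exact: exchange_card (sym_exchangeW (fam_exchange D_trivial (b := b))) _ _ (ZF b) (ZF' b).
have w0 (V : bool -> {set E}) : weight (wgt false) (V false) = weight (cost1 I) (V false) by [].
have w1 (V : bool -> {set E}) : weight (wgt true) (V true) = weight (cost2 I) (symdiff (V true) D) + c.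
  by rewrite -wE symdiffK.
rewrite /pair_weight !w0 !w1 /value /objective => le.
have -> : #|symdiff (Z false) (symdiff (Z true) D)| =
          #|symdiff (Z' false) (symdiff (Z' true) D)|.
  have sA (V : bool -> {set E}) : symdiff (V false) (symdiff (V true) D) =
      symdiff (symdiff (V false) (V true)) D.
    by apply/setP => e; rewrite !symdiff_in addbA.
  have e0 : #|symdiff (Z false) (Z true)| = #|symdiff (Z' false) (Z' true)|.
    by rewrite !card_symdiff !cZ; move: ek; rewrite /both => ->.
  rewrite !sA; case: D_trivial => ->; rewrite ?symdiff0 // !symdiffT.
  by apply: (@addnI #|symdiff (Z false) (Z true)|); rewrite {2}e0 !cardsC.
by rewrite lerD2r; move: le; rewrite /weight; lra.
Qed.

(** An augmentation makes [none Z] smaller but may shrink the searched set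
    arbitrarily, hence the factor [n.+1]. *)
Definition rank (Z : bool -> {set E}) (S : {set E}) : nat :=
  (#|none Z| * n.+1 + (n - #|S|))%N.

(** The three outcomes are an augmentation, a dual step, and the absence of arcs
    that leave the searched set. *)
Lemma iteration_spec h lam : static h -> holds_best I h ->
    certificate (cur h) (pot h) lam ->
  let k := sem iteration h in
  [/\ [/\ static k, holds_best I k & ereal k rBest <= ereal h rBest],
      exists lam', certificate (cur k) (pot k) lam',
      cur k = cur h \/ (#|both (cur k)|.+1 = #|both (cur h)|)%N /\ ereal k rBest <= value (cur k)
    & fewest_common fam (cur h) \/ exists S lev par sd,
        searched (cur h) (pot h) S lev par sd /\
        forall S2 lev2 par2 sd2, searched (cur k) (pot k) S2 lev2 par2 sd2 ->
          (rank (cur k) S2 < rank (cur h) S)%N].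
Proof.
move=> sh bh ch k.
have fx b : sym_exchange (fam b) by apply: fam_exchange.
have fh : in_fam h by move=> b; apply: certificate_feasible ch.
rewrite /k /iteration sem_seq; set h1 := sem search h.
have a1 := sem_agree I search h; rewrite -/h1 in a1.
have [lev] := search_spec D_trivial sh fh; rewrite -/h1.
set S := eset h1 sReach; set par := epar h1; set sd := fun v => v \in eset h1 sSide.
move=> sr levn; rewrite sem_seq; set h2 := sem pick_target h1.
have a2 := sem_agree I pick_target h1; rewrite -/h2 in a2.
have curE f x y : keeps_pair f -> agree f x y -> cur y = cur x.
  by move=> kp a; apply: functional_extensionality => b; apply: cur_agree a.
have h1c : cur h1 = cur h by apply: curE a1.
have h2c : cur h2 = cur h by rewrite -h1c; apply: curE a2.
have h2p : pot h2 = pot h by rewrite (pot_agree _ a2) // (pot_agree _ a1).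
have s2 : static h2 by apply: static_agree a2 (static_agree _ a1 sh).
have h2S : eset h2 sReach = S by rewrite (agree_set a2).
have b2 : holds_best I h2.
  case: bh => b1 b3 b4; split; rewrite ?(agree_real a2) ?(agree_real a1) //;
    by rewrite !(agree_set a2) // !(agree_set a1).
have h2b : ereal h2 rBest = ereal h rBest by rewrite (agree_real a2) // (agree_real a1).
have := pick_target_spec I h1; cbv zeta; rewrite -/h2 -/S h1c sem_if.
have -> : ceval I (CSome vT) h2 = isSome (evar h2 vT) by [].
case tE: (evar h2 vT) => [t|]; cbv beta iota delta [isSome].
- case=> tS tn; rewrite sem_seq; set h3 := sem trace_back h2.
  have a3 := sem_agree I trace_back h2; rewrite -/h3 in a3.
  have h3c := trace_back_spec I tE; rewrite -/h3 (agree_par a2) // (agree_set a2) // h2c -/par -/sd in h3c.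
  have [] := augment fx ch sr tn tS (levn t tS); rewrite -h3c => c3 both3 none3.
  have p3 : pot h3 = pot h by rewrite -h2p /pot (agree_arr a3).
  have s3 : static h3 by apply: static_agree a3 s2.
  have b3 : holds_best I h3.
    case: b2 => *; split; rewrite ?(agree_real a3) //; by rewrite !(agree_set a3).
  have f3 : in_fam h3 by move=> b; apply: certificate_feasible c3.
  have [b4 le4 le4'] := record_spec s3 f3 b3.
  set h4 := sem record h3 in b4 le4 le4' *.
  have a4 := sem_agree I record h3; rewrite -/h4 in a4.
  have h4c : cur h4 = cur h3 by apply: curE a4.
  have h4p : pot h4 = pot h3 by apply: pot_agree a4.
  rewrite h4c h4p p3; split.
  + split=> //; first by apply: static_agree a4 s3.
    by apply: le_trans le4 _; rewrite (agree_real a3) // h2b.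
  + by exists lam.
  + by right.
  + right; exists S, lev, par, sd; split => // S2 _ _ _ _.
    rewrite /rank; have : (#|none (cur h3)|.+1 * n.+1 <= #|none (cur h)| * n.+1)%N.
      by rewrite leq_mul2r none3 orbT.
    by rewrite mulSn; lia.
- move=> dis; rewrite sem_seq; set h3 := sem dual_scan h2.
  have f2 : in_fam h2 by move=> b; rewrite h2c.
  have [a3] := dual_scan_spec D_trivial s2 f2; rewrite -/h3 => lo.
  have kp3 : keeps_pair fp_dual by [].
  have h3c : cur h3 = cur h by rewrite -h2c; apply: curE a3.
  have h3p : pot h3 = pot h by rewrite -h2p; apply: pot_agree a3.
  have s3 : static h3 by apply: static_agree a3 s2.
  have h3S : eset h3 sReach = S by rewrite (agree_set a3).
  have b3 : holds_best I h3.
    case: b2 => *; split; rewrite ?(agree_real a3) //; by rewrite !(agree_set a3).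
  have h3b : ereal h3 rBest = ereal h rBest by rewrite (agree_real a3).
  have lvE b u v x : leaving I D h2 b u v x <->
      [/\ u \in S, v \notin S, swap_arc fam (cur h) b u v & x = slack wgt (pot h) b u v].
    by rewrite /leaving h2S h2c h2p.
  have bS : both (cur h) \subset S by apply/subsetP => e /(srch_both sr)[].
  rewrite sem_if; have -> : ceval I (CSome vB) h3 = isSome (evar h3 vB) by [].
  move: lo; rewrite /least_of; case: (evar h3 vB) => [v|]; cbv beta iota delta [isSome]; last first.
    move=> no; rewrite -[sem KSkip h3]/h3; rewrite h3c h3p; split.
    + by split=> //; rewrite h3b.
    + by exists lam.
    + by left.
    + left; apply: (no_arcs_out fx ch bS dis) => b u v uS vS; apply/negP => av.
      by apply: (no v (slack wgt (pot h) b u v)); exists b, u; apply/lvE.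
  move=> [[b [u /lvE[uS vS av eE]]] le].
  set h4 := sem raise_pot h3; have a4 := sem_agree I raise_pot h3; rewrite -/h4 in a4.
  have h4p : pot h4 = raise S (pot h) (ereal h3 rEps).
    by rewrite /h4 raise_pot_spec h3S h3p.
  have h4c : cur h4 = cur h.
    rewrite -h3c; apply: functional_extensionality => c.
    by case: c; rewrite /cur (agree_set a4).
  have e0 : 0 <= ereal h3 rEps by rewrite eE; apply: arc_slack_ge0 ch av.
  rewrite h4c h4p; split.
  + split.
    * by apply: static_agree a4 s3.
    * case: b3 => *; split; rewrite ?(agree_real a4) //; by rewrite !(agree_set a4).
    * by rewrite (agree_real a4) // h3b.
  + exists (lam + ereal h3 rEps); apply: certificate_raise => //.
    by move=> c x y xS yS axy; apply: (le y); exists c, x; apply/lvE.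
  + by left.
  + right; exists S, lev, par, sd; split => // S2 lev2 par2 sd2 sr2.
    have lt := searched_grows sr sr2 uS vS av (esym eE).
    by rewrite /rank ltn_add2l ltn_sub2l // (leq_trans lt) // max_card.
Qed.

Lemma rep_ind x c m (P : nat -> env R E -> Prop) h i :
    (forall i k v, P i k -> P i (set_var k x v)) ->
    (forall i k, P i k -> P (i + m)%N (sem c k)) -> P i h ->
  P (i + n.+1 * m)%N (sem (rep x c) h).
Proof.
move=> Px Pc Ph; rewrite /rep sem_seq mulSn addnA.
apply: (for_iter (P := fun j => P (i + m + j * m)%N)) => [|j e k jn IH _].
  by rewrite addn0; apply/Px/Pc.
by rewrite mulSnr addnA; apply/Pc/Px.
Qed.

(** Each iteration lowers the rank until the intersection is as small as
    possible; [c0] is the size that it had at the beginning, and the recorded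
    value is at most that of every pair whose intersection has a size in
    between. *)
Definition phase_inv h0 c0 i k : Prop :=
  [/\ [/\ static k, holds_best I k & ereal k rBest <= ereal h0 rBest],
      exists lam, certificate (cur k) (pot k) lam,
      forall Z', (forall b, Z' b \in fam b) ->
        (#|both (cur k)| <= #|both Z'| <= c0)%N -> ereal k rBest <= value Z'
    & fewest_common fam (cur k) \/ forall S lev par sd,
        searched (cur k) (pot k) S lev par sd -> (rank (cur k) S + i < n.+1 * n.+1)%N].

Lemma phase_inv_iteration h0 c0 i k : phase_inv h0 c0 i k ->
  phase_inv h0 c0 (i + 1) (sem iteration k).
Proof.
move=> [[sk bk lek] [lam ck] cov prog].
have [[sk' bk' lek'] [lam' ck'] step down] := iteration_spec sk bk ck.
set k' := sem iteration k in sk' bk' lek' ck' step down *.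
have f' b : cur k' b \in fam b by apply: certificate_feasible ck'.
split.
- by split=> //; apply: le_trans lek' lek.
- by exists lam'.
- move=> Z' ZF /andP[l1 l2]; case: step => [same|[card_k' val_k']].
    by apply: le_trans lek' (cov _ ZF _); rewrite -same l1.
  move: l1; rewrite leq_eqVlt card_k' => /predU1P[ek|l1].
    apply: le_trans val_k' _; apply: value_le => //.
    by apply: certificate_opt ck' _ _ => // b; apply: fam_exchange.
  by apply: le_trans lek' (cov _ ZF _); rewrite l1 l2.
- have fin : fewest_common fam (cur k) -> fewest_common fam (cur k').
    move=> few; case: step => [-> //|[card_k' _]].
    by have := few _ f'; rewrite -card_k' ltnn.
  case: prog => [few|prog]; first by left; apply: fin.
  case: down => [few|[S [lev [par [sd [sr down]]]]]]; first by left; apply: fin.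
  right=> S2 lev2 par2 sd2 sr2; have := prog _ _ _ _ sr; have := down _ _ _ _ sr2.
  by move: (rank _ S2) (rank _ S) => r2 r lt; apply: leq_trans; lia.
Qed.

Lemma phase_loop h0 c0 k : phase_inv h0 c0 0 k ->
  let k' := sem (rep vI (rep vJ iteration)) k in
  phase_inv h0 c0 (n.+1 * n.+1) k'.
Proof.
move=> inv k'; have sv i k1 x v : phase_inv h0 c0 i k1 -> phase_inv h0 c0 i (set_var k1 x v).
  by move=> [[sk ? ?] ? ? ?]; split=> //; split=> //; case: sk.
rewrite -[(n.+1 * n.+1)%N]add0n.
apply: rep_ind inv => [i k1 v|i k1 inv1]; first exact: sv.
have := @rep_ind vJ iteration 1 (phase_inv h0 c0) k1 i; rewrite muln1; apply => // [j k2 v|j k2].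
  exact: sv.
exact: phase_inv_iteration.
Qed.

Lemma set_weight_spec h : earr h aC2 = cost2 I -> eset h sMask = D ->
  let k := sem (KFor vV set_weight) h in earr k aW = wgt true /\ pot k = fun=> 0.
Proof.
move=> hc hD k.
pose P (S : {set E}) k := forall e, e \in S -> earr k aW e = wgt true e /\ pot k e = 0.
suff main : P setT k.
  by split; apply: functional_extensionality => e; have [] := main e (in_setT e).
apply: for_ind => [|S e k1 eS IH ak e']; first by move=> e; rewrite inE.
have c1 : earr k1 aC2 = cost2 I by rewrite (agree_arr ak).
have D1 : eset k1 sMask = D by rewrite (agree_set ak).
set k2 := set_var k1 vV (Some e); rewrite /set_weight 2!sem_seq.
set k3 := sem (WHEN _ DO _) _.
have k3A : ereal k3 rA = wgt true e.
  rewrite /k3 sem_if; have -> : ceval I (CIn vV sMask) (sem (KLoad rA aC2 vV) k2) = (e \in D).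
    by rewrite -D1.
  by rewrite /wgt; case: ifP => _; rewrite /= /upd /= c1.
have k3v : evar k3 vV = Some e by rewrite /k3 sem_if; case: ifP.
have k3a : earr k3 = earr k1 by rewrite /k3 sem_if; case: ifP.
move: k3 k3A k3v k3a => k3 k3A k3v k3a.
rewrite /= /upd /= !k3v /= /pot /= /upd /= k3a k3A in_setU1.
by case: (eqVneq e' e) => [->|_] //= /IH[].
Qed.

Definition initial h b := if b then symdiff (eset h sY0) D else eset h sX0.

Lemma phase_spec h : eset h (mask_id false) = set0 -> eset h sMask = D ->
    earr h aC1 = cost1 I -> earr h aC2 = cost2 I ->
    eset h sX0 \in minimizers (bases M) (cost1 I) ->
    eset h sY0 \in minimizers (bases M) (cost2 I) -> holds_best I h ->
  let k := sem phase h in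
  [/\ holds_best I k, ereal k rBest <= ereal h rBest
    & forall Z', (forall b, Z' b \in fam b) -> (#|both Z'| <= #|both (initial h)|)%N ->
        ereal k rBest <= value Z'].
Proof.
move=> h0 hD hc1 hc2 hX hY bh k; rewrite /k /phase sem_seq.
set h1 := sem start h; have a1 := sem_agree I start h; rewrite -/h1 in a1.
have [wE pE cE] : [/\ earr h1 aW = wgt true, pot h1 = fun=> 0 & cur h1 = initial h].
  rewrite /h1 /start 2!sem_seq; set ha := sem _ h; set hb := sem _ ha.
  have aa := sem_agree I (assign sX (CIn vE sX0)) h.
  have ab := sem_agree I (assign sY (CXor (CIn vE sY0) (CIn vE sMask))) ha.
  have [||w1 p1] := @set_weight_spec hb.
  - by rewrite (agree_arr ab) // (agree_arr aa).
  - by rewrite (agree_set ab) // (agree_set aa).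
  split=> //; apply: functional_extensionality => b.
  have ac := sem_agree I (KFor vV set_weight) hb.
  rewrite /cur (agree_set ac); last by case: (b).
  case: b => /=.
    rewrite /hb assign_set //; apply/setP => e.
    by rewrite inE symdiff_in /= !(agree_set aa) // hD.
  rewrite (agree_set ab) // /ha assign_set //; apply/setP => e.
  by rewrite inE.
have s1 : static h1.
  split=> [b|||//]; rewrite ?(agree_arr a1) //.
  by rewrite (agree_set a1); [case: (b) | case: (b)].
have Fm b : cur h1 b \in minimizers (fam b) (wgt b).
  rewrite cE; have [c wc] := weight_symdiff; case: b; rewrite /initial; last first.
    by rewrite (_ : fam false = bases M) //; apply/setP => B; rewrite inE symdiff0.
  have /minimizersP[YM mY] := hY; apply/minimizersP; split; first by rewrite inE symdiffK.
  move=> A; rewrite inE => AM; have := mY _ AM.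
  by rewrite wc -{2}[A](symdiffK A D) wc lerD2r.
have c1 : certificate (cur h1) (pot h1) 0.
  by rewrite pE; apply: certificate_init.
have b1 : holds_best I h1.
  by case: bh => *; split; rewrite ?(agree_real a1) //; rewrite !(agree_set a1).
have f1 : in_fam h1 by move=> b; apply: certificate_feasible c1.
rewrite sem_seq; set h2 := sem record h1.
have a2 := sem_agree I record h1; rewrite -/h2 in a2.
have [b2 le2 val2] := record_spec s1 f1 b1; rewrite -/h2 in b2 le2 val2.
have h2c : cur h2 = cur h1.
  by apply: functional_extensionality => b; apply: cur_agree a2.
have h2p : pot h2 = pot h1 by apply: pot_agree a2.
have h2b : ereal h2 rBest <= ereal h rBest by apply: le_trans le2 _; rewrite (agree_real a1).
have inv : phase_inv h #|both (initial h)| 0 h2.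
  split.
  - by split=> //; apply: static_agree a2 s1.
  - by exists 0; rewrite h2c h2p.
  - move=> Z' ZF; rewrite h2c cE -eqn_leq => /eqP ek; apply: le_trans val2 _.
    apply: value_le => //; first by rewrite cE.
    by apply: certificate_opt c1 _ _ => //; rewrite ?cE // => b; apply: fam_exchange.
  - right=> S lev par sd _; rewrite /rank addn0 mulSn.
    apply: (@leq_ltn_trans (n * n.+1 + n)%N).
      by rewrite leq_add ?leq_mul ?max_card ?leq_subr.
    by rewrite addnC ltn_add2r.
have := phase_loop inv; cbv zeta; set h3 := sem (rep _ _) h2.
move=> [[s3 b3 le3] [lam c3] cov [few|prog]]; last first.
  have f3 : in_fam h3 by move=> b'; apply: certificate_feasible c3.
  have [lev sr _] := search_spec D_trivial s3 f3.
  have a4 := sem_agree I search h3.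
  by have := prog _ _ _ _ sr; rewrite ltnNge leq_addl.
split=> // Z' ZF le; apply: cov => //; rewrite le andbT.
exact: few.
Qed.

End Phase.

Section Main.
Variables (R : realType) (E : finType) (I : instance R E).
Local Notation M := (imat I).
Local Notation sem := (sem I).

(** The first phase covers the pairs with at most as many common elements as the
    greedy pair, the second one, with the complement of the second base, the
    pairs with at least as many. *)
Lemma main_spec : let k := sem main (init_env I) in
  optimal I (eset k sBestX) (eset k sBestY).
Proof.
rewrite /main; set h0 := init_env I.
rewrite sem_seq; set h1 := sem (greedy aC1) h0.
have a1 := sem_agree I (greedy aC1) h0; rewrite -/h1 in a1.
have g1 : eset h1 sW \in minimizers (bases M) (cost1 I) by apply: greedy_spec.
rewrite sem_seq; set h2 := sem _ h1.
have a2 := sem_agree I (assign sX0 (CIn vE sW)) h1; rewrite -/h2 in a2.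
have X2 : eset h2 sX0 = eset h1 sW.
  by rewrite /h2 assign_set //; apply/setP => e; rewrite inE.
rewrite sem_seq; set h3 := sem (greedy aC2) h2.
have a3 := sem_agree I (greedy aC2) h2; rewrite -/h3 in a3.
have g3 : eset h3 sW \in minimizers (bases M) (cost2 I).
  by apply: greedy_spec; rewrite (agree_arr a2) // (agree_arr a1).
rewrite sem_seq; set h4 := sem _ h3.
have a4 := sem_agree I (assign sY0 (CIn vE sW)) h3; rewrite -/h4 in a4.
have Y4 : eset h4 sY0 = eset h3 sW.
  by rewrite /h4 assign_set //; apply/setP => e; rewrite inE.
rewrite sem_seq; set h5 := sem _ h4.
have a5 := sem_agree I (assign sX (CIn vE sX0)) h4; rewrite -/h5 in a5.
have X5 : eset h5 sX = eset h4 sX0.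
  by rewrite /h5 assign_set //; apply/setP => e; rewrite inE.
rewrite sem_seq; set h6 := sem _ h5.
have a6 := sem_agree I (assign sYout (CIn vE sY0)) h5; rewrite -/h6 in a6.
have Y6 : eset h6 sYout = eset h5 sY0.
  by rewrite /h6 assign_set //; apply/setP => e; rewrite inE.
rewrite sem_seq; set h7 := sem evaluate h6.
have a7 := sem_agree I evaluate h6; rewrite -/h7 in a7.
have arr6 j : earr h6 j = earr h0 j.
  by rewrite !(agree_arr a6, agree_arr a5, agree_arr a4, agree_arr a3, agree_arr a2, agree_arr a1).
have v7 : ereal h7 rA = objective I (eset h1 sW) (eset h3 sW).
  rewrite /h7 evaluate_spec ?arr6 // Y6 (agree_set a6) // X5 (agree_set a5) // Y4.
  by rewrite (agree_set a4) // (agree_set a3) // X2.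
rewrite sem_seq; set h8 := sem save h7.
have a8 := sem_agree I save h7; rewrite -/h8 in a8.
have arr8 j : earr h8 j = earr h0 j by rewrite (agree_arr a8) // (agree_arr a7) // arr6.
have [X8 Y8 v8] := save_spec I h7; rewrite -/h8 in X8 Y8 v8.
have h8X0 : eset h8 sX0 = eset h1 sW.
  rewrite (agree_set a8) // (agree_set a7) // (agree_set a6) // (agree_set a5) //.
  by rewrite (agree_set a4) // (agree_set a3) // X2.
have h8Y0 : eset h8 sY0 = eset h3 sW.
  by rewrite (agree_set a8) // (agree_set a7) // (agree_set a6) // (agree_set a5) // Y4.
have m8 b : eset h8 (mask_id b) = set0.
  case: b; rewrite (agree_set a8) // (agree_set a7) // (agree_set a6) // (agree_set a5) //;
    by rewrite (agree_set a4) // (agree_set a3) // (agree_set a2) // (agree_set a1).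
have X7 : eset h7 sX = eset h1 sW.
  rewrite (agree_set a7) // (agree_set a6) // X5.
  by rewrite (agree_set a4) // (agree_set a3) // X2.
have Y7 : eset h7 sYout = eset h3 sW by rewrite (agree_set a7) // Y6 (agree_set a5) // Y4.
have /minimizersP[XM _] := g1; have /minimizersP[YM _] := g3.
have b8 : holds_best I h8 by split; rewrite ?X8 ?Y8 ?X7 ?Y7 // v8 v7.
rewrite sem_seq.
have [||||||||b9 le9 cov9] := @phase_spec _ _ I set0 _ h8.
- by left.
- exact: (m8 false).
- exact: (m8 true).
- by rewrite arr8.
- by rewrite arr8.
- by rewrite h8X0.
- by rewrite h8Y0.
- exact: b8.
set h9 := sem phase h8 in b9 le9 cov9 *.
have a9 := sem_agree I phase h8; rewrite -/h9 in a9.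
rewrite sem_seq; set h10 := sem _ h9.
have a10 := sem_agree I (assign sMask (CEq vE vE)) h9; rewrite -/h10 in a10.
have M10 : eset h10 sMask = setT.
  by rewrite /h10 assign_set //; apply/setP => e; rewrite !inE /= eqxx.
have arr10 j : j \in [:: aC1; aC2] -> earr h10 j = earr h0 j.
  by rewrite !inE => /orP[] /eqP->; rewrite (agree_arr a10) // (agree_arr a9) // arr8.
have b10 : holds_best I h10.
  by case: b9 => *; split; rewrite ?(agree_real a10) //; rewrite !(agree_set a10).
have X10 : eset h10 sX0 = eset h1 sW by rewrite (agree_set a10) // (agree_set a9) // h8X0.
have Y10 : eset h10 sY0 = eset h3 sW by rewrite (agree_set a10) // (agree_set a9) // h8Y0.
have [||||||||b11 le11 cov11] := @phase_spec _ _ I setT _ h10.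
- by right.
- by rewrite (agree_set a10) // (agree_set a9) // (m8 false).
- exact: M10.
- by rewrite arr10.
- by rewrite arr10.
- by rewrite X10.
- by rewrite Y10.
- exact: b10.
set h11 := sem phase h10 in b11 le11 cov11 *; cbv zeta.
case: b11 => bX bY bE; split; first by split.
move=> X' Y' [X'M Y'M]; rewrite -bE.
pose X0 := eset h1 sW; pose Y0 := eset h3 sW.
have cX : #|X'| = #|X0| by apply: (base_card X'M XM).
case: (leqP #|X' :&: Y'| #|X0 :&: Y0|) => le.
- apply: le_trans le11 _; rewrite (agree_real a10) //.
  pose Z' b := if b then Y' else X'.
  rewrite -[objective _ _ _](_ : value I set0 Z' = _); last by rewrite /value symdiff0.
  apply: cov9 => [b|]; first by rewrite inE; case: b; rewrite /mask symdiff0.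
  by rewrite /both /initial h8X0 h8Y0 symdiff0.
- pose Z' b := if b then ~: Y' else X'.
  rewrite -[objective _ _ _](_ : value I setT Z' = _); last first.
    by rewrite /value symdiffT setCK.
  apply: cov11 => [b|].
    by rewrite inE; case: b; rewrite /mask ?symdiffT ?setCK ?symdiff0.
  rewrite /both /initial X10 Y10 symdiffT /Z' -!setDE -/X0 -/Y0.
  by rewrite !cardsD cX leq_sub2l // ltnW.
Qed.

End Main.

Lemma main_wf : wf main. Proof. by []. Qed.

Theorem corollary1 (R : realType) :
  exists p : prog, solves R p /\ strongly_polynomial R p.
Proof.
have [f fE] := cost_poly main.
exists (program main sBestX sBestY).
pose out (E : finType) (I : instance R E) := program_correct I main_wf
  (isT : (sBestX < n_sets)%N) (isT : (sBestY < n_sets)%N).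
split.
  move=> E I tr e; have [tr' [e' [oX oY] _ _]] := out E I.
  rewrite (exec_det e e') oX oY.
  exact: main_spec.
apply: (@strongly_polynomial_additive _ _ ((size prologue)%:P + f + 2%:P)) => E I.
eexists; apply: runs_ge (out E I).
by rewrite !hornerD !hornerC -fE addnA; exact: leqnn.
Qed.
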